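(* Let $\alpha := m n^{-1/3}$. As $n\to\infty$, $$\frac{\log G_{n,m}}{n^{2/3}} \sim G(\alpha) := r + \frac{\zeta(3)-2\eta_2(\alpha r)}{2r^2},$$ uniformly when $\alpha \gg n^{-1/3}$ (that is, uniformly when $m=m(n)\to\infty$), where $r=r(\alpha)>0$ solves the equation $$r^3-\zeta(3)+2\eta_2(\alpha r)-\alpha r\,\eta_2'(\alpha r)=0.$$ In particular, $$G(\alpha)\sim \begin{cases}\dfrac{\pi}{\sqrt6}\,\sqrt{\alpha}, & \text{if } \alpha\to0;\\[2mm] \dfrac32\,\zeta(3)^{1/3}, & \text{if }\alpha\to\infty.\end{cases}$$
   Context: Let $\mathbb{N}=\{0,1,2,\dots\}$ and, for a positive integer $m$, let $\mathbb{T}_m=\{(i,j)\in\mathbb{N}^2 : j\le i\le j+m-1\}$. A banded plane partition (BPP) of width $m$ is a function $f:\mathbb{T}_m\to\mathbb{N}$ with finite support such that for every $(i,j)\in\mathbb{T}_m$: $f(i,j)\ge f(i,j+1)$ whenever $(i,j+1)\in\mathbb{T}_m$, and $f(i,j)\ge f(i+1,j)$ whenever $(i+1,j)\in\mathbb{T}_m$. Its size is $\sum_{(i,j)\in\mathbb{T}_m} f(i,j)$, and $G_{n,m}$ denotes the number of BPPs of size $n$ and width $m$ (throughout, $m\ge 3$). By a theorem of Han and Xiong (known), $$\sum_{n\ge0}G_{n,m}z^n = G_m(z)=P(z)Q_m(z),\quad P(z)=\prod_{k\ge1}\frac1{1-z^k},\quad Q_m(z)=\prod_{k\ge0}\ \prod_{1\le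 h<j<m}\frac1{1-z^{2mk+h+j}}.$$ For $d\in\mathbb{N}$ and $\Re(z)>0$, $$\eta_d(z):=\sum_{\ell\ge1}\frac{e^{-\ell z}}{\ell^{2d-1}(1+e^{-\ell z})}.$$ $\zeta$ is the Riemann zeta function. *)

(* Defs.v *)
From mathcomp Require Export all_boot all_order all_algebra.
From mathcomp Require Export finmap.
From mathcomp Require Export all_classical all_reals all_analysis.

Set Implicit Arguments.
Unset Strict Implicit.
Unset Printing Implicit Defensive.

Import Order.TTheory GRing.Theory Num.Theory.
Import numFieldNormedType.Exports.

Local Open Scope classical_set_scope.
Local Open Scope ring_scope.

(* The index set T_m, for m >= 1 (the subtraction is truncated). *)
Definition band (m : nat) : Type :=
  {ij : nat * nat | (ij.2 <= ij.1 <= ij.2 + m - 1)%N}.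

Definition is_bpp (m : nat) (f : {fsfun band m -> nat with 0%N}) : Prop :=
  forall p q : band m,
    val q = ((val p).1, (val p).2.+1) \/ val q = ((val p).1.+1, (val p).2) ->
    (f q <= f p)%N.

Definition bpp_size (m : nat) (f : {fsfun band m -> nat with 0%N}) : nat :=
  (\sum_(p <- finsupp f) f p)%N.

(* [fset_set] sends an infinite set to the empty one.  This default is not
   used for m >= 2: then f (0, 0) is the largest entry of f, and an entry at
   p forces nonzero entries along a lattice path from (0, 0) to p, so only
   finitely many f have a given size. *)
Definition nbpp (n m : nat) : nat :=
  #|` fset_set [set f : {fsfun band m -> nat with 0%N} |
                 is_bpp f /\ bpp_size f = n]|%fset.

(* The Riemann zeta function at a real s > 1. *)
Definition zeta (R : realType) (s : R) : R :=
  limn (fun N => \sum_(1 <= l < N) (l%:R `^ s)^-1).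

(* The restriction of eta_d to the positive reals.  The exponent 2d - 1 is an
   integer, equal to -1 when d = 0. *)
Definition eta (R : realType) (d : nat) (x : R) : R :=
  limn (fun N => \sum_(1 <= l < N)
    expR (- (l%:R * x)) /
    ((l%:R : R) ^ (2 * d%:Z - 1) * (1 + expR (- (l%:R * x))))).

Definition alpha (R : realType) (n m : nat) : R :=
  m%:R * n%:R `^ (- (1 / 3)).

Definition saddle_eq (R : realType) (a r : R) : Prop :=
  r ^+ 3 - zeta 3 + 2 * eta 2 (a * r) - a * r * derive1 (@eta R 2) (a * r) = 0.

(* G(a), with r = r(a) as an argument. *)
Definition growth (R : realType) (a r : R) : R :=
  r + (zeta 3 - 2 * eta 2 (a * r)) / (2 * r ^+ 2).

(* Main.v *)
From HB Require Import structures.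
Require Import Defs.
From mathcomp Require Import zify ring lra.

Set Implicit Arguments.
Unset Strict Implicit.
Unset Printing Implicit Defensive.

Import Order.TTheory GRing.Theory Num.Theory.
Import numFieldNormedType.Exports.

Local Open Scope classical_set_scope.
Local Open Scope ring_scope.

(** The diagonals of a banded plane partition of width [m] are partitions
    [l_0, ..., l_(m-1)], each interlacing with the next.  Their generating
    function is therefore a product of transfer operators [up] between two
    free ends.  Reflecting every part of a partition in the interval that its
    two neighbours allow is a bijection ([ptoggle_bij]); it shows that [up] and
    [down] commute up to a scalar ([up_down]) and that a free end turns [up]
    into [down] ([up_one]).  Moving all operators through each other gives the
    functional equation [chain_gf_shift].  Iterated, it is the product formula
    of Han and Xiong with a remainder ([chain_gf_prod]), and for the present
    purpose it suffices that the remainder lies between [1] and the generating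
    function of all partitions.

    Put [q = exp (- t)].  The expansion of [- ln (1 - x)] turns the logarithm
    of the product into a sum over [l] of [l ^ -2] times a bounded closed form.
    As [m] tends to infinity and [t] to [0] this sum is asymptotic to the
    free energy [F = h (m t) / (2 t ^ 2)], where
    [h s = zeta 3 - 2 eta 2 s] is the sum of [tanh (l s / 2) / l ^ 3]:
    see [chain_upper], [wsum_pair_level_ge] and [gf_lower].

    For [t = r n ^ (- 1 / 3)] the saddle point equation says that [n] is minus
    the derivative of [F] at [t], and [n ^ (2 / 3)] times the growth function
    is [n t + F] ([saddle_scaling]).  The upper bound for the number [G_n] is
    Markov's ([ln_nbpp_le]).  For the lower bound, the concavity of [h] gives
    [F ((1 + e) t) <= F - e n t + 16 e ^ 2 F] ([free_energy_tilt]), whence by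
    Chernoff's argument the weights [G_k exp (- k t)] are concentrated on [k]
    close to [n].  As [G_k] is nondecreasing in [k] this bounds [G_k] from
    below for [k >= (1 + delta) n] ([nbpp_lower]).  To come back to [G_n]
    itself, apply this to [n' = n / (1 + delta)] and its own saddle point [t'];
    the upper bound at [t'] for an index a little above [n] shows that
    [n t + F] at the saddle point of [n] is not much larger than its analogue
    for [n'] and [t'] ([nbpp_asymptotics]).

    Finally [h s] tends to [zeta 3] at infinity, and [h s / s] tends to
    [zeta 2 / 2 = pi ^ 2 / 12] at [0] ([basel]); inserted in the saddle point
    equation, these give the two limits of the growth function. *)

(** * Integer partitions and interlacing *)

Record par := Par {
  part :> nat -> nat;
  part_noninc : forall i, (part i.+1 <= part i)%N;
  part_ev0 : exists N, part N == 0%N }.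

HB.instance Definition _ := gen_eqMixin par.
HB.instance Definition _ := gen_choiceMixin par.

Lemma parP (l m : par) : (forall i, l i = m i) -> l = m.
Proof.
case: l m => [l l1 l2] [m m1 m2] /= /funext lm.
subst m; congr Par; exact: Prop_irrelevance.
Qed.

Definition valid_par (f : nat -> nat) :=
  (forall i, (f i.+1 <= f i)%N) /\ exists N, f N == 0%N.

Lemma valid_par0 : valid_par (fun=> 0%N).
Proof. by split => //; exists 0%N. Qed.

Definition par0 : par := Par valid_par0.1 valid_par0.2.

(** Lets the maps below be defined on all sequences, with the junk value [par0]. *)
Definition mkpar (f : nat -> nat) : par :=
  match pselect (valid_par f) with
  | left h => Par h.1 h.2
  | right _ => par0
  end.

Lemma mkparE f : valid_par f -> mkpar f =1 f.
Proof. by move=> h i; rewrite /mkpar; case: pselect. Qed.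

Definition plen (l : par) : nat := ex_minn (part_ev0 l).
Definition psize (l : par) : nat := (\sum_(i < plen l) l i)%N.

Lemma part_le (l : par) i j : (i <= j)%N -> (l j <= l i)%N.
Proof.
move=> /subnK <-; elim: (j - i)%N => [|k IH] //.
by rewrite addSn (leq_trans (part_noninc l _)).
Qed.

Lemma plen0 (l : par) : l (plen l) = 0%N.
Proof. by rewrite /plen; case: ex_minnP => n /eqP. Qed.

Lemma part0_ge (l : par) N : (plen l <= N)%N -> l N = 0%N.
Proof. by move=> /(part_le l); rewrite plen0 leqn0 => /eqP. Qed.

Lemma psizeE (l : par) N : l N = 0%N -> psize l = (\sum_(i < N) l i)%N.
Proof.
move=> lN; rewrite /psize.
have lP : (plen l <= N)%N.
  by rewrite /plen; case: ex_minnP => n _; apply; rewrite lN.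
rewrite -(big_mkord predT (fun i => l i)) -(big_mkord predT (fun i => l i)).
rewrite [RHS](@big_cat_nat _ _ _ (plen l)) //= [X in (_ + X)%N]big_nat_cond.
rewrite [X in (_ + X)%N]big1 ?addn0 // => i /andP[/andP[li _] _]; apply/eqP.
by rewrite -leqn0 -(plen0 l) part_le.
Qed.

(** [interl a b] says that the skew shape [a / b] is a horizontal strip. *)
Definition interl (a b : nat -> nat) := forall i, (b i <= a i)%N /\ (a i.+1 <= b i)%N.

Lemma interl_size (a b : par) : interl a b -> (psize b <= psize a)%N.
Proof.
move=> ab; have b0 : b (plen a) = 0%N.
  by apply/eqP; rewrite -leqn0 -(plen0 a); case: (ab (plen a)).
rewrite (psizeE b0) /psize; apply: leq_sum => i _; by case: (ab i).
Qed.

Lemma interlxx (a : par) : interl a a.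
Proof. by move=> i; split => //; exact: part_noninc. Qed.

(** The parts of an upper neighbour of [mu] and [ka] other than the first,
    and the parts of a lower neighbour, range over the same intervals.  Each is
    sent to its mirror image; [k] is the excess of the unbounded first part. *)
Definition toggle (mu ka nu : nat -> nat) (k i : nat) : nat :=
  if i is j.+1 then (maxn (mu j.+1) (ka j.+1) + minn (mu j) (ka j) - nu j)%N
  else (maxn (mu 0) (ka 0) + k)%N.

Definition untoggle (mu ka la : nat -> nat) (i : nat) : nat :=
  (maxn (mu i.+1) (ka i.+1) + minn (mu i) (ka i) - la i.+1)%N.

Lemma toggle_valid (mu ka nu : par) k :
  interl mu nu -> interl ka nu -> valid_par (toggle mu ka nu k).
Proof.
move=> mn kn; split.
  case => [|i] /=.
    move: (mn 0%N) (kn 0%N) => [] ? ? [] ? ?; lia.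
  move: (mn i) (kn i) (mn i.+1) (kn i.+1) => [] ? ? [] ? ? [] ? ? [] ? ?.
  lia.
exists (maxn (plen mu) (plen ka)).+1 => /=.
set N := maxn (plen mu) (plen ka).
have h1 : mu N = 0%N by apply: part0_ge; exact: leq_maxl.
have h2 : ka N = 0%N by apply: part0_ge; exact: leq_maxr.
have := part_noninc mu N; have := part_noninc ka N.
rewrite h1 h2; lia.
Qed.

Lemma untoggle_valid (mu ka la : par) :
  interl la mu -> interl la ka -> valid_par (untoggle mu ka la).
Proof.
move=> lm lk; split.
  move=> i; rewrite /untoggle.
  move: (lm i) (lk i) (lm i.+1) (lk i.+1) (lm i.+2) (lk i.+2).
  by move=> [] ? ? [] ? ? [] ? ? [] ? ? [] ? ? [] ? ?; lia.
exists (maxn (plen mu) (plen ka)); rewrite /untoggle.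
set N := maxn (plen mu) (plen ka).
have h1 : mu N = 0%N by apply: part0_ge; exact: leq_maxl.
have h2 : ka N = 0%N by apply: part0_ge; exact: leq_maxr.
have := part_noninc mu N; have := part_noninc ka N.
rewrite h1 h2; lia.
Qed.

Definition ptoggle (mu ka : par) (p : par * nat) : par := mkpar (toggle mu ka p.1 p.2).

(** The local move behind the Cauchy identity for skew Schur functions: both
    sides are sets of sequences that are free in a product of intervals, which
    the reflection matches. *)
Lemma ptoggle_bij (mu ka : par) :
  set_bij ([set nu : par | interl mu nu /\ interl ka nu] `*` [set: nat])
          [set la : par | interl la mu /\ interl la ka] (ptoggle mu ka).
Proof.
split.
- move=> [nu k] /= [[mn kn] _].
  have E := mkparE (toggle_valid k mn kn).
  split=> i; rewrite /ptoggle /= !E; case: i => [|i] /=.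
  + by move: (mn 0%N) (kn 0%N) => [] ? ? [] ? ?; lia.
  + by move: (mn i) (kn i) (mn i.+1) (kn i.+1) => [] ? ? [] ? ? [] ? ? [] ? ?; lia.
  + by move: (mn 0%N) (kn 0%N) => [] ? ? [] ? ?; lia.
  + by move: (mn i) (kn i) (mn i.+1) (kn i.+1) => [] ? ? [] ? ? [] ? ? [] ? ?; lia.
- move=> [nu k] [nu' k'] /set_mem /= [[mn kn] _] /set_mem /= [[mn' kn'] _].
  rewrite /ptoggle /= => E.
  have {}E i : toggle mu ka nu k i = toggle mu ka nu' k' i.
    by rewrite -(mkparE (toggle_valid k mn kn)) E mkparE //; exact: toggle_valid.
  congr pair; last by have := E 0%N => /=; lia.
  apply: parP => i; have := E i.+1 => /=.
  by move: (mn i) (kn i) (mn' i) (kn' i) => [] ? ? [] ? ? [] ? ? [] ? ?; lia.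
- move=> la /= [lm lk].
  have E := mkparE (untoggle_valid lm lk).
  have a1 : interl mu (mkpar (untoggle mu ka la)).
    move=> i; rewrite E /untoggle.
    by move: (lm i) (lk i) (lm i.+1) (lk i.+1) => [] ? ? [] ? ? [] ? ? [] ? ?; lia.
  have a2 : interl ka (mkpar (untoggle mu ka la)).
    move=> i; rewrite E /untoggle.
    by move: (lm i) (lk i) (lm i.+1) (lk i.+1) => [] ? ? [] ? ? [] ? ? [] ? ?; lia.
  exists (mkpar (untoggle mu ka la), (la 0 - maxn (mu 0) (ka 0))%N) => //=.
  apply: parP => i; rewrite /ptoggle mkparE /=; last exact: toggle_valid.
  case: i => [|i] /=.
    by move: (lm 0%N) (lk 0%N) => [] ? ? [] ? ?; lia.
  rewrite E /untoggle.
  by move: (lm i) (lk i) (lm i.+1) (lk i.+1) => [] ? ? [] ? ? [] ? ? [] ? ?; lia.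
Qed.

(** The maxima and minima of [mu i] and [ka i] add up to [mu i + ka i], so
    reflecting all parts gives a relation between sizes only. *)
Lemma ptoggle_size (mu ka nu : par) k : interl mu nu -> interl ka nu ->
  (psize (ptoggle mu ka (nu, k)) + psize nu = k + psize mu + psize ka)%N.
Proof.
move=> mn kn; rewrite /ptoggle.
have E := mkparE (toggle_valid k mn kn).
set la := mkpar _ in E *.
set N := maxn (plen mu) (plen ka).
have h1 : mu N = 0%N by apply: part0_ge; exact: leq_maxl.
have h2 : ka N = 0%N by apply: part0_ge; exact: leq_maxr.
have h3 : nu N = 0%N by move: (mn N); rewrite h1 => -[? ?]; lia.
have h4 : la N.+1 = 0%N.
  rewrite E /= h1 h2.
  by have := part_noninc mu N; have := part_noninc ka N; rewrite h1 h2; lia.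
rewrite (psizeE h4) (psizeE h1) (psizeE h2) (psizeE h3).
rewrite big_ord_recl (eq_bigr (fun i : 'I_N => la i.+1)) // E /=.
have step n : (\sum_(i < n) la i.+1 + \sum_(i < n) nu i + maxn (mu 0) (ka 0)
   = \sum_(i < n) mu i + \sum_(i < n) ka i + maxn (mu n) (ka n))%N.
  elim: n => [|n IH]; first by rewrite !big_ord0.
  rewrite !big_ord_recr /= E /=.
  case: (mn n) (kn n) => [? ?] [? ?]; move: IH.
  by do 4! [move: (bigop.body _ _ _) => ?]; lia.
move: (step N); rewrite h1 h2 maxnn; clearbody N.
by do 4! [move: (bigop.body _ _ _) => ?]; lia.
Qed.

(** * Sums of non-negative families *)

Section esums.
Local Open Scope ereal_scope.
Variable R : realType.

Lemma esum_subset (T : choiceType) (A B : set T) (f : T -> \bar R) :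
  A `<=` B -> \esum_(i in A) f i <= \esum_(i in B) f i.
Proof.
move=> AB; apply: ge_ereal_sup => _ [X [finX XA] <-].
by apply: ereal_sup_ubound; exists X => //; split => // i /XA/AB.
Qed.

Lemma esum_ge_term (T : choiceType) (A : set T) (f : T -> \bar R) i :
  A i -> 0 <= f i -> f i <= \esum_(j in A) f j.
Proof.
move=> Ai f0; rewrite -{1}(@esum_set1 _ _ i f) //.
by apply: esum_subset => j ->.
Qed.

Lemma le_esumZ (T : choiceType) (A : set T) (c : \bar R) (f : T -> \bar R) :
  0 <= c -> (forall i, A i -> 0 <= f i) ->
  \esum_(i in A) (c * f i) <= c * \esum_(i in A) f i.
Proof.
move=> c0 f0; apply: ge_ereal_sup => _ [X [finX XA] <-].
rewrite fsbig_finite //= big_seq.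
rewrite -ge0_sume_distrr; last first.
  by move=> i; rewrite in_fset_set // inE => /XA; exact: f0.
apply: lee_pmul => //.
  by apply: sume_ge0 => i; rewrite in_fset_set // inE => /XA; exact: f0.
by rewrite -big_seq -fsbig_finite //; apply: ereal_sup_ubound; exists X.
Qed.

Lemma esumZ (T : choiceType) (A : set T) (c : \bar R) (f : T -> \bar R) :
  0 <= c -> (forall i, A i -> 0 <= f i) ->
  \esum_(i in A) (c * f i) = c * \esum_(i in A) f i.
Proof.
move=> c0 f0; apply/eqP; rewrite eq_le le_esumZ //=.
case: c c0 => [c||//]; last first.
  move=> _.
  have [A0|/existsNP [i /not_implyP[Ai /eqP fi]]] := pselect (forall i, A i -> f i = 0).
    by rewrite esum1 // mule0 esum_ge0 // => i Ai; rewrite (A0 _ Ai) mule0.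
  apply: le_trans (leey _) _.
  apply: le_trans (@esum_ge_term _ A (fun i => +oo * f i) i Ai _).
    by rewrite gt0_mulye // lt_neqAle eq_sym fi f0.
  by rewrite mule_ge0 // f0.
rewrite lee_fin; have [->|cn0] := eqVneq c 0%R => c0.
  by rewrite mul0e esum_ge0 // => i _; rewrite mul0e.
have {cn0}c0 : (0 < c)%R by rewrite lt_neqAle eq_sym cn0.
rewrite muleC -lee_pdivlMr // muleC.
apply: le_trans (le_esumZ _ _); last 2 first.
- by rewrite lee_fin invr_ge0 ltW.
- by move=> i Ai; rewrite mule_ge0 ?lee_fin ?(ltW c0) ?f0.
by apply: le_esum => i Ai; rewrite muleA -EFinM mulVf ?gt_eqF // mul1e.
Qed.

(** Tonelli's theorem for a sum over the pairs of a relation, read from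
    either side. *)
Lemma esum_swap (S T : choiceType) (A : set S) (B : S -> set T)
    (f : S -> T -> \bar R) :
  (forall i j, 0 <= f i j) ->
  \esum_(i in A) \esum_(j in B i) f i j =
  \esum_(j in [set: T]) \esum_(i in [set i | A i /\ B i j]) f i j.
Proof.
move=> f0; rewrite !esum_esum //.
rewrite [RHS](reindex_esum (A `*`` B) _ (fun p => (p.2, p.1))) //.
split.
- by move=> [i j] [/= ? ?].
- by move=> [i j] [i' j'] _ _ /= [-> ->].
- by move=> [j i] /= [_ [? ?]]; exists (i, j).
Qed.

Lemma esum_geometric (x : R) : (0 <= x < 1)%R ->
  \esum_(k in [set: nat]) (x ^+ k)%:E = ((1 - x)^-1)%:E.
Proof.
move=> /andP[x0 x1].
rewrite -nneseries_esumT; last by move=> n; rewrite lee_fin exprn_ge0.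
apply: cvg_lim => //.
have -> : (fun n => \sum_(0 <= i < n) (x ^+ i)%:E) = EFin \o series (geometric 1%R x).
  apply/funext => n /=; rewrite sumEFin; congr EFin; apply: eq_bigr => i _.
  by rewrite /geometric /= mul1r.
apply: cvg_EFin; first exact: nearW.
rewrite -[(1 - x)^-1%R]mul1r.
by apply: cvg_geometric_series; rewrite ger0_norm.
Qed.

Lemma esum_prod (S T : choiceType) (A : set S) (B : set T)
    (a : S -> \bar R) (b : T -> \bar R) :
  (forall i, 0 <= a i) -> (forall j, 0 <= b j) ->
  \esum_(p in A `*` B) (a p.1 * b p.2) =
  (\esum_(i in A) a i) * \esum_(j in B) b j.
Proof.
move=> a0 b0.
rewrite -(@esum_esum _ _ _ A (fun=> B) (fun i j => a i * b j)); last first.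
  by move=> i j _ _; rewrite mule_ge0.
rewrite muleC -esumZ ?esum_ge0 //.
by apply: eq_esum => i _; rewrite esumZ // muleC.
Qed.

End esums.

(** * The transfer operators *)

Section transfer.
Local Open Scope ereal_scope.
Variable R : realType.
Implicit Types (x y u : R) (f g : par -> \bar R) (mu ka la nu : par) (xs : seq R).

Definition strip_weight x la mu : \bar R := (x ^+ (psize la - psize mu))%:E.

(** One step to a larger partition along a horizontal strip, weighted by [x]
    to the power of the number of cells of the strip. *)
Definition up x f mu := \esum_(la in [set la : par | interl la mu]) (strip_weight x la mu * f la).
Definition down x f mu := \esum_(ka in [set ka : par | interl mu ka]) (strip_weight x mu ka * f ka).

Lemma strip_weight_ge0 x la mu : (0 <= x)%R -> 0 <= strip_weight x la mu.
Proof. by move=> x0; rewrite lee_fin exprn_ge0. Qed.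

Lemma up_ge0 x f mu : (0 <= x)%R -> (forall l, 0 <= f l) -> 0 <= up x f mu.
Proof. by move=> x0 f0; apply: esum_ge0 => l _; rewrite mule_ge0 // strip_weight_ge0. Qed.

Lemma down_ge0 x f mu : (0 <= x)%R -> (forall l, 0 <= f l) -> 0 <= down x f mu.
Proof. by move=> x0 f0; apply: esum_ge0 => l _; rewrite mule_ge0 // strip_weight_ge0. Qed.

Lemma eq_up x f g : f =1 g -> up x f =1 up x g.
Proof. by move=> fg mu; apply: eq_esum => l _; rewrite fg. Qed.

Lemma eq_down x f g : f =1 g -> down x f =1 down x g.
Proof. by move=> fg mu; apply: eq_esum => l _; rewrite fg. Qed.

Lemma upZ x (c : R) f mu : (0 <= x)%R -> (0 <= c)%R -> (forall l, 0 <= f l) ->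
  up x (fun l => c%:E * f l) mu = c%:E * up x f mu.
Proof.
move=> x0 c0 f0; rewrite /up -esumZ ?lee_fin //; last first.
  by move=> l _; rewrite mule_ge0 // strip_weight_ge0.
by apply: eq_esum => l _; rewrite muleCA.
Qed.

Lemma downZ x (c : R) f mu : (0 <= x)%R -> (0 <= c)%R -> (forall l, 0 <= f l) ->
  down x (fun l => c%:E * f l) mu = c%:E * down x f mu.
Proof.
move=> x0 c0 f0; rewrite /down -esumZ ?lee_fin //; last first.
  by move=> l _; rewrite mule_ge0 // strip_weight_ge0.
by apply: eq_esum => l _; rewrite muleCA.
Qed.

(** Summing over the excess [k] in [ptoggle_bij] produces the geometric
    series in [x * y]. *)
Lemma toggle_sum x y mu ka : (0 <= x)%R -> (0 <= y)%R -> (x * y < 1)%R ->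
  \esum_(la in [set la : par | interl la mu /\ interl la ka]) (strip_weight x la mu * strip_weight y la ka) =
  ((1 - x * y)^-1)%:E *
  \esum_(nu in [set nu : par | interl mu nu /\ interl ka nu]) (strip_weight x ka nu * strip_weight y mu nu).
Proof.
move=> x0 y0 xy1.
rewrite (reindex_esum _ _ _ _ (ptoggle_bij mu ka)).
rewrite (eq_esum (b := fun p => (x ^+ (psize ka - psize p.1) * y ^+ (psize mu - psize p.1))%:E
     * ((x * y) ^+ p.2)%:E)); last first.
  move=> [nu k] [/= [mn kn] _].
  have := ptoggle_size k mn kn; move: (interl_size mn) (interl_size kn) => ? ? E.
  rewrite /strip_weight -!EFinM; congr EFin.
  rewrite (_ : (_ - psize mu)%N = (k + (psize ka - psize nu))%N); last by lia.
  rewrite (_ : (psize (ptoggle _ _ _) - psize ka)%N = (k + (psize mu - psize nu))%N); last by lia.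
  by rewrite !exprD exprMn; ring.
rewrite (@esum_prod _ _ _ _ _ (fun nu : par => (x ^+ (psize ka - psize nu) * y ^+ (psize mu - psize nu))%:E)
  (fun k => ((x * y) ^+ k)%:E)); last 2 first.
- by move=> nu; rewrite lee_fin mulr_ge0 // exprn_ge0.
- by move=> k; rewrite lee_fin exprn_ge0 // mulr_ge0.
rewrite esum_geometric; last by rewrite mulr_ge0.
by rewrite muleC; congr (_ * _); apply: eq_esum => nu _; rewrite EFinM.
Qed.

(** Fix the two end partitions: the intermediate one ranges over the common
    upper neighbours on the left and over the common lower neighbours on the
    right, and [toggle_sum] compares the two. *)
Lemma up_down x y f mu : (0 <= x)%R -> (0 <= y)%R -> (x * y < 1)%R ->
  (forall l, 0 <= f l) ->
  up x (down y f) mu = ((1 - x * y)^-1)%:E * down y (up x f) mu.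
Proof.
move=> x0 y0 xy1 f0.
have c0 : (0 <= (1 - x * y)^-1)%R by rewrite invr_ge0 subr_ge0 ltW.
rewrite /up /down.
rewrite (eq_esum (b := fun la => \esum_(ka in [set ka : par | interl la ka])
   (strip_weight x la mu * strip_weight y la ka * f ka))); last first.
  move=> la _; rewrite -esumZ ?strip_weight_ge0 //; last first.
    by move=> ka _; rewrite mule_ge0 // strip_weight_ge0.
  by apply: eq_esum => ka _; rewrite muleA.
rewrite esum_swap; last by move=> la ka; rewrite !mule_ge0 // strip_weight_ge0.
rewrite [X in _ = _ * X](eq_esum (b := fun nu => \esum_(ka in [set ka : par | interl ka nu])
   (strip_weight x ka nu * strip_weight y mu nu * f ka))); last first.
  move=> la _; rewrite -esumZ ?strip_weight_ge0 //; last first.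
    by move=> ka _; rewrite mule_ge0 // strip_weight_ge0.
  by apply: eq_esum => ka _; rewrite muleA [strip_weight y _ _ * _]muleC.
rewrite [X in _ = _ * X]esum_swap; last by move=> la ka; rewrite !mule_ge0 // strip_weight_ge0.
rewrite -esumZ //; last first.
  by move=> ka _; apply: esum_ge0 => nu _; rewrite !mule_ge0 // strip_weight_ge0.
apply: eq_esum => ka _.
under eq_esum do rewrite muleC.
under [in RHS]eq_esum do rewrite muleC.
rewrite !esumZ //; first by rewrite toggle_sum // muleCA.
- by move=> nu _; rewrite !mule_ge0 // strip_weight_ge0.
- by move=> nu _; rewrite !mule_ge0 // strip_weight_ge0.
Qed.

End transfer.

(** * The generating function of chains *)

Section words.
Local Open Scope ereal_scope.
Variable R : realType.
Implicit Types (x y u c : R) (f g : par -> \bar R) (mu ka la nu : par) (xs : seq R).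

Definition ups xs f := foldl (fun g x => up x g) f xs.
Definition downs xs f := foldr (@down R) f xs.

Definition one_fun : par -> \bar R := fun=> 1.

(** The product of the [1 / (1 - x_i)] and of the [1 / (1 - x_i x_j)] with
    [i < j], that is the sum of all Schur functions in the variables [xs]. *)
Fixpoint cauchy_factor xs : R :=
  if xs is x :: xs' then
    ((1 - x)^-1 * (\prod_(y <- xs') (1 - y * x)^-1) * cauchy_factor xs')%R
  else 1%R.

Definition in01 := [pred x : R | (0 <= x < 1)%R].

Lemma one_fun_ge0 l : 0 <= one_fun l. Proof. by rewrite /one_fun. Qed.

Lemma eq_ups xs f g : f =1 g -> ups xs f =1 ups xs g.
Proof.
elim: xs f g => [|x xs IH] f g fg //=; apply: IH; exact: eq_up.
Qed.

Lemma ups_ge0 xs f : all in01 xs -> (forall l, 0 <= f l) -> forall mu, 0 <= ups xs f mu.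
Proof.
elim: xs f => [|x xs IH] f //= /andP[/andP[x0 _] axs] f0; apply: IH => // l.
exact: up_ge0.
Qed.

Lemma downs_ge0 xs f : all in01 xs -> (forall l, 0 <= f l) -> forall mu, 0 <= downs xs f mu.
Proof.
move=> + f0; elim: xs => [|x xs IH] //= /andP[/andP[x0 _] axs] mu.
by apply: down_ge0 => // l; exact: IH.
Qed.

Lemma upsZ xs c f : all in01 xs -> (0 <= c)%R -> (forall l, 0 <= f l) ->
  ups xs (fun l => c%:E * f l) =1 fun mu => c%:E * ups xs f mu.
Proof.
move=> + c0; elim: xs f => [|x xs IH] f //= /andP[/andP[x0 _] axs] f0 mu.
rewrite -IH //; last by move=> l; exact: up_ge0.
by apply: eq_ups => l; rewrite upZ.
Qed.

Lemma in01M x y : in01 x -> in01 y -> (x * y < 1)%R.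
Proof.
move=> /andP[x0 x1] /andP[y0 y1].
by apply: le_lt_trans y1; rewrite ler_piMl // ltW.
Qed.

Lemma in01_invB1 x : (x < 1)%R -> (0 <= (1 - x)^-1)%R.
Proof. by move=> x1; rewrite invr_ge0 subr_ge0 ltW. Qed.

Lemma ups_down xs x f mu : all in01 xs -> in01 x -> (forall l, 0 <= f l) ->
  ups xs (down x f) mu = (\prod_(y <- xs) (1 - y * x)^-1)%:E * down x (ups xs f) mu.
Proof.
move=> + x01; elim: xs f mu => [|y xs IH] f mu /=; first by rewrite big_nil mul1e.
move=> /andP[y01 axs] f0; have /andP[x0 x1] := x01; have /andP[y0 y1] := y01.
have yx := in01M y01 x01.
rewrite (@eq_ups _ _ (fun l => ((1 - y * x)^-1)%:E * down x (up y f) l)); last first.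
  by move=> l; rewrite up_down.
rewrite upsZ //; [|exact: in01_invB1|by move=> l; apply: down_ge0 => // l'; apply: up_ge0].
rewrite IH //; last by move=> l; exact: up_ge0.
by rewrite muleA -EFinM big_cons.
Qed.

(** Reflection at a free end: the case [ka = mu], [y = 1] of [toggle_sum]. *)
Lemma up_one x mu : in01 x -> up x one_fun mu = ((1 - x)^-1)%:E * down x one_fun mu.
Proof.
move=> /andP[x0 x1]; have := @toggle_sum R x 1 mu mu x0 ler01.
rewrite mulr1 => /(_ x1) E; rewrite /up /down.
rewrite [LHS](_ : _ = \esum_(la in [set la : par | interl la mu /\ interl la mu])
    (strip_weight x la mu * strip_weight 1 la mu)); last first.
  rewrite (_ : [set la : par | interl la mu /\ interl la mu] = [set la : par | interl la mu]).
    by apply: eq_esum => l _; rewrite /one_fun /strip_weight expr1n.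
  by apply/seteqP; split => l /= => [[]|].
rewrite E; congr (_ * _).
rewrite (_ : [set la : par | interl mu la /\ interl mu la] = [set la : par | interl mu la]).
  by apply: eq_esum => l _; rewrite /one_fun /strip_weight expr1n.
by apply/seteqP; split => l /= => [[]|].
Qed.

Lemma prod_inv_ge0 xs x : all in01 xs -> in01 x -> (0 <= \prod_(y <- xs) (1 - y * x)^-1)%R.
Proof.
move=> /allP axs x01; rewrite big_seq; apply: prodr_ge0 => y /axs y01.
exact/in01_invB1/in01M.
Qed.

Lemma cauchy_factor_ge0 xs : all in01 xs -> (0 <= cauchy_factor xs)%R.
Proof.
elim: xs => [|x xs IH] //= /andP[x01 axs].
have /andP[x0 x1] := x01.
by rewrite !mulr_ge0 ?IH ?prod_inv_ge0 ?in01_invB1.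
Qed.

(** Starting from the free end, every operator is reflected and then moved
    past those that follow it. *)
Lemma ups_one xs mu : all in01 xs ->
  ups xs one_fun mu = (cauchy_factor xs)%:E * downs xs one_fun mu.
Proof.
elim: xs mu => [|x xs IH] mu /=; first by rewrite mul1e.
move=> /andP[x01 axs]; have /andP[x0 x1] := x01.
rewrite (@eq_ups _ _ (fun l => ((1 - x)^-1)%:E * down x one_fun l)); last first.
  by move=> l; rewrite up_one.
rewrite upsZ //; [|exact: in01_invB1|by move=> l; apply: down_ge0].
rewrite ups_down //.
rewrite (@eq_down _ _ _ (fun l => (cauchy_factor xs)%:E * downs xs one_fun l)); last first.
  by move=> l; rewrite IH.
rewrite downZ //; [|exact: cauchy_factor_ge0|exact: downs_ge0].
by rewrite !muleA -!EFinM.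
Qed.

Definition pairing g f := \esum_(mu in [set: par]) (g mu * f mu).

(** The operators [up x] and [down x] are adjoint. *)
Lemma pairing_down g x f : (0 <= x)%R -> (forall l, 0 <= g l) -> (forall l, 0 <= f l) ->
  pairing g (down x f) = pairing (up x g) f.
Proof.
move=> x0 g0 f0; rewrite /pairing /down /up.
rewrite (eq_esum (b := fun mu => \esum_(ka in [set ka : par | interl mu ka])
  (strip_weight x mu ka * g mu * f ka))); last first.
  move=> mu _; rewrite -esumZ //; last by move=> *; rewrite mule_ge0 // strip_weight_ge0.
  by apply: eq_esum => ka _; rewrite muleA [g _ * _]muleC.
rewrite esum_swap; last by move=> *; rewrite !mule_ge0 // strip_weight_ge0.
apply: eq_esum => ka _.
rewrite muleC -esumZ //; last by move=> *; rewrite mule_ge0 // strip_weight_ge0.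
rewrite (_ : [set i : par | _] = [set l : par | interl l ka]).
  by apply: eq_esum => l _; rewrite muleC.
by apply/seteqP; split => l /= => [[]|].
Qed.

Lemma pairing_downs g xs f : all in01 xs -> (forall l, 0 <= g l) -> (forall l, 0 <= f l) ->
  pairing g (downs xs f) = pairing (ups xs g) f.
Proof.
move=> + + f0; elim: xs g => [|x xs IH] g //= /andP[/andP[x0 _] axs] g0.
rewrite pairing_down //; last exact: downs_ge0.
by rewrite IH // => l; exact: up_ge0.
Qed.

Definition psizeX u mu : \bar R := (u ^+ psize mu)%:E.

Lemma psizeX_ge0 u mu : (0 <= u)%R -> 0 <= psizeX u mu.
Proof. by move=> u0; rewrite lee_fin exprn_ge0. Qed.

(** A weight [u] per cell moved across a strip multiplies the variable of
    that strip by [u]. *)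
Lemma up_psizeX u x f mu : (0 <= u)%R -> (0 <= x)%R -> (forall l, 0 <= f l) ->
  up x (fun l => psizeX u l * f l) mu = psizeX u mu * up (u * x)%R f mu.
Proof.
move=> u0 x0 f0; rewrite /up -esumZ ?psizeX_ge0 //; last first.
  by move=> l _; rewrite mule_ge0 // strip_weight_ge0 // mulr_ge0.
apply: eq_esum => l /= /interl_size ml; rewrite !muleA; congr (_ * _).
rewrite /strip_weight /psizeX -!EFinM; congr EFin.
by rewrite exprMn mulrCA mulrA -exprD subnK // mulrC.
Qed.

Lemma ups_psizeX u xs f mu : (0 <= u)%R -> all in01 xs -> (forall l, 0 <= f l) ->
  ups xs (fun l => psizeX u l * f l) mu = psizeX u mu * ups [seq u * x | x <- xs]%R f mu.
Proof.
move=> u0; elim: xs f mu => [|x xs IH] f mu //= /andP[/andP[x0 _] axs] f0.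
rewrite (@eq_ups _ _ (fun l => psizeX u l * up (u * x)%R f l)); last first.
  by move=> l; rewrite up_psizeX.
by rewrite IH // => l; apply: up_ge0 => //; rewrite mulr_ge0.
Qed.

(** Chains with a free last partition, counted with weight [u] per cell of
    the last partition and with the variables [xs] for the strips. *)
Definition chain_gf xs u := pairing (psizeX u) (ups xs one_fun).

(** Reflect all operators at the first free end, then use adjunction to
    reflect them at the other one: the same chains come back, with the
    variables multiplied by [u]. *)
Lemma chain_gf_shift xs u : in01 u -> all in01 xs ->
  chain_gf xs u = (cauchy_factor xs)%:E * chain_gf [seq u * x | x <- xs]%R u.
Proof.
move=> /andP[u0 u1] axs; rewrite /chain_gf.
transitivity ((cauchy_factor xs)%:E * pairing (psizeX u) (downs xs one_fun)).
  rewrite /pairing -esumZ; last 2 first.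
  - by rewrite lee_fin cauchy_factor_ge0.
  - by move=> l _; rewrite mule_ge0 ?psizeX_ge0 // downs_ge0.
  by apply: eq_esum => l _; rewrite ups_one // muleCA.
congr (_ * _); rewrite pairing_downs //; last by move=> l; exact: psizeX_ge0.
apply: eq_esum => l _; rewrite /one_fun mule1.
rewrite -ups_psizeX //; apply: eq_ups => l'.
by rewrite mule1.
Qed.

Lemma in01_scale u xs : in01 u -> all in01 xs -> all in01 [seq u * x | x <- xs]%R.
Proof.
move=> /andP[u0 u1] /allP axs; apply/allP => _ /mapP[x /axs x01 ->].
rewrite /in01 /= in01M ?inE ?u0 //.
by move: x01 => /andP[x0 _]; rewrite mulr_ge0.
Qed.

Lemma scale_iter u xs K :
  [seq u ^+ K.+1 * x | x <- xs]%R = [seq u ^+ K * x | x <- [seq u * x | x <- xs]]%R.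
Proof. by rewrite -map_comp; apply: eq_map => x /=; rewrite exprSr mulrA. Qed.

Lemma chain_gf_prod xs u K : in01 u -> all in01 xs ->
  chain_gf xs u = (\prod_(k < K) cauchy_factor [seq u ^+ k * x | x <- xs]%R)%:E
     * chain_gf [seq u ^+ K * x | x <- xs]%R u.
Proof.
move=> u01; elim: K xs => [|K IH] xs axs.
  rewrite big_ord0 mul1e; congr (chain_gf _ u).
  by rewrite -[LHS]map_id; apply: eq_map => x; rewrite expr0 mul1r.
rewrite chain_gf_shift // (IH [seq u * x | x <- xs]%R) ?in01_scale // -scale_iter.
rewrite muleA -EFinM; congr (_%:E * _).
rewrite big_ord_recl; congr (_ * _)%R.
  by congr cauchy_factor; rewrite -[LHS]map_id; apply: eq_map => x; rewrite expr0 mul1r.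
by apply: eq_bigr => k _; rewrite -scale_iter.
Qed.

Lemma up_ge x f mu : (0 <= x)%R -> (forall l, 0 <= f l) -> f mu <= up x f mu.
Proof.
move=> x0 f0.
have := @esum_ge_term R _ [set la : par | interl la mu] (fun la => strip_weight x la mu * f la) mu.
rewrite /strip_weight subnn expr0 mul1e; apply; [exact: interlxx|exact: f0].
Qed.

Lemma ups_ge xs f mu : all in01 xs -> (forall l, 0 <= f l) -> f mu <= ups xs f mu.
Proof.
elim: xs f => [|x xs IH] f //= /andP[/andP[x0 _] axs] f0.
apply: (le_trans (up_ge mu x0 f0)); apply: IH => // l; exact: up_ge0.
Qed.

Lemma psize0 : psize par0 = 0%N.
Proof. by rewrite /psize big1. Qed.

Lemma chain_gf_ge1 xs u : in01 u -> all in01 xs -> 1 <= chain_gf xs u.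
Proof.
move=> /andP[u0 _] axs; rewrite /chain_gf /pairing.
have := @esum_ge_term R _ [set: par] (fun mu => psizeX u mu * ups xs one_fun mu) par0 I.
rewrite /psizeX psize0 expr0 mul1e => h.
apply: le_trans (h _); last exact: ups_ge0.
exact: (ups_ge par0 axs one_fun_ge0).
Qed.

Definition pshift (l : par) : par :=
  Par (fun i => part_noninc l i.+1)
      (ex_intro _ (plen l) (introT eqP (part0_ge (leqnSn (plen l))))).

Lemma psize_shift l : psize l = (l 0%N + psize (pshift l))%N.
Proof.
rewrite (psizeE (N := (plen l).+1)); last exact: part0_ge.
rewrite big_ord_recl (psizeE (N := plen l)) //=.
exact: part0_ge.
Qed.

Lemma interl_shift (a b : par) : interl a b -> interl (pshift a) (pshift b).
Proof. by move=> ab i; exact: (ab i.+1). Qed.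

(** The first part of the smaller partition takes at most one value for each
    number of removed cells; the remaining parts interlace with the shifted
    partition. *)
Lemma down_one_shift x mu : in01 x ->
  down x one_fun mu <= ((1 - x)^-1)%:E * down x one_fun (pshift mu).
Proof.
move=> x01; have /andP[x0 x1] := x01.
rewrite -esum_geometric // /down.
rewrite -esum_prod; last 2 first.
- by move=> k; rewrite lee_fin exprn_ge0.
- by move=> l; rewrite mule_ge0 // strip_weight_ge0.
pose e (l : par) := ((mu 0 - l 0)%N, pshift l).
rewrite (eq_esum (b := fun l => (x ^+ (e l).1)%:E * (strip_weight x (pshift mu) (e l).2 * one_fun (e l).2))); last first.
  move=> l /= ml; rewrite muleA; congr (_ * _); rewrite /strip_weight -EFinM -exprD.
  congr ((x ^+ _)%:E); rewrite !(psize_shift mu) !(psize_shift l).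
  have := interl_size (interl_shift ml); have := (ml 0%N).1; lia.
rewrite -(@esum_image _ _ _ _ e (fun p => (x ^+ p.1)%:E * (strip_weight x (pshift mu) p.2 * one_fun p.2))).
  by apply: esum_subset => _ [l /= ml <-] /=; split => //; exact: interl_shift.
move=> l l' /set_mem /= ml /set_mem /= ml' [E0 E1]; apply: parP => -[|i].
  have := (ml 0%N).1; have := (ml' 0%N).1; lia.
exact: (congr1 (fun h => h i) E1).
Qed.

Lemma down_one_le x mu : in01 x -> down x one_fun mu <= (((1 - x)^-1) ^+ psize mu)%:E.
Proof.
move=> x01; have /andP[x0 x1] := x01.
have c1 : (1 <= (1 - x)^-1)%R by rewrite invf_ge1 ?gerBl // subr_gt0.
have [n] := ubnP (psize mu); elim: n mu => // n IH mu mun.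
have [mu0|mu0] := eqVneq (mu 0%N) 0%N.
  have -> : mu = par0.
    by apply: parP => i; apply/eqP; rewrite -leqn0 /= -mu0 part_le.
  rewrite psize0 expr0 /down (_ : [set ka : par | _] = [set par0]).
    by rewrite esum_set1 /strip_weight /one_fun ?subnn ?expr0 ?mul1e.
  apply/seteqP; split => l /= => [il|-> i] //.
  by apply: parP => i; apply/eqP; rewrite -leqn0; exact: (il i).1.
apply: le_trans (down_one_shift mu x01) _.
have := psize_shift mu => E.
apply: le_trans (_ : ((1 - x)^-1)%:E * (((1 - x)^-1) ^+ psize (pshift mu))%:E <= _).
  by apply: lee_wpmul2l; [rewrite lee_fin in01_invB1|apply: IH; lia].
rewrite -EFinM lee_fin -exprS; apply: ler_weXn2l => //; lia.
Qed.

Lemma downs_one_le xs mu : all in01 xs ->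
  downs xs one_fun mu <= ((\prod_(x <- xs) (1 - x)^-1) ^+ psize mu)%:E.
Proof.
elim: xs mu => [|x xs IH] mu /=; first by rewrite big_nil expr1n.
move=> /andP[x01 axs]; have /andP[x0 x1] := x01.
set c := (\prod_(y <- xs) _)%R in IH *.
have c1 : (1 <= c)%R.
  rewrite /c big_seq; elim/big_ind : _ => //.
    by move=> a b a1 b1; rewrite -[1%R]mulr1 ler_pM.
  move=> y /(allP axs) /andP[y0 y1]; by rewrite invf_ge1 ?gerBl // subr_gt0.
have c0 : (0 <= c)%R by rewrite (le_trans ler01).
apply: le_trans (_ : (c ^+ psize mu)%:E * down x one_fun mu <= _).
  rewrite /down -esumZ; last 2 first.
  - by rewrite lee_fin exprn_ge0.
  - by move=> l _; rewrite mule_ge0 // strip_weight_ge0.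
  apply: le_esum => l /= ml; rewrite muleCA; apply: lee_wpmul2l; first exact: strip_weight_ge0.
  rewrite mule1; apply: le_trans (IH _ axs) _; rewrite lee_fin.
  by apply: ler_weXn2l => //; exact: interl_size.
rewrite big_cons exprMn EFinM muleC; apply: lee_wpmul2r; first by rewrite lee_fin exprn_ge0.
exact: down_one_le.
Qed.

(** Used only for variables close to [0], where the product on the right is
    close to [1]. *)
Lemma chain_gf_le xs u : in01 u -> all in01 xs ->
  chain_gf xs u <= (cauchy_factor xs)%:E *
    \esum_(mu in [set: par]) psizeX (u * \prod_(x <- xs) (1 - x)^-1) mu.
Proof.
move=> /andP[u0 u1] axs; rewrite /chain_gf /pairing -esumZ; last 2 first.
- by rewrite lee_fin cauchy_factor_ge0.
- move=> mu _; apply: psizeX_ge0; rewrite mulr_ge0 // big_seq prodr_ge0 // => x /(allP axs).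
  by move=> /andP[_ x1]; exact: in01_invB1.
apply: le_esum => mu _; rewrite ups_one // muleCA.
apply: lee_wpmul2l; first by rewrite lee_fin cauchy_factor_ge0.
rewrite /psizeX exprMn EFinM; apply: lee_wpmul2l; first by rewrite lee_fin exprn_ge0.
exact: downs_one_le.
Qed.

Definition unrow (N : nat) (mu : par) : par := mkpar (fun i => mu i - mu N)%N.

Lemma unrowE N mu i : unrow N mu i = (mu i - mu N)%N.
Proof.
rewrite mkparE //; split; first by move=> j; rewrite leq_sub2r // part_noninc.
by exists N; rewrite subnn.
Qed.

(** Subtracting the part of index [N] from the first [N + 1] parts leaves a
    partition with at most [N] parts. *)
Lemma par_gf_bounded u N : in01 u ->
  \esum_(mu in [set mu : par | mu N = 0%N]) psizeX u mu <=
  (\prod_(i < N) (1 - u ^+ i.+1)^-1)%:E.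
Proof.
move=> /andP[u0 u1]; elim: N => [|N IH].
  rewrite big_ord0 (_ : [set mu : par | mu 0%N = 0%N] = [set par0]).
    by rewrite esum_set1 /psizeX ?psize0 ?expr0.
  apply/seteqP; split => l /= => [l0|-> //].
  by apply: parP => i; apply/eqP; rewrite -leqn0 /= -l0 part_le.
have uN : (0 <= u ^+ N.+1 < 1)%R by rewrite exprn_ge0 // exprn_ilt1.
rewrite big_ord_recr /= mulrC EFinM.
rewrite -esum_geometric //.
apply: (@le_trans _ _ ((\esum_(i in [set: nat]) (u ^+ N.+1 ^+ i)%:E) *
   (\esum_(mu in [set mu : par | mu N = 0%N]) psizeX u mu))); last first.
  apply: lee_wpmul2l => //; apply: esum_ge0 => k _; by rewrite lee_fin !exprn_ge0.
rewrite -esum_prod; last 2 first.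
- by move=> k; rewrite lee_fin !exprn_ge0.
- by move=> l; exact: psizeX_ge0.
pose e (l : par) := (l N, unrow N l).
rewrite (eq_esum (b := fun l => (u ^+ N.+1 ^+ (e l).1)%:E * psizeX u (e l).2)); last first.
  move=> l /= lN; rewrite /psizeX -EFinM; congr EFin.
  rewrite -exprM -exprD (psizeE lN) (psizeE (N := N.+1)); last by rewrite unrowE lN.
  congr (_ ^+ _)%R; rewrite (eq_bigr (fun i : 'I_N.+1 => unrow N l i + l N)%N); last first.
    by move=> i _; rewrite unrowE subnK // part_le // -ltnS.
  by rewrite big_split /= sum_nat_const card_ord addnC.
rewrite -(@esum_image _ _ _ _ e (fun p => (u ^+ N.+1 ^+ p.1)%:E * psizeX u p.2)).
  by apply: esum_subset => _ [l /= ml <-] /=; split => //; rewrite unrowE subnn.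
move=> l l' /set_mem /= lN /set_mem /= lN' [E0 /(congr1 part) E1]; apply: parP => i.
have := congr1 (fun h => h i) E1 => /=; rewrite !unrowE.
have [iN|iN] := leqP i N; first by have := part_le l iN; have := part_le l' iN; lia.
by have := part_le l iN; have := part_le l' iN; lia.
Qed.

Lemma par_gf_le u B : in01 u -> (forall N, (\prod_(i < N) (1 - u ^+ i.+1)^-1 <= B)%R) ->
  \esum_(mu in [set: par]) psizeX u mu <= B%:E.
Proof.
move=> u01 uB; apply: ge_ereal_sup => _ [X [finX _] <-].
pose N := (\max_(l <- fset_set X) plen l)%N.
apply: le_trans (_ : \esum_(mu in [set mu : par | mu N = 0%N]) psizeX u mu <= _).
  apply: ereal_sup_ubound; exists X => //; split => // l Xl /=.
  apply: part0_ge; rewrite /N.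
  by apply: (@leq_bigmax_seq _ _ xpredT plen) => //; rewrite in_fset_set // inE.
by apply: le_trans (par_gf_bounded N u01) _; rewrite lee_fin.
Qed.

End words.

(** * Banded plane partitions as chains of partitions *)

(** The diagonals are listed from the last one to the first, so that each
    new partition is larger. *)
Fixpoint rising (mu : par) (s : seq par) : Prop :=
  if s is la :: s' then interl la mu /\ rising la s' else True.

Definition chain_size (s : seq par) : nat := (\sum_(l <- s) psize l)%N.

Section chain_sum.
Local Open Scope ereal_scope.
Variable R : realType.

Lemma ups_rcons (xs : seq R) x f mu : ups (rcons xs x) f mu = up x (ups xs f) mu.
Proof. by rewrite /ups foldl_rcons. Qed.

Lemma iota1S d : iota 1 d.+1 = rcons (iota 1 d) d.+1.
Proof. by rewrite -(addn1 d) iotaD cats1 addnC. Qed.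

Lemma all_in01_pow (q : R) s : (0 <= q < 1)%R -> all (leq 1) s ->
  all (@in01 R) [seq q ^+ i | i <- s]%R.
Proof.
move=> /andP[q0 q1] /allP s1; apply/allP => _ /mapP[i /s1 i0 ->].
by rewrite /in01 /= exprn_ge0 // exprn_ilt1 // -lt0n.
Qed.

(** The total size counts a strip once for every diagonal that contains
    it.  So the weight [q] per cell becomes the weight [q ^ i] for the strip
    between the diagonals [i - 1] and [i]. *)
Lemma rising_sum (q : R) d mu : (0 <= q < 1)%R ->
  \esum_(s in [set s | size s = d /\ rising mu s]) (q ^+ chain_size s)%:E =
  psizeX (q ^+ d) mu * ups [seq q ^+ i | i <- iota 1 d]%R (@one_fun R) mu.
Proof.
move=> q01; have /andP[q0 q1] := q01.
elim: d mu => [|d IH] mu.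
  rewrite (_ : [set s | _] = [set [::]]); last first.
    by apply/seteqP; split => s /=; [case=> /size0nil ->|move=> ->].
  rewrite esum_set1 /chain_size big_nil expr0 //.
  by rewrite /psizeX expr1n mul1e.
rewrite iota1S map_rcons ups_rcons.
set xs := [seq q ^+ i | i <- iota 1 d]%R.
have axs : all (@in01 R) xs.
  by apply: all_in01_pow => //; apply/allP => i; rewrite mem_iota => /andP[].
transitivity (up (q ^+ d.+1) (ups xs (@one_fun R)) mu * psizeX (q ^+ d.+1) mu); last exact: muleC.
transitivity (\esum_(la in [set la : par | interl la mu])
  \esum_(s in [set s | size s = d /\ rising la s]) (q ^+ (psize la + chain_size s))%:E).
  rewrite esum_esum; last by move=> *; rewrite lee_fin exprn_ge0.
  rewrite (reindex_esum ([set la : par | interl la mu] `*``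
     (fun la : par => [set s | size s = d /\ rising la s])) _ (fun p => p.1 :: p.2)).
    by apply: eq_esum => -[la s] _ /=; rewrite /chain_size big_cons.
  split.
  - by move=> [la s] [/= ? [<- ?]].
  - by move=> [la s] [la' s'] _ _ /= [-> ->].
  - by case=> [|la s] /= [] // [sd] [? ?]; exists (la, s).
rewrite muleC -esumZ ?psizeX_ge0 ?exprn_ge0 //; last first.
  by move=> l _; rewrite mule_ge0 ?strip_weight_ge0 ?exprn_ge0 ?ups_ge0.
apply: eq_esum => la /= /interl_size lm.
under eq_esum do rewrite exprD EFinM.
rewrite esumZ ?lee_fin ?exprn_ge0 //; last by move=> s _; rewrite lee_fin exprn_ge0.
rewrite IH !muleA; congr (_ * _); rewrite /psizeX /strip_weight -!EFinM -!exprM -!exprD.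
congr ((q ^+ _)%:E); rewrite -mulnDr subnKC // mulSn; lia.
Qed.

Definition chains (m : nat) : set (seq par) :=
  [set t | size t = m /\ forall j, (j.+1 < m)%N -> interl (nth par0 t j.+1) (nth par0 t j)].

Lemma risingP mu s : rising mu s <->
  forall j, (j < size s)%N -> interl (nth par0 (mu :: s) j.+1) (nth par0 (mu :: s) j).
Proof.
elim: s mu => [|la s IH] mu //=; split.
  move=> [lm /IH h] [|j] //=; rewrite ltnS; exact: h.
move=> h; split; first exact: (h 0%N).
by apply/IH => j js; exact: (h j.+1).
Qed.

Lemma chains_sum (q : R) d : (0 <= q < 1)%R ->
  \esum_(t in chains d.+1) (q ^+ chain_size t)%:E =
  chain_gf [seq q ^+ i | i <- iota 1 d]%R (q ^+ d.+1)%R.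
Proof.
move=> q01; have /andP[q0 q1] := q01.
rewrite /chain_gf /pairing.
rewrite (reindex_esum ([set: par] `*``
     (fun mu : par => [set s | size s = d /\ rising mu s])) _ (fun p => p.1 :: p.2)); last first.
  split.
  - by move=> [la s] [/= _ [<- /risingP h]].
  - by move=> [la s] [la' s'] _ _ /= [-> ->].
  - move=> [|mu s] /= [//= [sd] h]; exists (mu, s) => //; split => //; split => //.
    by apply/risingP => j js; apply: h; rewrite -sd.
rewrite -(@esum_esum _ _ _ _ _ (fun mu s => (q ^+ chain_size (mu :: s))%:E)); last first.
  by move=> *; rewrite lee_fin exprn_ge0.
apply: eq_esum => mu _.
under eq_esum do rewrite /chain_size big_cons exprD EFinM.
rewrite esumZ ?lee_fin ?exprn_ge0 //; last by move=> s _; rewrite lee_fin exprn_ge0.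
rewrite rising_sum // muleA; congr (_ * _).
by rewrite /psizeX -EFinM -!exprM -exprD mulSn.
Qed.

End chain_sum.

Section diagonals.
Variable m' : nat.
Local Notation m := m'.+1.
Hypothesis m'0 : (0 < m')%N.
Implicit Type f : {fsfun band m -> nat with 0%N}.

Lemma band_at_subproof (d : 'I_m) i : (i <= i + d <= i + m - 1)%N.
Proof. by have := ltn_ord d; lia. Qed.

Definition band_at (d : 'I_m) (i : nat) : band m := exist _ ((i + d)%N, i) (band_at_subproof d i).

Lemma band_atP (p : band m) : exists d i, p = band_at d i.
Proof.
case: p => -[a b] /= h.
have dm : (a - b < m)%N by lia.
exists (Ordinal dm), b; apply: val_inj => /=; congr pair; lia.
Qed.

Lemma band_at_inj d i d' i' : band_at d i = band_at d' i' -> d = d' /\ i = i'.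
Proof.
move=> /(congr1 val) /= [E1 E2]; split => //; apply: val_inj => /=; lia.
Qed.

Definition diag f (d : 'I_m) : par := mkpar (fun i => f (band_at d i)).

Lemma finsupp_row f : exists N, forall d i, (N <= i)%N -> f (band_at d i) = 0%N.
Proof.
exists (\max_(p <- finsupp f) (val p).2).+1 => d i Ni.
apply: fsfun_dflt; apply/negP => fi.
have := @leq_bigmax_seq _ _ xpredT (fun p : band m => (val p).2) _ fi isT.
by rewrite /= leqNgt => /negP; apply.
Qed.

Lemma bpp_step1 f (d d' : 'I_m) i : is_bpp f -> d' = d.+1 :> nat ->
  (f (band_at d' i) <= f (band_at d i))%N /\ (f (band_at d i.+1) <= f (band_at d' i))%N.
Proof.
move=> hf E; split; apply: hf => /=; [right|left]; congr pair; lia.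
Qed.

(** That a diagonal is nonincreasing follows from two steps of the band,
    through a neighbouring diagonal; hence the need for a width of at least
    two. *)
Lemma diagE f d i : is_bpp f -> diag f d i = f (band_at d i).
Proof.
move=> hf; rewrite mkparE //; split; last first.
  by have [N hN] := finsupp_row f; exists N; rewrite hN.
move=> j; have [dm|dm] := ltnP d.+1 m.
  have [h1 h2] := @bpp_step1 f d (Ordinal dm) j hf erefl.
  exact: leq_trans h2 h1.
have d0 : (d.-1 < m)%N by have := ltn_ord d; lia.
have dE : d = (Ordinal d0).+1 :> nat by have := ltn_ord d; rewrite /=; lia.
have [h1 _] := bpp_step1 j.+1 hf dE.
have [_ h2] := bpp_step1 j hf dE.
exact: leq_trans h1 h2.
Qed.

Definition bpp_chain f : seq par := mkseq (fun j => diag f (inord (m' - j))) m.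

Lemma bpp_size_diag f : is_bpp f -> bpp_size f = (\sum_(d < m) psize (diag f d))%N.
Proof.
move=> hf; have [N hN] := finsupp_row f.
transitivity (\sum_(d < m) \sum_(i < N) f (band_at d i))%N; last first.
  apply: eq_bigr => d _; rewrite (psizeE (N := N)); last by rewrite diagE // hN.
  by apply: eq_bigr => i _; rewrite diagE.
rewrite /bpp_size.
pose L := [seq band_at d i | d <- enum 'I_m, i <- index_iota 0 N].
transitivity (\sum_(p <- L) f p)%N; last first.
  rewrite big_allpairs_dep /= -big_enum; apply: eq_bigr => d _.
  by rewrite big_mkord.
rewrite [RHS](bigID (mem (finsupp f)) xpredT) /= [X in (_ + X)%N]big1_seq ?addn0; last first.
  by move=> p /andP[pf _]; exact: fsfun_dflt.
rewrite -[RHS]big_filter; apply: perm_big; apply: uniq_perm.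
- exact: fset_uniq.
- apply: filter_uniq; apply: allpairs_uniq_dep; first exact: enum_uniq.
    by move=> *; exact: iota_uniq.
  move=> [d i] [d' i'] _ _ /= /band_at_inj[-> ->] //.
- move=> p; rewrite mem_filter; case pf : (p \in finsupp f) => //=.
  apply/esym/allpairsPdep; have [d [i pE]] := band_atP p.
  exists d, i; split => //; first by rewrite mem_enum.
  rewrite mem_index_iota /= ltnNge; apply/negP => Ni.
  by move: pf; rewrite mem_finsupp pE hN // eqxx.
Qed.

Lemma bpp_chain_size f : is_bpp f -> bpp_size f = chain_size (bpp_chain f).
Proof.
move=> hf; rewrite bpp_size_diag // /chain_size /bpp_chain /mkseq big_map.
rewrite -/(index_iota 0 m) big_mkord (reindex_inj rev_ord_inj) /=.
apply: eq_bigr => j _; congr (psize (diag f _)); apply: val_inj => /=.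
by rewrite inordK //; lia.
Qed.

Definition chain_fun (t : seq par) (p : band m) : nat :=
  nth par0 t (m' - ((val p).1 - (val p).2)) (val p).2.

Definition chain_bpp (t : seq par) : {fsfun band m -> nat with 0%N} :=
  [fsfun p in fset_set [set p : band m | ((val p).2 < (\max_(l <- t) plen l).+1)%N]
   => chain_fun t p].

Lemma finite_band_rows N : finite_set [set p : band m | ((val p).2 < N)%N].
Proof.
apply: (@sub_finite_set _ _ (val @^-1` (`I_(N + m) `*` `I_N))); last first.
  apply: finite_preimage; first by move=> x y _ _ /val_inj.
  exact: finite_setX.
by move=> [[a b] /= h] /= bN; split => /=; lia.
Qed.

Lemma chain_bppE t d i : size t = m ->
  chain_bpp t (band_at d i) = nth par0 t (m' - d) i.
Proof.
move=> tm; rewrite /chain_bpp fsfunE.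
have -> : chain_fun t (band_at d i) = nth par0 t (m' - d) i.
  by rewrite /chain_fun /= addKn.
case: ifPn => //; rewrite in_fset_set ?notin_setE; last exact: finite_band_rows.
move=> /= /negP; rewrite -leqNgt => h; apply: esym; apply: part0_ge; apply: leq_trans (ltnW h).
apply: (@leq_bigmax_seq _ _ xpredT plen) => //.
by apply: mem_nth; rewrite tm; lia.
Qed.

Lemma nth_bpp_chain f j i : is_bpp f -> (j < m)%N ->
  nth par0 (bpp_chain f) j i = f (band_at (inord (m' - j)) i).
Proof. by move=> hf jm; rewrite nth_mkseq // diagE. Qed.

Lemma bpp_chain_bij : set_bij [set f | is_bpp f] (chains m) bpp_chain.
Proof.
split.
- move=> f /= hf; split; first by rewrite size_mkseq.
  move=> j jm i; rewrite !nth_bpp_chain ?(ltnW jm) //.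
  by apply: bpp_step1 => //; rewrite !inordK; lia.
- move=> f g /set_mem /= hf /set_mem /= hg E; apply/fsfunP => p.
  have [d [i ->]] := band_atP p.
  have dm := ltn_ord d.
  have := congr1 (fun t => nth par0 t (m' - d) i) E.
  rewrite /= !nth_bpp_chain //; [|lia|lia].
  have -> : inord (m' - (m' - d)) = d by apply: val_inj; rewrite /= inordK; lia.
  by [].
- move=> t [tm ht]; have hf : is_bpp (chain_bpp t).
    move=> p q; have [d [i ->]] := band_atP p; have [d' [i' ->]] := band_atP q.
    rewrite !chain_bppE //= => -[] [E1 E2]; subst i'.
      have dm := ltn_ord d; have dE : d = d'.+1 :> nat by lia.
      have jm : ((m' - d).+1 < m)%N by have := ltn_ord d; lia.
      have := (ht _ jm i).2; rewrite (_ : (m' - d).+1 = (m' - d')%N) //; lia.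
    have dE : d' = d.+1 :> nat by lia.
    have jm : ((m' - d').+1 < m)%N by have := ltn_ord d'; lia.
    have := (ht _ jm i).1; rewrite (_ : (m' - d').+1 = (m' - d)%N) //.
    by have := ltn_ord d'; lia.
  exists (chain_bpp t) => //; apply: (@eq_from_nth _ par0); first by rewrite size_mkseq tm.
  rewrite size_mkseq => j jm; apply: parP => i.
  rewrite nth_bpp_chain // chain_bppE // inordK; last by lia.
  by rewrite subKn; last lia.
Qed.

Lemma bpp_gf (R : realType) (q : R) : 0 <= q < 1 ->
  (\esum_(f in [set f | is_bpp f]) (q ^+ @bpp_size m f)%:E =
   chain_gf [seq q ^+ i | i <- iota 1 m']%R (q ^+ m)%R)%E.
Proof.
move=> q01; rewrite -chains_sum //.
rewrite (reindex_esum _ _ _ _ bpp_chain_bij).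
by apply: eq_esum => f hf; rewrite bpp_chain_size.
Qed.

End diagonals.

(** * Counting by size *)

Lemma sumr_const_fset (T : choiceType) (V : nmodType) (X : {fset T}) (v : V) :
  \sum_(i <- X) v = v *+ #|` X|%fset.
Proof. by rewrite big_const_seq count_predT iter_addr addr0. Qed.

Definition bpps m n := [set f : {fsfun band m -> nat with 0%N} | is_bpp f /\ bpp_size f = n].

Arguments bpps : clear implicits.

Section counting.
Variables (R : realType) (m : nat) (q B : R).
Hypotheses (q0 : 0 < q) (q1 : q < 1).
Local Notation bgf := (\esum_(f in [set f | is_bpp f]) (q ^+ @bpp_size m f)%:E)%E.
Hypothesis bgfB : (bgf <= B%:E)%E.

(** An infinite set of plane partitions of one size would make the
    generating function infinite. *)
Lemma bpps_finite n : finite_set (bpps m n).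
Proof.
apply: contrapT => inf.
(* More than B / q ^ n members of size n exceed the bound B. *)
pose N := (Num.truncn `|B / q ^+ n|).+2.
have [X XS XN] := infinite_set_fset N inf.
have qn0 : 0 < q ^+ n by rewrite exprn_gt0.
have : (N%:R * q ^+ n <= B).
  rewrite -lee_fin; apply: le_trans bgfB.
  apply: (@le_trans _ _ (\esum_(f in [set` X]) (q ^+ @bpp_size m f)%:E)%E); last first.
    by apply: esum_subset => f /XS [].
  rewrite esum_fset; [|exact: finite_fset|by move=> *; rewrite lee_fin exprn_ge0 // ltW].
  rewrite fsbig_finite /=; last exact: finite_fset.
  rewrite set_fsetK sumEFin lee_fin.
  rewrite (eq_big_seq (fun=> q ^+ n)); last by move=> f /XS [_ ->].
  rewrite sumr_const_fset -[X in _ <= X]mulr_natl.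
  by rewrite ler_wpM2r ?ler_nat ?(ltW qn0).
rewrite -ler_pdivlMr // leNgt => /negP; apply.
apply: le_lt_trans (ler_norm _) _; rewrite -natr1.
have := truncnS_gt `|B / q ^+ n|; rewrite -natr1 /N => h.
by apply: lt_le_trans h _; rewrite natr1 lerDl.
Qed.

Local Notation G k := ((nbpp k m)%:R : R).

Lemma bpps_sum n : (\esum_(f in bpps m n) (q ^+ @bpp_size m f)%:E)%E = (G n * q ^+ n)%:E.
Proof.
have fin := bpps_finite n.
rewrite -{1}(fset_setK fin) esum_fset; [|exact: finite_fset|].
  rewrite fsbig_finite /=; last exact: finite_fset.
  rewrite set_fsetK sumEFin (eq_big_seq (fun=> q ^+ n)).
    by rewrite sumr_const_fset mulr_natl.
  by move=> f; rewrite in_fset_set // inE => -[_ ->].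
by move=> f _; rewrite lee_fin exprn_ge0 // ltW.
Qed.

Lemma bpps_partial N :
  (\esum_(f in [set f | is_bpp f /\ (bpp_size f < N)%N]) (q ^+ @bpp_size m f)%:E)%E =
  (\sum_(k < N) G k * q ^+ k)%:E.
Proof.
elim: N => [|N IH].
  by rewrite big_ord0 (_ : [set f | _] = set0) ?esum_set0 //; apply/seteqP; split => f // [].
rewrite (esumID [set f | bpp_size f = N]); last first.
  by move=> f _; rewrite lee_fin exprn_ge0 // ltW.
rewrite big_ord_recr /= addrC EFinD -bpps_sum -IH.
set A1 := _ `&` _; set A2 := _ `&` _.
have -> : A1 = bpps m N.
  apply/seteqP; split => f /=; first by move=> [[]].
  by move=> [hf fN]; do !split => //; rewrite fN.
have -> // : A2 = [set f | is_bpp f /\ (bpp_size f < N)%N].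
apply/seteqP; split => f /=.
  by move=> [[hf fN]] fn; split => //; rewrite ltn_neqAle -ltnS fN andbT; apply/eqP.
by move=> [hf fN]; do !split => //; [exact: ltnW|move=> E; rewrite E ltnn in fN].
Qed.

Lemma bpps_upper N : \sum_(k < N) G k * q ^+ k <= B.
Proof.
rewrite -lee_fin -bpps_partial; apply: le_trans bgfB.
by apply: esum_subset => f [].
Qed.

(** A finite subfamily of large sum only involves sizes below some [N]. *)
Lemma bpps_lower (A : R) : (A%:E < bgf)%E -> exists N, A <= \sum_(k < N) G k * q ^+ k.
Proof.
move=> /ereal_sup_gt[_ [X [finX Xb] <-] AX].
exists (\max_(f <- fset_set X) @bpp_size m f).+1.
rewrite -lee_fin -bpps_partial; apply: le_trans (ltW AX) _.
apply: ereal_sup_ubound; exists X => //; split => // f Xf; split; first exact: Xb.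
rewrite ltnS; apply: (@leq_bigmax_seq _ _ xpredT (@bpp_size m)) => //.
by rewrite in_fset_set // inE.
Qed.

End counting.

Section monotone.
Variable m' : nat.
Local Notation m := m'.+1.
Hypothesis m'0 : (0 < m')%N.
Implicit Type f : {fsfun band m -> nat with 0%N}.

Let p0 : band m := band_at m'0 ord0 0.

Definition bump_corner f : {fsfun band m -> nat with 0%N} :=
  [fsfun p in (p0 |` finsupp f)%fset => (f p + (p == p0))%N].

Lemma bump_cornerE f p : bump_corner f p = (f p + (p == p0))%N.
Proof.
rewrite /bump_corner fsfunE; case: ifPn => //.
rewrite in_fset1U negb_or => /andP[/negbTE -> fp].
by rewrite fsfun_dflt.
Qed.

Lemma bump_corner_bpps n f : bpps m n f -> bpps m n.+1 (bump_corner f).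
Proof.
move=> [hf fn]; split.
  move=> p q pq; rewrite !bump_cornerE.
  have -> : (q == p0) = false.
    apply/eqP => E; rewrite E in pq.
    by move: pq; rewrite /p0 /= => -[].
  by rewrite addn0 (leq_trans (hf _ _ pq)) // leq_addr.
rewrite -fn /bpp_size.
have E (X : {fset band m}) (g : {fsfun band m -> nat with 0%N}) : (finsupp g `<=` X)%fset -> (\sum_(p <- finsupp g) g p = \sum_(p <- X) g p)%N.
  move=> gX; rewrite (big_fset_incl _ gX) // => p *; exact: fsfun_dflt.
rewrite (E (p0 |` finsupp f)%fset (bump_corner f)); last exact: finsupp_sub.
rewrite (E (p0 |` finsupp f)%fset f); last exact: fsubsetU1.
under eq_bigr do rewrite bump_cornerE.
rewrite big_split /=.
suff -> : (\sum_(p <- (p0 |` finsupp f)%fset) (p == p0) = 1)%N by rewrite addn1.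
rewrite (big_fsetD1 p0) ?fset1U1 // eqxx big_seq big1 // => p.
by rewrite in_fsetD1 => /andP[/negbTE ->].
Qed.

(** Adding one to the corner entry is an injection. *)
Lemma nbpp_mono n : (forall k, finite_set (bpps m k)) -> (nbpp n m <= nbpp n.+1 m)%N.
Proof.
move=> fin; rewrite /nbpp -/(bpps m n) -/(bpps m n.+1).
have inj : injective bump_corner.
  move=> f g /fsfunP E; apply/fsfunP => p; move: (E p).
  by rewrite !bump_cornerE => /addIn.
have <- : #|` (bump_corner @` fset_set (bpps m n))%fset|%fset = #|` fset_set (bpps m n)|%fset.
  by rewrite card_imfset.
rewrite -fset_set_image //; apply: fsubset_leq_card.
rewrite -fset_set_sub //; last exact: finite_image.
by move=> _ [f /bump_corner_bpps h <-].
Qed.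

End monotone.

(** * Bounded families weighted by inverse squares *)

Section wsum.
Variable R : realType.
Implicit Types (g h : nat -> R) (M c : R).

Definition isq (l : nat) : R := (l%:R ^+ 2)^-1.
(** All series below are written in this form, where boundedness is the only
    condition for convergence.  The term of index [0] vanishes, as the inverse
    of [0] is [0]. *)
Definition wsum g : R := limn (series (fun l => g l * isq l)).
Definition bounded_by M g := forall l, (0 < l)%N -> `|g l| <= M.

Lemma isq_ge0 l : 0 <= isq l.
Proof. by rewrite invr_ge0 exprn_ge0. Qed.

Lemma isq0 : isq 0 = 0.
Proof. by rewrite /isq expr0n /= invr0. Qed.

(** Telescoping majorant of the inverse squares. *)
Lemma isq_le l : isq l.+2 <= l.+1%:R^-1 - l.+2%:R^-1.
Proof.
rewrite /isq; have h1 : (0 < l.+1%:R :> R) by rewrite ltr0n.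
have -> : l.+2%:R = l.+1%:R + 1 :> R by rewrite -[in LHS]addn1 natrD.
set x : R := l.+1%:R in h1 *.
have -> : x^-1 - (x + 1)^-1 = (x * (x + 1))^-1 by field; lra.
rewrite lef_pV2 ?posrE; nra.
Qed.

Lemma isq_tail N n : \sum_(N.+2 <= l < n) isq l <= N.+1%:R^-1.
Proof.
have [nN|Nn] := leqP n N.+2; first by rewrite big_geq // invr_ge0.
apply: (@le_trans _ _ (\sum_(N.+2 <= l < n) (l.-1%:R^-1 - l%:R^-1))).
  rewrite big_nat_cond [leRHS]big_nat_cond; apply: ler_sum => -[|[|l]] // _.
  exact: isq_le.
have -> : \sum_(N.+2 <= l < n) (l.-1%:R^-1 - l%:R^-1 : R) = N.+1%:R^-1 - n.-1%:R^-1.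
  rewrite (eq_bigr (fun l => - (l%:R^-1) - - (l.-1%:R^-1))); last by move=> *; rewrite opprK addrC.
  rewrite (@telescope_sumr_eq _ _ _ (fun l => - (l.-1%:R^-1))) ?(ltnW Nn) //.
  by rewrite opprK addrC.
by rewrite gerBl invr_ge0.
Qed.

Lemma isq_sum n : \sum_(0 <= l < n) isq l <= 2.
Proof.
case: n => [|[|n]]; first by rewrite big_geq.
  by rewrite big_nat1 isq0.
rewrite big_ltn // big_ltn // isq0 add0r.
have := @isq_tail 0 n.+2; rewrite {2}/isq expr1n invr1; lra.
Qed.

Lemma isq_cvg : cvgn (series isq).
Proof.
apply: nondecreasing_is_cvgn.
  by apply/nondecreasing_seqP => n; rewrite !seriesEnat /= big_nat_recr //= lerDl isq_ge0.
by exists 2 => _ [n _ <-]; rewrite seriesEnat /= isq_sum.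
Qed.

Lemma wsum_is_cvg M g : bounded_by M g -> cvgn (series (fun l => g l * isq l)).
Proof.
move=> gM; apply: normed_cvg.
apply: (@series_le_cvg _ _ (fun l => `|M| * isq l)).
- by move=> n; exact: normr_ge0.
- by move=> n; rewrite mulr_ge0 // isq_ge0.
- move=> [|n] /=; first by rewrite isq0 !mulr0 normr0.
  rewrite normrM (ger0_norm (isq_ge0 _)) ler_wpM2r ?isq_ge0 //.
  exact: le_trans (gM _ _) (ler_norm _).
- have -> : series (fun l => `|M| * isq l) = (fun n => `|M| * series isq n).
    by apply/funext => n; rewrite /series /= mulr_sumr.
  exact: is_cvgMl_tmp isq_cvg.
Qed.

Lemma wsum_cvg M g : bounded_by M g -> series (fun l => g l * isq l) @ \oo --> wsum g.
Proof. by move=> /wsum_is_cvg. Qed.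

Lemma eq_wsum g h : (forall l, (0 < l)%N -> g l = h l) -> wsum g = wsum h.
Proof.
move=> gh; rewrite /wsum; congr (limn (series _)); apply/funext => -[|l].
  by rewrite isq0 !mulr0.
by rewrite gh.
Qed.

Lemma wsumD M M' g h : bounded_by M g -> bounded_by M' h ->
  wsum (fun l => g l + h l) = wsum g + wsum h.
Proof.
move=> /wsum_cvg cg /wsum_cvg ch; apply: cvg_lim => //.
have -> : series (fun l => (g l + h l) * isq l) =
    series (fun l => g l * isq l) \+ series (fun l => h l * isq l).
  apply/funext => n; rewrite /series /= -big_split /=.
  by apply: eq_bigr => l _; rewrite mulrDl.
exact: cvgD.
Qed.

Lemma wsumZ M g c : bounded_by M g -> wsum (fun l => c * g l) = c * wsum g.
Proof.
move=> /wsum_cvg cg; apply: cvg_lim => //.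
have -> : series (fun l => c * g l * isq l) = (fun n => c * series (fun l => g l * isq l) n).
  by apply/funext => n; rewrite /series /= mulr_sumr; apply: eq_bigr => l _; rewrite mulrA.
exact: cvgMl_tmp cg.
Qed.

Lemma bounded_byZ M g c : bounded_by M g -> bounded_by (`|c| * M) (fun l => c * g l).
Proof. by move=> gM l l0; rewrite normrM ler_wpM2l // gM. Qed.

Lemma bounded_byD M M' g h : bounded_by M g -> bounded_by M' h ->
  bounded_by (M + M') (fun l => g l + h l).
Proof. by move=> gM hM l l0; rewrite (le_trans (ler_normD _ _)) // lerD ?gM ?hM. Qed.

Lemma wsumB M M' g h : bounded_by M g -> bounded_by M' h ->
  wsum (fun l => g l - h l) = wsum g - wsum h.
Proof.
move=> gM hM; rewrite -mulN1r -(wsumZ _ hM) -(wsumD gM (bounded_byZ (-1) hM)).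
by apply: eq_wsum => l _; rewrite mulN1r.
Qed.

Lemma wsum_tail M g N : bounded_by M g ->
  `|wsum g - series (fun l => g l * isq l) N.+2| <= M / N.+1%:R.
Proof.
move=> gM; have gc := wsum_cvg gM.
have M0 : 0 <= M by apply: le_trans (gM 1%N isT).
have h : (fun n => `|series (fun l => g l * isq l) n - series (fun l => g l * isq l) N.+2|)
    @ \oo --> `|wsum g - series (fun l => g l * isq l) N.+2|.
  by apply: cvg_norm; apply: cvgB gc _; exact: cvg_cst.
apply: (closed_cvg (fun y => y <= M / N.+1%:R) _ _ _ h); first exact: closed_le.
near=> n; have Nn : (N.+2 <= n)%N by near: n; exact: nbhs_infty_ge.
rewrite /series /= (big_cat_nat (leq0n _) Nn) /= addrAC subrr add0r.
apply: le_trans (ler_norm_sum _ _ _) _.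
apply: (@le_trans _ _ (M * \sum_(N.+2 <= l < n) isq l)).
  rewrite mulr_sumr big_nat_cond [leRHS]big_nat_cond; apply: ler_sum => l /andP[/andP[l0 _] _].
  rewrite normrM (ger0_norm (isq_ge0 _)) ler_wpM2r ?isq_ge0 // gM //.
  by apply: leq_trans l0.
by rewrite ler_wpM2l // isq_tail.
Unshelve. all: by end_near.
Qed.

Lemma wsum_norm M g : bounded_by M g -> `|wsum g| <= 2 * M.
Proof.
move=> gM; have M0 : 0 <= M by apply: le_trans (gM 1%N isT).
apply: (closed_cvg (fun y => y <= 2 * M) _ _ _ (cvg_norm (wsum_cvg gM))); first exact: closed_le.
apply: nearW => n; rewrite /series /=.
apply: le_trans (ler_norm_sum _ _ _) _.
apply: (@le_trans _ _ (M * \sum_(0 <= l < n) isq l)).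
  rewrite mulr_sumr; apply: ler_sum => -[|l] _; first by rewrite isq0 !mulr0 normr0.
  by rewrite normrM (ger0_norm (isq_ge0 _)) ler_wpM2r ?isq_ge0 // gM.
by rewrite mulrC ler_wpM2r // isq_sum.
Qed.

Lemma wsum_le M M' g h : bounded_by M g -> bounded_by M' h ->
  (forall l, (0 < l)%N -> g l <= h l) -> wsum g <= wsum h.
Proof.
move=> gM hM gh; apply: ler_lim (wsum_is_cvg gM) (wsum_is_cvg hM) _.
apply: nearW => n; apply: ler_sum => -[|l] _; first by rewrite isq0 !mulr0.
by rewrite ler_wpM2r ?isq_ge0 // gh.
Qed.

Lemma wsum_ge_partial M g n : bounded_by M g -> (forall l, (0 < l)%N -> 0 <= g l) ->
  \sum_(0 <= l < n) g l * isq l <= wsum g.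
Proof.
move=> gM g0; apply: (nondecreasing_cvgn_le (u_ := series (fun l => g l * isq l))).
  apply/nondecreasing_seqP => k; rewrite /series /= big_nat_recr //= lerDl.
  by case: k => [|k]; [rewrite isq0 mulr0|rewrite mulr_ge0 ?isq_ge0 ?g0].
exact: wsum_is_cvg gM.
Qed.

Lemma wsum_ge_first M g : bounded_by M g -> (forall l, (0 < l)%N -> 0 <= g l) -> g 1%N <= wsum g.
Proof.
move=> gM g0; have := wsum_ge_partial 2 gM g0.
by rewrite !big_nat_recl // big_geq // isq0 mulr0 add0r addr0 /isq expr1n invr1 mulr1.
Qed.

Lemma wsum_ge0 M g : bounded_by M g -> (forall l, (0 < l)%N -> 0 <= g l) -> 0 <= wsum g.
Proof. by move=> gM g0; apply: le_trans (wsum_ge_first gM g0); exact: g0. Qed.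

(** The tails are small uniformly in the parameter, so termwise convergence
    passes to the sum (Tannery's theorem). *)
Lemma wsum_tannery (T : Type) (F : set_system T) (FF : ProperFilter F) M
    (g : T -> nat -> R) (c : nat -> R) :
  (\forall x \near F, bounded_by M (g x)) ->
  (forall l, (0 < l)%N -> g x l @[x --> F] --> c l) ->
  wsum (g x) @[x --> F] --> wsum c.
Proof.
move=> gM gc.
have cM : bounded_by M c.
  move=> l l0; apply: (closed_cvg (fun y => y <= M) _ _ _ (cvg_norm (gc l l0))).
    exact: closed_le.
  by apply: filterS gM => x; exact.
have M0 : 0 <= M by apply: le_trans (cM 1%N isT).
apply/cvgrPdist_le => e e0.
pose N := Num.truncn (3 * M / e).
have hN : M / N.+1%:R <= e / 3.
  have := truncnS_gt (3 * M / e); rewrite -/N => h.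
  rewrite ler_pdivrMr ?ltr0n //; move: h; rewrite ltr_pdivrMr // => h; nra.
have hp : series (fun l => g x l * isq l) N.+2 @[x --> F] --> series (fun l => c l * isq l) N.+2.
  rewrite /series /=; elim: (N.+2) => [|n IH].
    by rewrite big_geq //; under eq_fun do rewrite big_geq //; exact: cvg_cst.
  rewrite big_nat_recr //=; under eq_fun do rewrite big_nat_recr //=.
  apply: cvgD IH _; case: n => [|n]; last by apply: cvgMr_tmp; exact: gc.
  by rewrite isq0 mulr0; under eq_fun do rewrite mulr0; exact: cvg_cst.
have e3 : 0 < e / 3 by rewrite divr_gt0.
move/cvgrPdist_le : hp => /(_ _ e3) hp.
near=> x.
have gx : bounded_by M (g x) by near: x.
have h1 := le_trans (wsum_tail N gx) hN; have h2 := le_trans (wsum_tail N cM) hN.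
have h3 : `|series (fun l => c l * isq l) N.+2 - series (fun l => g x l * isq l) N.+2| <= e / 3.
  by near: x.
move: h1 h2 h3; rewrite !ler_norml => /andP[? ?] /andP[? ?] /andP[? ?].
by apply/andP; split; lra.
Unshelve. all: by end_near.
Qed.

End wsum.

(** * The function tanh (v / 2) *)

Section tanh.
Variable R : realType.
Implicit Types (s v x a b : R).

Lemma mvt (f df : R -> R) a b : (forall x, is_derive x 1 f (df x)) ->
  exists c, [/\ Num.min a b <= c, c <= Num.max a b & f b - f a = df c * (b - a)].
Proof.
move=> fd.
have cf : forall a b, {within `[a, b], continuous f}.
  by move=> a' b'; apply: derivable_within_continuous => x _; have [] := fd x.
have [ab|ba] := leP a b.
  have [c] := MVT_segment ab (fun x _ => fd x) (cf a b).
  by rewrite in_itv /= => /andP[? ?] ?; exists c.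
have [c] := MVT_segment (ltW ba) (fun x _ => fd x) (cf b a).
rewrite in_itv /= => /andP[? ?] E; exists c; split => //.
by rewrite -[LHS]opprB E; ring.
Qed.

Lemma expR_ge_sq x : 0 <= x -> x ^+ 2 / 2 <= expR x.
Proof. by move=> x0; have := expR_ge1Dxn 1 x0; rewrite (_ : 2`! = 2)%N //; lra. Qed.

(** This is [tanh (v / 2)], see [tanh_halfE]. *)
Definition tanh_half v : R := 2 * (1 + expR (- v))^-1 - 1.
Definition dtanh_half v : R := 2 * expR (- v) * (1 + expR (- v))^-1 ^+ 2.
Definition ddtanh_half v : R := - tanh_half v * dtanh_half v.

Lemma den_gt0 v : 0 < 1 + expR (- v).
Proof. by rewrite addr_gt0 // expR_gt0. Qed.

Lemma tanh_halfE v : tanh_half v = (1 - expR (- v)) / (1 + expR (- v)).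
Proof. by rewrite /tanh_half; have := den_gt0 v => h; field; rewrite gt_eqF. Qed.

Lemma is_derive_tanh_half v : is_derive v 1 tanh_half (dtanh_half v).
Proof.
have h := den_gt0 v.
have h' : 1 + expR (- v) != 0 by rewrite gt_eqF.
rewrite /tanh_half.
apply: is_derive_eq; rewrite /dtanh_half /GRing.scale /=.
by field.
Qed.

Lemma is_derive_dtanh_half v : is_derive v 1 dtanh_half (ddtanh_half v).
Proof.
have h := den_gt0 v.
have h' : 1 + expR (- v) != 0 by rewrite gt_eqF.
rewrite /dtanh_half.
apply: is_derive_eq; rewrite /ddtanh_half tanh_halfE /dtanh_half /GRing.scale /=.
by field.
Qed.


Lemma tanh_half_gt0 v : 0 < v -> 0 < tanh_half v.
Proof.
move=> v0; rewrite tanh_halfE divr_gt0 ?den_gt0 // subr_gt0.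
by rewrite -[ltRHS]expR0 ltr_expR oppr_lt0.
Qed.

Lemma tanh_half0 : tanh_half 0 = 0.
Proof. by rewrite tanh_halfE oppr0 expR0 subrr mul0r. Qed.

Lemma tanh_half_ge0 v : 0 <= v -> 0 <= tanh_half v.
Proof. by rewrite le_eqVlt => /predU1P[<-|/tanh_half_gt0/ltW //]; rewrite tanh_half0. Qed.

Lemma tanh_half_le1 v : tanh_half v <= 1.
Proof.
rewrite tanh_halfE ler_pdivrMr ?den_gt0 //; have := expR_gt0 (- v); lra.
Qed.

Lemma dtanh_half_ge0 v : 0 <= dtanh_half v.
Proof. by rewrite /dtanh_half !mulr_ge0 ?expR_ge0 ?exprn_ge0 ?invr_ge0 ?(ltW (den_gt0 _)). Qed.

Lemma dtanh_half_le v : dtanh_half v <= 2 * expR (- v).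
Proof.
rewrite /dtanh_half ler_piMr ?mulr_ge0 ?expR_ge0 //.
rewrite exprn_ile1 ?invr_ge0 ?(ltW (den_gt0 _)) // invf_le1 ?den_gt0 //.
by rewrite lerDl expR_ge0.
Qed.

Lemma dtanh_half_le_half v : dtanh_half v <= 1 / 2.
Proof.
rewrite /dtanh_half exprVn ler_pdivrMr ?exprn_gt0 ?den_gt0 //.
have := sqr_ge0 (1 - expR (- v)); set y := expR _; nra.
Qed.

Lemma dtanh_half_nincr a b : 0 <= a -> a <= b -> dtanh_half b <= dtanh_half a.
Proof.
move=> a0 ab; have [c [+ _ E]] := mvt a b is_derive_dtanh_half.
rewrite min_l // => ac.
rewrite -subr_le0 E /ddtanh_half mulNr mulNr oppr_le0.
by rewrite !mulr_ge0 ?dtanh_half_ge0 ?tanh_half_ge0 ?subr_ge0 // (le_trans a0).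
Qed.

(** The graph lies below its tangents, the derivative being nonincreasing. *)
Lemma tanh_half_le_mul s v : 0 <= s -> 0 <= v -> tanh_half v <= tanh_half s + (v - s) * dtanh_half s.
Proof.
move=> s0 v0; have [c [c1 c2 E]] := mvt s v is_derive_tanh_half.
rewrite -lerBlDl E mulrC.
have [sv|/ltW vs] := leP s v.
  rewrite min_l // in c1; apply: ler_wpM2l; first by rewrite subr_ge0.
  exact: dtanh_half_nincr.
rewrite max_l // in c2; rewrite -subr_ge0 -mulrBr.
rewrite mulr_le0 ?subr_le0 ?dtanh_half_nincr // (le_trans v0) //.
by move: c1; rewrite min_r.
Qed.

Lemma tanh_half_ge_dtanh_half v : 0 <= v -> v * dtanh_half v <= tanh_half v.
Proof. by move=> v0; have := tanh_half_le_mul v0 (lexx 0); rewrite tanh_half0; lra. Qed.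

Lemma tanh_half_le_half v : 0 <= v -> tanh_half v <= v / 2.
Proof.
move=> v0; have := tanh_half_le_mul (lexx 0) v0; rewrite tanh_half0 subr0 add0r.
have := dtanh_half_le_half 0; nra.
Qed.

Lemma tanh_half_le_nat s (l : nat) : 0 <= s -> (0 < l)%N -> tanh_half (l%:R * s) <= l%:R * tanh_half s.
Proof.
move=> s0 l0; have ls0 : 0 <= l%:R * s by rewrite mulr_ge0.
have := tanh_half_le_mul s0 ls0; have := tanh_half_ge_dtanh_half s0.
have : 1 <= l%:R :> R by rewrite ler1n.
nra.
Qed.

Lemma tanh_half_homo a b : a <= b -> tanh_half a <= tanh_half b.
Proof.
move=> ab; have [c [_ _ E]] := mvt a b is_derive_tanh_half.
by rewrite -subr_ge0 E mulr_ge0 ?dtanh_half_ge0 ?subr_ge0.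
Qed.

Lemma tanh_half1 : 1 / 3 <= tanh_half 1.
Proof.
have h : 2 <= expR 1 :> R by have := expR_ge1Dx (1 : R); lra.
have h' : expR (- 1) <= 1 / 2 :> R.
  by rewrite expRN div1r lef_pV2 ?posrE ?expR_gt0.
rewrite tanh_halfE ler_pdivlMr ?den_gt0 //; lra.
Qed.

Lemma tanh_half_ge_min v : 0 <= v -> Num.min v 1 / 3 <= tanh_half v.
Proof.
move=> v0; have [v1|/ltW v1] := leP v 1; last first.
  by apply: le_trans (tanh_half_homo v1); exact: tanh_half1.
have h := tanh_half_le_mul v0 (ler01 : 0 <= 1 :> R).
have h' := tanh_half_ge_dtanh_half v0; have h1 := tanh_half1.
have h2 := dtanh_half_ge0 v.
have [->|vn0] := eqVneq v 0; first by rewrite mul0r tanh_half0.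
have vp : 0 < v by rewrite lt_neqAle eq_sym vn0.
have : v * (1 / 3) <= v * tanh_half v + (1 - v) * (v * dtanh_half v) by nra.
nra.
Qed.

(** The second derivative is at most [2 exp (- s / 2)] between [s / 2] and
    [3 s / 2], and [s ^ 2 exp (- s / 2)] is dominated by the function itself.
    The error is relative to the value at [s], so that it can be summed over
    all multiples of [s]. *)
Lemma tanh_half_taylor s v : 0 < s -> `|v - s| <= s / 2 ->
  `|tanh_half v - tanh_half s - (v - s) * dtanh_half s| <= 96 * ((v - s) / s) ^+ 2 * tanh_half s.
Proof.
move=> s0 vs.
have s20 : 0 <= s / 2 by rewrite divr_ge0 // ltW.
have vlo : s / 2 <= v by move: vs; rewrite ler_norml => /andP[? ?]; lra.
have [c [c1 c2 ->]] := mvt s v is_derive_tanh_half.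
have clo : s / 2 <= c by apply: le_trans c1; rewrite le_min vlo andbT; lra.
have cs : `|c - s| <= `|v - s|.
  have [h|/ltW h] := leP s v.
    rewrite min_l // in c1; rewrite max_r // in c2.
    by rewrite !ger0_norm ?subr_ge0 // lerB.
  rewrite min_r // in c1; rewrite max_l // in c2.
  by rewrite !ler0_norm ?subr_le0 // lerN2 lerB.
rewrite [dtanh_half c * _]mulrC -mulrBr normrM.
have [d [d1 _ ->]] := mvt s c is_derive_dtanh_half.
have dlo : s / 2 <= d by apply: le_trans d1; rewrite le_min clo andbT; lra.
have d0 : 0 <= d by apply: le_trans dlo.
have h1 : `|ddtanh_half d| <= 2 * expR (- (s / 2)).
  rewrite /ddtanh_half mulNr normrN normrM !ger0_norm ?dtanh_half_ge0 ?tanh_half_ge0 //.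
  apply: le_trans (_ : dtanh_half d <= _).
    by rewrite ler_piMl ?dtanh_half_ge0 ?tanh_half_le1.
  apply: le_trans (dtanh_half_nincr s20 dlo) _; exact: dtanh_half_le.
have h2 : s ^+ 2 * (2 * expR (- (s / 2))) <= 96 * tanh_half s.
  rewrite expRN; have := expR_ge_sq s20; have := expR_ge1Dx (s / 2).
  have := expR_gt0 (s / 2).
  set E := expR _ => E0 E1 E2.
  have hm := tanh_half_ge_min (ltW s0).
  have [s1|s1] := leP s 1.
    rewrite min_l // in hm.
    apply: (@le_trans _ _ (s ^+ 2 * 2)).
      rewrite ler_wpM2l ?exprn_ge0 ?(ltW s0) // ler_piMr // invf_le1 //; lra.
    nra.
  rewrite min_r ?(ltW s1) // in hm.
  apply: (@le_trans _ _ 32); last lra.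
  rewrite mulrA ler_pdivrMr //; nra.
rewrite normrM.
apply: (@le_trans _ _ (`|v - s| * (2 * expR (- (s / 2)) * `|v - s|))).
  apply: ler_wpM2l; first exact: normr_ge0.
  by apply: ler_pM.
rewrite mulrCA -expr2 real_normK ?num_real // expr_div_n.
have -> : 96 * ((v - s) ^+ 2 / s ^+ 2) * tanh_half s = (v - s) ^+ 2 * (96 * tanh_half s / s ^+ 2) by ring.
rewrite mulrC; apply: ler_wpM2l; first exact: sqr_ge0.
by rewrite ler_pdivlMr ?exprn_gt0 // mulrC.
Qed.

End tanh.

(** * The sum of tanh (l s / 2) / l ^ 3 *)

Section HK.
Variable R : realType.
Implicit Types (s v x a b : R).

Lemma lim_series (u : nat -> R) : u 0%N = 0 ->
  limn (fun N => \sum_(1 <= l < N) u l) = limn (series u).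
Proof.
move=> u0; congr (limn _); apply/funext => -[|N].
  by rewrite /series /= !big_geq.
by rewrite /series /= [RHS]big_ltn // u0 add0r.
Qed.

(** This is [zeta 3 - 2 eta 2 s] for positive [s], see [tanh_sum_eta]. *)
Definition tanh_sum s : R := wsum (fun l => tanh_half (l%:R * s) / l%:R).
(** The product of [s] and of the derivative of [tanh_sum] at [s]. *)
Definition dtanh_sum s : R := wsum (fun l => s * dtanh_half (l%:R * s)).

Lemma nat_ge1 (l : nat) : (0 < l)%N -> 1 <= l%:R :> R.
Proof. by rewrite ler1n. Qed.

Lemma zeta3E : zeta (3 : R) = wsum (fun l => l%:R^-1).
Proof.
rewrite /zeta /wsum -lim_series ?isq0 ?mulr0 //.
congr (limn _); apply/funext => N; apply: eq_bigr => l _.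
by rewrite powR_mulrn // /isq -invfM -exprS.
Qed.

Lemma eta2E x : eta 2 x = wsum (fun l => expR (- (l%:R * x)) / (l%:R * (1 + expR (- (l%:R * x))))).
Proof.
rewrite /eta /wsum -lim_series ?isq0 ?mulr0 //.
congr (limn _); apply/funext => N; apply: eq_bigr => l _.
rewrite (_ : 2 * 2%:Z - 1 = 3%:Z) // -exprnP /isq -mulrA -invfM.
by congr (_ / _); rewrite exprS; ring.
Qed.

Lemma bounded_inv : bounded_by 1 (fun l => l%:R^-1 : R).
Proof.
move=> l l0; have h := nat_ge1 l0.
by rewrite ger0_norm ?invr_ge0 // invf_le1 // (lt_le_trans ltr01).
Qed.

Lemma tanh_half_div_ge0 s (l : nat) : 0 <= s -> 0 <= tanh_half (l%:R * s) / l%:R.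
Proof. by move=> s0; rewrite divr_ge0 // tanh_half_ge0 // mulr_ge0. Qed.

Lemma tanh_half_div_le1 s (l : nat) : (0 < l)%N -> tanh_half (l%:R * s) / l%:R <= 1.
Proof.
move=> l0; have h := nat_ge1 l0; rewrite ler_pdivrMr ?(lt_le_trans ltr01) // mul1r.
by apply: le_trans h; exact: tanh_half_le1.
Qed.

Lemma tanh_sum_bounded s : 0 <= s -> bounded_by 1 (fun l => tanh_half (l%:R * s) / l%:R).
Proof.
move=> s0 l l0; rewrite ger0_norm ?tanh_half_div_le1 //.
exact: tanh_half_div_ge0.
Qed.

Lemma dtanh_sum_term_le s (l : nat) : 0 <= s -> (0 < l)%N ->
  s * dtanh_half (l%:R * s) <= tanh_half (l%:R * s) / l%:R.
Proof.
move=> s0 l0; have h := nat_ge1 l0; rewrite ler_pdivlMr ?(lt_le_trans ltr01) //.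
by rewrite mulrC mulrA tanh_half_ge_dtanh_half // mulr_ge0.
Qed.

Lemma dtanh_sum_term_ge0 s (l : nat) : 0 <= s -> 0 <= s * dtanh_half (l%:R * s).
Proof. by move=> s0; rewrite mulr_ge0 // dtanh_half_ge0. Qed.

Lemma dtanh_sum_bounded s : 0 <= s -> bounded_by 1 (fun l => s * dtanh_half (l%:R * s)).
Proof.
move=> s0 l l0; rewrite ger0_norm ?dtanh_sum_term_ge0 //.
exact: le_trans (dtanh_sum_term_le s0 l0) (tanh_half_div_le1 _ l0).
Qed.

Lemma zeta3_le2 : zeta (3 : R) <= 2.
Proof.
rewrite zeta3E; have := wsum_norm bounded_inv; rewrite mulr1.
exact: le_trans (ler_norm _).
Qed.

Lemma zeta3_ge1 : 1 <= zeta (3 : R).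
Proof.
by rewrite zeta3E; have := wsum_ge_first bounded_inv; rewrite invr1; apply => l _; rewrite invr_ge0.
Qed.

Lemma tanh_sum_ge_tanh_half s : 0 <= s -> tanh_half s <= tanh_sum s.
Proof.
move=> s0; have := wsum_ge_first (tanh_sum_bounded s0); rewrite mul1r divr1; apply => l _.
exact: tanh_half_div_ge0.
Qed.

Lemma tanh_sum_gt0 s : 0 < s -> 0 < tanh_sum s.
Proof. by move=> s0; apply: lt_le_trans (tanh_sum_ge_tanh_half (ltW s0)); exact: tanh_half_gt0. Qed.

Lemma tanh_sum_le_zeta3 s : 0 <= s -> tanh_sum s <= zeta 3.
Proof.
move=> s0; rewrite zeta3E; apply: wsum_le (tanh_sum_bounded s0) bounded_inv _ => l l0.
by rewrite ler_piMl ?invr_ge0 ?tanh_half_le1.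
Qed.

Lemma dtanh_sum_ge0 s : 0 <= s -> 0 <= dtanh_sum s.
Proof. by move=> s0; apply: wsum_ge0 (dtanh_sum_bounded s0) _ => l _; exact: dtanh_sum_term_ge0. Qed.

Lemma dtanh_sum_le s : 0 <= s -> dtanh_sum s <= tanh_sum s.
Proof. by move=> s0; apply: wsum_le (dtanh_sum_bounded s0) (tanh_sum_bounded s0) _ => l; exact: dtanh_sum_term_le. Qed.

Lemma tanh_sum_eta s : 0 < s -> tanh_sum s = zeta 3 - 2 * eta 2 s.
Proof.
move=> s0; rewrite zeta3E eta2E.
have e1 l : (0 < l)%N -> expR (- (l%:R * s)) / (l%:R * (1 + expR (- (l%:R * s)))) =
    2^-1 * (l%:R^-1 - tanh_half (l%:R * s) / l%:R).
  move=> l0; rewrite tanh_halfE; have := nat_ge1 l0; have := den_gt0 (l%:R * s).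
  by move=> ? ?; field; apply/andP; split; rewrite gt_eqF //; lra.
rewrite (eq_wsum e1) (@wsumZ _ (1 + 1)); last first.
  move=> l l0; rewrite (le_trans (ler_normB _ _)) // lerD //; first exact: bounded_inv.
  by apply: tanh_sum_bounded => //; exact: ltW.
rewrite (wsumB bounded_inv (tanh_sum_bounded (ltW s0))) -/(tanh_sum s); lra.
Qed.

Lemma tanh_sum_le_tangent s v : 0 < s -> 0 <= v -> tanh_sum v <= tanh_sum s + (v - s) / s * dtanh_sum s.
Proof.
move=> s0 v0; have s0' := ltW s0.
have b := bounded_byZ ((v - s) / s) (dtanh_sum_bounded s0').
rewrite /dtanh_sum -(wsumZ _ (dtanh_sum_bounded s0')) -(wsumD (tanh_sum_bounded s0') b).
apply: wsum_le (tanh_sum_bounded v0) (bounded_byD (tanh_sum_bounded s0') b) _ => l l0.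
have l1 := nat_ge1 l0; have lp : 0 < l%:R :> R by lra.
have -> : (v - s) / s * (s * dtanh_half (l%:R * s)) = (v - s) * dtanh_half (l%:R * s).
  by field; rewrite gt_eqF.
rewrite ler_pdivrMr // mulrDl divfK ?gt_eqF //.
have := tanh_half_le_mul (mulr_ge0 (ltW lp) s0') (mulr_ge0 (ltW lp) v0).
by rewrite -mulrBr; move/le_trans; apply; rewrite lerD2l; lra.
Qed.

(** The termwise estimate [tanh_half_taylor] has a relative error, hence it
    adds up; it contains the differentiability of the sum. *)
Lemma tanh_sum_taylor s v : 0 < s -> `|v - s| <= s / 2 ->
  `|tanh_sum v - tanh_sum s - (v - s) / s * dtanh_sum s| <= 96 * ((v - s) / s) ^+ 2 * tanh_sum s.
Proof.
move=> s0 vs; have s0' := ltW s0.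
have v0 : 0 <= v by move: vs; rewrite ler_norml => /andP[? ?]; lra.
have b := bounded_byZ ((v - s) / s) (dtanh_sum_bounded s0').
have b1 := bounded_byD (tanh_sum_bounded v0) (bounded_byZ (-1) (tanh_sum_bounded s0')).
have b2 := bounded_byD b1 (bounded_byZ (-1) b).
have E : tanh_sum v - tanh_sum s - (v - s) / s * dtanh_sum s = wsum (fun l => tanh_half (l%:R * v) / l%:R
    + (-1) * (tanh_half (l%:R * s) / l%:R) + (-1) * ((v - s) / s * (s * dtanh_half (l%:R * s)))).
  rewrite (wsumD b1 (bounded_byZ (-1) b)) (wsumD (tanh_sum_bounded v0) (bounded_byZ (-1) (tanh_sum_bounded s0'))).
  rewrite (wsumZ _ (tanh_sum_bounded s0')) (wsumZ _ b) (wsumZ _ (dtanh_sum_bounded s0')) -/(tanh_sum v) -/(tanh_sum s) -/(dtanh_sum s); ring.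
have b3 := bounded_byZ (96 * ((v - s) / s) ^+ 2) (tanh_sum_bounded s0').
have key l : (0 < l)%N -> `|tanh_half (l%:R * v) / l%:R
    + (-1) * (tanh_half (l%:R * s) / l%:R) + (-1) * ((v - s) / s * (s * dtanh_half (l%:R * s)))|
    <= 96 * ((v - s) / s) ^+ 2 * (tanh_half (l%:R * s) / l%:R).
  move=> l0; have l1 := nat_ge1 l0; have lp : 0 < l%:R :> R by lra.
  have h1 : `|l%:R * v - l%:R * s| <= l%:R * s / 2.
    by rewrite -mulrBr normrM ger0_norm ?(ltW lp) // -mulrA ler_wpM2l // ltW.
  have := tanh_half_taylor (mulr_gt0 lp s0) h1.
  rewrite -mulrBr -(mulf_div l%:R l%:R) divff ?gt_eqF // mul1r => h2.
  rewrite [X in `|X|](_ : _ = (tanh_half (l%:R * v) - tanh_half (l%:R * s) -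
     l%:R * (v - s) * dtanh_half (l%:R * s)) / l%:R); last by field; rewrite !gt_eqF.
  by rewrite normrM normfV (ger0_norm (ltW lp)) mulrA ler_wpM2r // invr_ge0 ltW.
rewrite E -(wsumZ _ (tanh_sum_bounded s0')) ler_norml; apply/andP; split.
  rewrite -[X in X <= _]mulN1r -(wsumZ _ b3); apply: wsum_le (bounded_byZ (-1) b3) b2 _ => l l0.
  by rewrite mulN1r; move: (key l l0); rewrite ler_norml => /andP[].
apply: wsum_le b2 b3 _ => l l0.
by move: (key l l0); rewrite ler_norml => /andP[].
Qed.

Lemma derive1_eta s : 0 < s -> derive1 (@eta R 2) s = - (dtanh_sum s / (2 * s)).
Proof.
move=> s0; rewrite /derive1; apply: cvg_lim => //.
apply/cvgrPdist_le => e e0.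
have Hs := tanh_sum_gt0 s0.
near=> h.
have hn0 : h != 0 by near: h; exact: nbhs_dnbhs_neq.
have hs : `|h| <= s / 2.
  near: h; apply: dnbhs0_le; by rewrite divr_gt0.
have he : `|h| <= e * s ^+ 2 / (48 * tanh_sum s).
  near: h; apply: dnbhs0_le; by rewrite divr_gt0 ?mulr_gt0 ?exprn_gt0.
have hs0 : 0 < h + s by move: hs; rewrite ler_norml => /andP[? ?]; lra.
have e1 : eta 2 (h + s) = (zeta 3 - tanh_sum (h + s)) / 2 by rewrite (tanh_sum_eta hs0); field.
have e2 : eta 2 s = (zeta 3 - tanh_sum s) / 2 by rewrite (tanh_sum_eta s0); field.
have := @tanh_sum_taylor s (h + s) s0; rewrite addrK => /(_ hs) ht.
rewrite e1 e2 /GRing.scale /=.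
rewrite [X in `|X|](_ : _ = (tanh_sum (h + s) - tanh_sum s - h / s * dtanh_sum s) / (2 * h)); last first.
  by field; rewrite hn0 gt_eqF.
rewrite normrM normfV normrM (ger0_norm (ler0n _ _)).
rewrite ler_pdivrMr ?mulr_gt0 ?normr_gt0 //; apply: le_trans ht _.
move: he; rewrite ler_pdivlMr ?mulr_gt0 // => he.
rewrite expr_div_n -real_normK ?num_real //.
have sn : s != 0 by rewrite gt_eqF.
rewrite -(ler_pM2r (exprn_gt0 2 s0)).
have -> : 96 * (`|h| ^+ 2 / s ^+ 2) * tanh_sum s * s ^+ 2 = (2 * `|h|) * (`|h| * (48 * tanh_sum s)) by field.
rewrite [leRHS](_ : _ = (2 * `|h|) * (e * s ^+ 2)); last by ring.
by rewrite ler_wpM2l // mulr_ge0.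
Unshelve. all: by end_near.
Qed.

Lemma saddle_eqE a r : 0 < a -> 0 < r -> saddle_eq a r <-> r ^+ 3 = tanh_sum (a * r) - dtanh_sum (a * r) / 2.
Proof.
move=> a0 r0; have s0 := mulr_gt0 a0 r0.
rewrite /saddle_eq derive1_eta // (tanh_sum_eta s0).
have -> : a * r * - (dtanh_sum (a * r) / (2 * (a * r))) = - (dtanh_sum (a * r) / 2).
  by field; rewrite !gt_eqF.
by split => h; lra.
Qed.

Lemma growthE a r : 0 < a -> 0 < r -> growth a r = r + tanh_sum (a * r) / (2 * r ^+ 2).
Proof. by move=> a0 r0; rewrite /growth -tanh_sum_eta // mulr_gt0. Qed.

End HK.

(** * The sum of the inverse squares *)

Section basel.
Variable R : realType.
Implicit Types (x : R).

Lemma sin_le x : 0 <= x -> sin x <= x.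
Proof.
move=> x0; have [c [_ _]] := mvt 0 x (fun x => is_derive_sin x).
rewrite sin0 !subr0 => ->; rewrite ler_piMl // cos_le1 //.
Qed.

Lemma x_cos_le_sin x : 0 <= x <= pi -> x * cos x <= sin x.
Proof.
move=> /andP[x0 xpi].
have d (y : R) : is_derive y 1 (fun y : R => sin y - y * cos y) (y * sin y).
  by apply: is_derive_eq; rewrite /GRing.scale /=; ring.
have [c [c1 c2]] := mvt 0 x d.
rewrite min_l // in c1; rewrite max_r // in c2.
rewrite mul0r sin0 !subr0 => E; rewrite -subr_ge0 E !mulr_ge0 // sin_ge0_pi //.
by rewrite c1 (le_trans c2).
Qed.

Definition csc2 x : R := (sin x ^+ 2)^-1.

Lemma csc2_ge x : 0 < x < pi / 2 -> (x ^+ 2)^-1 <= csc2 x.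
Proof.
move=> /[dup] x01 /andP[x0 x1]; have s0 := sin_gt0_pihalf x01.
by rewrite lef_pV2 ?posrE ?exprn_gt0 // ler_pXn2r ?nnegrE ?(ltW x0) ?(ltW s0) // sin_le // ltW.
Qed.

Lemma csc2_le x : 0 < x < pi / 2 -> csc2 x <= (x ^+ 2)^-1 + 1.
Proof.
move=> /[dup] x01 /andP[x0 x1]; have s0 := sin_gt0_pihalf x01.
have c0 : 0 < cos x by apply: cos_gt0_pihalf; rewrite x1 andbT; have := pi_gt0 R; lra.
have h : x * cos x <= sin x.
  by apply: x_cos_le_sin; rewrite ltW //= ltW // (lt_trans x1) // ltr_pdivrMr // ltr_pMr ?pi_gt0 // ltr1n.
have h2 : x ^+ 2 * (1 - sin x ^+ 2) <= sin x ^+ 2.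
  by rewrite -cos2sin2 -exprMn ler_pXn2r ?nnegrE ?mulr_ge0 ?(ltW x0) ?(ltW c0) ?(ltW s0).
have x20 : 0 < x ^+ 2 by rewrite exprn_gt0.
have s20 : 0 < sin x ^+ 2 by rewrite exprn_gt0.
rewrite /csc2 -[leLHS]mul1r ler_pdivrMr // mulrDl mul1r.
rewrite -(ler_pM2l x20) mulrDr mulrA divff ?gt_eqF // mul1r; lra.
Qed.

(** Both sides are [4 / sin x ^ 2], by the double angle formula and
    [sin ^ 2 + cos ^ 2 = 1]. *)
Lemma csc2_half x : 0 < x < pi / 2 ->
  csc2 (x / 2) + csc2 (pi / 2 - x / 2) = 4 * csc2 x.
Proof.
move=> /andP[x0 x1].
have h : 0 < x / 2 < pi / 2 by apply/andP; split; lra.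
have s0 := sin_gt0_pihalf h.
have c0 : 0 < cos (x / 2) by apply: cos_gt0_pihalf; apply/andP; split; lra.
have e1 : sin (pi / 2 - x / 2) = cos (x / 2) by rewrite addrC sinDpihalf cosN.
have e2 : sin x = 2 * (cos (x / 2) * sin (x / 2)).
  by rewrite {1}(splitr x) -mulr2n sin_mulr2n mulr_natl.
have e3 : cos (x / 2) ^+ 2 + sin (x / 2) ^+ 2 = 1 by exact: cos2Dsin2.
rewrite /csc2 e1 e2; set c := cos _ in c0 e3 *; set s := sin _ in s0 e3 *.
rewrite [LHS](_ : _ = (c ^+ 2 + s ^+ 2) / (c ^+ 2 * s ^+ 2)); last first.
  by field; rewrite !gt_eqF.
by rewrite e3; field; rewrite !gt_eqF.
Qed.

Definition dyadic (n : nat) : R := pi / (4 * 2 ^+ n).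

Lemma dyadic_odd n k : (k < 2 ^ n)%N -> 0 < (2 * k + 1)%:R * dyadic n < pi / 2.
Proof.
move=> kn; have h2 : 0 < 2 ^+ n :> R by rewrite exprn_gt0.
have p0 := pi_gt0 R.
rewrite mulr_gt0 ?ltr0n ?addn1 // ?divr_gt0 ?mulr_gt0 //= /dyadic.
have hk : (2 * k).+1%:R < 2 * 2 ^+ n :> R.
  by rewrite -natrX -natrM ltr_nat; lia.
rewrite mulrA ltr_pdivrMr ?mulr_gt0 //.
have -> : pi / 2 * (4 * 2 ^+ n) = (2 * 2 ^+ n) * pi :> R by field.
by rewrite ltr_pM2r.
Qed.

(** Halving an angle and taking the complement maps the odd multiples of one
    dyadic fraction of [pi] onto those of the next, so [csc2_half] quadruples
    the sum. *)
Lemma csc2_sum n : \sum_(k < 2 ^ n) csc2 ((2 * k + 1)%:R * dyadic n) = 2 * 4 ^+ n.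
Proof.
elim: n => [|n IH].
  rewrite expn0 big_ord1 /dyadic muln0 add0n !expr0 mul1r !mulr1.
  have e : sin (pi / 2) = 2 * (cos (pi / 4) * sin (pi / 4)) :> R.
    by rewrite mulr_natl -sin_mulr2n; congr sin; rewrite [RHS]mulr2n; lra.
  have e1 : cos (pi / 4) = sin (pi / 4) :> R.
    by rewrite -cosBpihalf -cosN; congr cos; lra.
  rewrite sin_pihalf e1 in e; rewrite /csc2 expr2.
  have -> : sin (pi / 4) * sin (pi / 4) = 2^-1 :> R by lra.
  by rewrite invrK.
have E : (2 ^ n.+1 = 2 ^ n + 2 ^ n)%N by rewrite expnS mul2n addnn.
have -> : \sum_(k < 2 ^ n.+1) csc2 ((2 * k + 1)%:R * dyadic n.+1) =
    \sum_(k < 2 ^ n + 2 ^ n) csc2 ((2 * k + 1)%:R * dyadic n.+1) by rewrite E.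
rewrite big_split_ord /= [X in _ + X](reindex_inj rev_ord_inj) /= -big_split /=.
rewrite exprS mulrCA -IH mulr_sumr; apply: eq_bigr => k _.
have p2 : 2 ^+ n != 0 :> R by rewrite expf_neq0.
have e1 : (2 * k + 1)%:R * dyadic n.+1 = (2 * k + 1)%:R * dyadic n / 2.
  by rewrite /dyadic exprS; field.
rewrite -csc2_half ?dyadic_odd // e1; congr (_ + csc2 _).
have kn := ltn_ord k.
have -> : (2 * (2 ^ n + (2 ^ n - k.+1)) + 1 = 4 * 2 ^ n - (2 * k + 1))%N by lia.
rewrite natrB; last by lia.
by rewrite natrM natrX /dyadic exprS; field.
Qed.

(** On each angle, [csc2 x] lies between [1 / x ^ 2] and [1 / x ^ 2 + 1]. *)
Lemma odd_isq_bounds n :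
  pi ^+ 2 / 8 - pi ^+ 2 / 16 / 2 ^+ n <= \sum_(k < 2 ^ n) isq R (2 * k + 1) <= pi ^+ 2 / 8.
Proof.
set O := \sum_(k < 2 ^ n) _.
have [p pE] : exists p : R, p = pi by exists pi.
have p0 : 0 < p by rewrite pE pi_gt0.
have t0 : 0 < 2 ^+ n :> R by rewrite exprn_gt0.
have E : \sum_(k < 2 ^ n) (((2 * k + 1)%:R * dyadic n) ^+ 2)^-1 = O * (16 * 4 ^+ n / p ^+ 2).
  rewrite /O mulr_suml; apply: eq_bigr => k _.
  have -> : 4 ^+ n = (2 ^+ n) ^+ 2 :> R by rewrite -exprM mulnC exprM; congr (_ ^+ n); ring.
  have : 0 < (2 * k + 1)%:R :> R by rewrite ltr0n addn1.
  rewrite /isq /dyadic -pE; move: (2 * k + 1)%:R => j j0.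
  by field; rewrite !gt_eqF.
have h1 : O * (16 * 4 ^+ n / p ^+ 2) <= 2 * 4 ^+ n.
  by rewrite -E -csc2_sum; apply: ler_sum => k _; rewrite csc2_ge // dyadic_odd.
have h2 : 2 * 4 ^+ n <= O * (16 * 4 ^+ n / p ^+ 2) + 2 ^+ n.
  rewrite -E -csc2_sum -natrX -[X in _ <= _ + X]mulr1 mulr_natl.
  rewrite -[X in _ + _ *+ X](card_ord (2 ^ n)) -sumr_const -big_split /=.
  by apply: ler_sum => k _; rewrite csc2_le // dyadic_odd.
have e4 : 4 ^+ n = 2 ^+ n * 2 ^+ n :> R by rewrite -exprMn; congr (_ ^+ n); ring.
rewrite e4 in h1 h2; set t := 2 ^+ n in t0 h1 h2 *.
have q0 : 0 < p ^+ 2 :> R by rewrite exprn_gt0.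
have f0 : 0 < p ^+ 2 / (16 * (t * t)) by rewrite divr_gt0 ?mulr_gt0.
rewrite -pE; apply/andP; split.
  move: h2; rewrite -(ler_pM2r f0) => h2.
  have e1 : 2 * (t * t) * (p ^+ 2 / (16 * (t * t))) = p ^+ 2 / 8 by field; rewrite gt_eqF.
  have e2 : (O * (16 * (t * t) / p ^+ 2) + t) * (p ^+ 2 / (16 * (t * t))) = O + p ^+ 2 / 16 / t.
    by field; rewrite !gt_eqF.
  by rewrite e1 e2 in h2; lra.
move: h1; rewrite -(ler_pM2r f0) => h1.
have e1 : 2 * (t * t) * (p ^+ 2 / (16 * (t * t))) = p ^+ 2 / 8 by field; rewrite gt_eqF.
have e2 : (O * (16 * (t * t) / p ^+ 2)) * (p ^+ 2 / (16 * (t * t))) = O.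
  by field; rewrite !gt_eqF.
by rewrite e1 e2 in h1.
Qed.

Lemma isq_split N : \sum_(0 <= l < 2 * N) isq R l =
  4^-1 * \sum_(0 <= l < N) isq R l + \sum_(k < N) isq R (2 * k + 1).
Proof.
elim: N => [|N IH]; first by rewrite muln0 !big_geq // big_ord0 mulr0 addr0.
have -> : (2 * N.+1 = (2 * N).+2)%N by lia.
rewrite !big_nat_recr //= big_ord_recr /= IH addn1.
have -> : isq R (2 * N) = 4^-1 * isq R N.
  rewrite /isq natrM exprMn invfM; congr (_^-1 * _); ring.
by rewrite mulrDr; ring.
Qed.

Lemma basel : wsum (fun=> 1 : R) = pi ^+ 2 / 6.
Proof.
have b1 : bounded_by (1 : R) (fun=> 1) by move=> l _; rewrite normr1.
set Z := wsum _.
have c : series (isq R) @ \oo --> Z.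
  have := wsum_cvg b1; rewrite (_ : (fun l => 1 * isq R l) = isq R) //.
  by apply/funext => l; rewrite mul1r.
have c2 : (fun n => series (isq R) (2 ^ n)%N) @ \oo --> Z.
  apply: cvg_comp c; apply/cvgnyPge => A; near=> n.
  apply: leq_trans (_ : n <= _)%N; first by near: n; exact: nbhs_infty_ge.
  by apply: ltnW; exact: ltn_expl.
have c3 : (fun n => series (isq R) (2 ^ n.+1)%N) @ \oo --> Z.
  by have := c2; rewrite -(cvg_shiftS (fun n => series (isq R) (2 ^ n)%N)).
have c4 : (fun n => \sum_(k < 2 ^ n) isq R (2 * k + 1)) @ \oo --> Z - 4^-1 * Z.
  have -> : (fun n => \sum_(k < 2 ^ n) isq R (2 * k + 1)) =
     (fun n => series (isq R) (2 ^ n.+1)%N - 4^-1 * series (isq R) (2 ^ n)%N).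
    by apply/funext => n; rewrite /series /= expnS isq_split addrC addKr.
  by apply: cvgB => //; apply: cvgMl_tmp.
have c5 : (fun n => \sum_(k < 2 ^ n) isq R (2 * k + 1)) @ \oo --> (pi ^+ 2 / 8 : R).
  apply: (@squeeze_cvgr _ _ _ _ (fun n => pi ^+ 2 / 8 - pi ^+ 2 / 16 * 2^-1 ^+ n) (fun=> pi ^+ 2 / 8)).
  - by apply: nearW => n; have := odd_isq_bounds n; rewrite exprVn.
  - rewrite -[X in _ --> X]subr0; apply: cvgB; first exact: cvg_cst.
    rewrite -(mulr0 (pi ^+ 2 / 16)); apply: cvgMl_tmp; apply: cvg_expr.
    by rewrite ger0_norm ?invr_ge0 // invf_lt1 // ltr1n.
  - exact: cvg_cst.
have E : Z - 4^-1 * Z = pi ^+ 2 / 8 by exact: cvg_unique c4 c5.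
by lra.
Unshelve. all: by end_near.
Qed.

End basel.

(** * Behaviour of the sum, and existence of the saddle point *)

Section limits.
Variable R : realType.
Implicit Types (s v x a b r : R).

Lemma continuous_tanh_half : continuous (@tanh_half R).
Proof.
by move=> v; apply/differentiable_continuous/derivable1_diffP; have [] := is_derive_tanh_half v.
Qed.

Lemma continuous_dtanh_half : continuous (@dtanh_half R).
Proof.
by move=> v; apply/differentiable_continuous/derivable1_diffP; have [] := is_derive_dtanh_half v.
Qed.

Lemma continuous_scale (f : R -> R) (l : nat) : continuous f -> continuous (fun s => f (l%:R * s)).
Proof.
move=> cf s; apply: (@continuous_comp _ _ _ (fun s => l%:R * s) f); last exact: cf.
exact: mulrl_continuous.
Qed.

Lemma dtanh_sum_continuous s : 0 < s -> {for s, continuous (@dtanh_sum R)}.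
Proof.
move=> s0; apply: (@wsum_tannery _ _ (nbhs s) _ 1).
  near=> x; apply: dtanh_sum_bounded; apply: ltW; near: x; exact: lt_nbhsr.
move=> l l0; apply: cvgM; first exact: cvg_id.
exact: continuous_scale continuous_dtanh_half s.
Unshelve. all: by end_near.
Qed.

Lemma tanh_sum_continuous s : 0 < s -> {for s, continuous (@tanh_sum R)}.
Proof.
move=> s0; apply: (@wsum_tannery _ _ (nbhs s) _ 1).
  near=> x; apply: tanh_sum_bounded; apply: ltW; near: x; exact: lt_nbhsr.
by move=> l l0; apply: cvgMr_tmp; exact: continuous_scale continuous_tanh_half s.
Unshelve. all: by end_near.
Qed.

(** The quotient of [dtanh_sum s] by [s], which is continuous at [0] also. *)
Definition kappa s : R := wsum (fun l => dtanh_half (l%:R * s)).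

Lemma dtanh_half_bounded s : bounded_by (1 / 2) (fun l => dtanh_half (l%:R * s)).
Proof. by move=> l _; rewrite ger0_norm ?dtanh_half_ge0 // dtanh_half_le_half. Qed.

Lemma kappa0 : kappa 0 = pi ^+ 2 / 12.
Proof.
have b1 : bounded_by (1 : R) (fun=> 1) by move=> l _; rewrite normr1.
rewrite /kappa (eq_wsum (h := fun=> (1 / 2 * 1 : R))); last first.
  by move=> l _; rewrite mulr0 /dtanh_half oppr0 expR0; field.
by rewrite (wsumZ _ b1) basel; lra.
Qed.

Lemma kappa_continuous : {for 0, continuous kappa}.
Proof.
apply: (@wsum_tannery _ _ (nbhs 0) _ (1 / 2)).
  by apply: nearW => x; exact: dtanh_half_bounded.
by move=> l l0; exact: continuous_scale continuous_dtanh_half 0.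
Qed.

Lemma dtanh_sum_kappa s : dtanh_sum s = s * kappa s.
Proof. by rewrite /dtanh_sum (wsumZ _ (dtanh_half_bounded s)). Qed.

Lemma tanh_sum_le_linear s : 0 <= s -> tanh_sum s <= s * (pi ^+ 2 / 12).
Proof.
move=> s0; have b1 : bounded_by (1 : R) (fun=> 1) by move=> l _; rewrite normr1.
have -> : s * (pi ^+ 2 / 12) = wsum (fun=> s / 2 * 1) by rewrite (wsumZ _ b1) basel; lra.
apply: wsum_le (tanh_sum_bounded s0) (bounded_byZ (s / 2) b1) _ => l l0.
have l1 := nat_ge1 R l0; rewrite mulr1 ler_pdivrMr ?(lt_le_trans ltr01) //.
have := @tanh_half_le_half _ (l%:R * s); rewrite mulr_ge0 // => /(_ isT); lra.
Qed.

Lemma expRN_le s : 0 < s -> expR (- s) <= s^-1.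
Proof.
move=> s0; rewrite expRN lef_pV2 ?posrE ?expR_gt0 //.
by have := expR_ge1Dx s; lra.
Qed.

Lemma tanh_sum_ge_infty s : 0 < s -> zeta 3 - 4 / s <= tanh_sum s.
Proof.
move=> s0; have b1 : bounded_by (1 : R) (fun=> 1) by move=> l _; rewrite normr1.
have hb := bounded_byD (bounded_inv R) (bounded_byZ (- (2 / s)) b1).
have h : wsum (fun l => l%:R^-1 + - (2 / s) * 1) <= tanh_sum s.
  apply: wsum_le hb (tanh_sum_bounded (ltW s0)) _ => l l0; have l1 := nat_ge1 R l0.
  have lp : 0 < l%:R :> R by lra.
  have e1 : expR (- (l%:R * s)) <= s^-1.
    apply: le_trans (expRN_le s0); rewrite ler_expR lerN2; nra.
  have e2 : 1 - 2 * expR (- (l%:R * s)) <= tanh_half (l%:R * s).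
    rewrite tanh_halfE ler_pdivlMr ?den_gt0 //.
    by have := expR_gt0 (- (l%:R * s)); nra.
  rewrite ler_pdivlMr // mulrDl mulVf ?gt_eqF // mulr1; apply: le_trans e2.
  have i0 : 0 < s^-1 by rewrite invr_gt0.
  have i1 : 0 <= s^-1 * (l%:R - 1) by rewrite mulr_ge0 ?subr_ge0 // ltW.
  rewrite mulNr lerD2l lerN2; lra.
have z : wsum (fun=> 1 : R) <= 2 by have := wsum_norm b1; rewrite mulr1; exact: le_trans (ler_norm _).
rewrite (wsumD (bounded_inv R) (bounded_byZ _ b1)) (wsumZ _ b1) -zeta3E in h.
apply: le_trans h; rewrite lerD2l mulNr lerN2.
have i0 : 0 < s^-1 by rewrite invr_gt0.
nra.
Qed.

Lemma dtanh_sum_le_infty s : 0 < s -> dtanh_sum s <= 8 / s.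
Proof.
move=> s0; have b1 : bounded_by (1 : R) (fun=> 1) by move=> l _; rewrite normr1.
have h : dtanh_sum s <= wsum (fun=> 4 / s * 1).
  apply: wsum_le (dtanh_sum_bounded (ltW s0)) (bounded_byZ (4 / s) b1) _ => l l0; have l1 := nat_ge1 R l0.
  rewrite mulr1; apply: le_trans (_ : s * (2 * expR (- s)) <= _).
    rewrite ler_wpM2l ?(ltW s0) //; apply: le_trans (dtanh_half_le _) _.
    rewrite ler_wpM2l // ler_expR lerN2; nra.
  have := expR_ge_sq (ltW s0); have := expR_gt0 s; rewrite expRN; set E := expR s => E0 E1.
  rewrite ler_pdivlMr // [leLHS](_ : _ = 2 * s ^+ 2 / E); last by field; rewrite gt_eqF.
  rewrite ler_pdivrMr //; lra.
have z : wsum (fun=> 1 : R) <= 2 by have := wsum_norm b1; rewrite mulr1; exact: le_trans (ler_norm _).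
rewrite (wsumZ _ b1) in h; apply: le_trans h _.
have i0 : 0 < s^-1 by rewrite invr_gt0.
nra.
Qed.

Lemma saddle_rhs_ge_half s : 0 <= s -> tanh_sum s / 2 <= tanh_sum s - dtanh_sum s / 2.
Proof. by move=> s0; have := dtanh_sum_le s0; lra. Qed.

Lemma saddle_rhs_le s : 0 <= s -> tanh_sum s - dtanh_sum s / 2 <= tanh_sum s.
Proof. by move=> s0; have := dtanh_sum_ge0 s0; lra. Qed.

Lemma saddle_rhs_ge_min s : 0 <= s -> Num.min s 1 / 6 <= tanh_sum s - dtanh_sum s / 2.
Proof.
move=> s0; have := saddle_rhs_ge_half s0; have := tanh_sum_ge_tanh_half s0; have := tanh_half_ge_min s0; lra.
Qed.

(** Near [0] the right-hand side is at least linear in [r], and it is bounded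
    by [zeta 3 <= 2]; so it crosses [r ^ 3] between [r1] and [2]. *)
Lemma saddle_exists a : 0 < a -> exists2 r : R, 0 < r & saddle_eq a r.
Proof.
move=> a0; pose f r := tanh_sum (a * r) - dtanh_sum (a * r) / 2 - r ^+ 3.
(* r1 <= 1 / 2 handles the case 1 <= a r1, and r1 <= a / 6 the other one. *)
pose r1 := Num.min (1 / 2) (a / 6).
have r10 : 0 < r1 by rewrite lt_min; apply/andP; split; lra.
have r1h : r1 <= 1 / 2 by rewrite ge_min lexx.
have r1a : r1 <= a / 6 by rewrite ge_min lexx orbT.
have f1 : 0 <= f r1.
  have s0 : 0 <= a * r1 by rewrite mulr_ge0 ?ltW.
  have := saddle_rhs_ge_min s0; rewrite /f.
  have [s1|s1] := leP (a * r1) 1; nra.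
have f2 : f 2 <= 0.
  have s0 : 0 <= a * 2 by rewrite mulr_ge0 ?ltW.
  have := saddle_rhs_le s0; have := tanh_sum_le_zeta3 s0; have := zeta3_le2 R; rewrite /f.
  move=> ? ? ?; have -> : 2 ^+ 3 = 8 :> R by ring.
  lra.
have r12 : r1 <= 2 by lra.
have cf : {within `[r1, 2], continuous f}.
  apply: continuous_in_subspaceT => x; rewrite inE /= in_itv /= => /andP[x1 _].
  have x0 : 0 < x by lra.
  have cm : {for x, continuous (fun x => a * x)} by exact: mulrl_continuous.
  apply: cvgB; last exact: exprn_continuous.
  apply: cvgB; first by apply: continuous_comp cm _; exact/tanh_sum_continuous/mulr_gt0.
  by apply: cvgMr_tmp; apply: continuous_comp cm _; exact/dtanh_sum_continuous/mulr_gt0.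
have [] := IVT r12 cf (v := 0).
  by rewrite ge_min f2 orbT /= le_max f1.
move=> r; rewrite in_itv /= => /andP[rr _] fr.
have r0 : 0 < r by lra.
exists r => //; apply/saddle_eqE => //; move: fr; rewrite /f; lra.
Qed.

End limits.

(** * Growth for narrow and for wide bands *)

Section growth_limits.
Variable R : realType.
Variable r : R -> R.
Hypothesis hr : forall a : R, 0 < a -> 0 < r a /\ saddle_eq a (r a).
Implicit Type a : R.

Lemma saddle_cube a : 0 < a -> r a ^+ 3 = tanh_sum (a * r a) - dtanh_sum (a * r a) / 2.
Proof. by move=> a0; have [r0 /saddle_eqE h] := hr a0; exact: h. Qed.

Lemma saddle_le2 a : 0 < a -> r a <= 2.
Proof.
move=> a0; have [r0 _] := hr a0; have s0 := mulr_gt0 a0 r0.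
have := saddle_cube a0; have := saddle_rhs_le (ltW s0); have := tanh_sum_le_zeta3 (ltW s0).
have := zeta3_le2 R => h1 h2 h3 h4.
have : r a ^+ 3 <= 2 ^+ 3 by rewrite (_ : 2 ^+ 3 = 8 :> R); [lra|ring].
by rewrite ler_pXn2r // ?nnegrE // ltW.
Qed.

(** The saddle point equation divided by [a * r] shows that [r ^ 2 / a] tends
    to [zeta 2 / 4]. *)
Lemma growth_at_0 :
  (fun a : R => growth a (r a) / (pi / Num.sqrt 6 * Num.sqrt a)) @ 0^'+ --> (1 : R).
Proof.
pose c : R := pi ^+ 2 / 12.
have c0 : 0 < c by rewrite divr_gt0 ?exprn_gt0 ?pi_gt0.
have cs : a * r a @[a --> 0^'+] --> (0 : R).
  apply: (@squeeze_cvgr _ _ _ _ (fun=> 0) (fun a => a * 2)).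
  - near=> a; have a0 : 0 < a by near: a; exact: nbhs_right_gt.
    have [r0 _] := hr a0; rewrite mulr_ge0 ?(ltW a0) ?(ltW r0) //=.
    by rewrite ler_wpM2l ?(ltW a0) // saddle_le2.
  - exact: cvg_cst.
  - rewrite -[X in _ --> X](mul0r (2 : R)); apply: cvgMr_tmp.
    by apply: cvg_at_right_filter; exact: cvg_id.
have ck : kappa (a * r a) @[a --> 0^'+] --> c.
  rewrite /c -kappa0; apply: continuous_cvg cs; exact: kappa_continuous.
pose h a := tanh_sum (a * r a) / (a * r a).
have ch : h a @[a --> 0^'+] --> c.
  apply: squeeze_cvgr ck (cvg_cst _); near=> a.
  have a0 : 0 < a by near: a; exact: nbhs_right_gt.
  have [r0 _] := hr a0; have s0 := mulr_gt0 a0 r0.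
  rewrite ler_pdivlMr // ler_pdivrMr // ![_ * (a * r a)]mulrC -dtanh_sum_kappa dtanh_sum_le ?(ltW s0) //=.
  exact: tanh_sum_le_linear (ltW s0).
pose rho a := Num.sqrt (h a - kappa (a * r a) / 2).
have crho : rho a @[a --> 0^'+] --> Num.sqrt (c - c / 2).
  apply: continuous_cvg; first exact: sqrt_continuous.
  by apply: cvgB ch _; apply: cvgMr_tmp.
pose d := Num.sqrt (c - c / 2).
have d0 : 0 < d by rewrite sqrtr_gt0; lra.
have d2 : d ^+ 2 = c / 2 by rewrite sqr_sqrtr; lra.
(* In the limit r is d sqrt a, and the growth function is twice that. *)
have e6 : pi / Num.sqrt 6 = 2 * d.
  apply/eqP; rewrite -(@eqrXn2 _ 2) ?divr_ge0 ?pi_ge0 ?sqrtr_ge0 ?mulr_ge0 ?(ltW d0) //.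
  by rewrite expr_div_n exprMn d2 sqr_sqrtr // /c; apply/eqP; lra.
rewrite -/d in crho.
have lim : (rho a + h a / (2 * rho a)) / (2 * d) @[a --> 0^'+] --> (d + c / (2 * d)) / (2 * d).
  apply: cvgMr_tmp; apply: (cvgD crho); apply: cvgM ch _.
  apply: cvgV; first by rewrite mulf_neq0 ?gt_eqF.
  by apply: cvgMl_tmp; exact: crho.
have e1 : (d + c / (2 * d)) / (2 * d) = 1.
  rewrite (_ : c = 2 * d ^+ 2); last by rewrite d2; lra.
  by field; rewrite gt_eqF.
rewrite e1 in lim; apply: cvg_trans lim; apply: near_eq_cvg; near=> a.
have a0 : 0 < a by near: a; exact: nbhs_right_gt.
have [r0 _] := hr a0; have s0 := mulr_gt0 a0 r0.
rewrite /= e6 growthE //.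
have q0 : 0 < Num.sqrt a by rewrite sqrtr_gt0.
have q2 : Num.sqrt a ^+ 2 = a by rewrite sqr_sqrtr // ltW.
have -> : rho a = r a / Num.sqrt a.
  rewrite /rho (_ : h a - kappa (a * r a) / 2 = (r a / Num.sqrt a) ^+ 2).
    by rewrite sqrtr_sqr ger0_norm // divr_ge0 ?sqrtr_ge0 // ltW.
  rewrite expr_div_n q2.
  have -> : r a ^+ 2 / a = r a ^+ 3 / (a * r a) by field; rewrite !gt_eqF.
  rewrite saddle_cube // dtanh_sum_kappa /h; field; by rewrite !gt_eqF.
rewrite /h; move: (tanh_sum _) => y; move: (r a) (Num.sqrt a) r0 q0 q2 => ra q r0 q0 <-.
by field; rewrite !gt_eqF.
Unshelve. all: by end_near.
Qed.

(** Were [a * r] at most [1], then [r ^ 2 >= a / 6] and [r <= 2] would force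
    [a <= 24]; and for [a * r >= 1] the cube of [r] is at least [1 / 6]. *)
Lemma saddle_large a : 24 < a -> a / 2 <= a * r a.
Proof.
move=> a24; have a0 : 0 < a by lra.
have [r0 _] := hr a0; have s0 := mulr_gt0 a0 r0.
have := saddle_rhs_ge_min (ltW s0); rewrite -saddle_cube //; have r2 := saddle_le2 a0.
have [s1|s1] := leP (a * r a) 1 => h.
  have : r a * a <= r a * (6 * r a ^+ 2) by nra.
  rewrite ler_pM2l // => h'; nra.
have r12 : 1 / 2 <= r a.
  rewrite leNgt; apply/negP => h'.
  have : r a ^+ 3 < 1 / 6.
    have : r a * r a < 1 / 4 by nra.
    move=> ?; rewrite (_ : r a ^+ 3 = r a * r a * r a); [nra|ring].
  lra.
nra.
Qed.

(** As [a * r] grows linearly with [a], the saddle point equation gives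
    [r ^ 3 = zeta 3 + O (1 / a)]. *)
Lemma growth_at_infty :
  (fun a : R => growth a (r a) / (3 / 2 * zeta 3 `^ (1 / 3))) @ +oo --> (1 : R).
Proof.
pose z : R := zeta 3 `^ (1 / 3).
have z1 := zeta3_ge1 R.
have zz : 1 <= z.
  have : zeta 3 `^ 0 <= z by apply: ler_powR => //; rewrite divr_ge0.
  by rewrite powRr0.
have z0 : 0 < z by lra.
have z3 : z ^+ 3 = zeta 3.
  rewrite /z -powR_mulrn ?powR_ge0 // -powRrM (_ : 1 / 3 * 3 = 1); last by field.
  by rewrite powRr1 //; lra.
have ci : a^-1 @[a --> +oo] --> (0 : R).
  by apply/gtr0_cvgV0; [exact: nbhs_pinfty_gt|exact: cvg_id].
have lo k b : b - k * a^-1 @[a --> +oo] --> (b : R).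
  rewrite -[X in _ --> X]subr0; apply: cvgB; first exact: cvg_cst.
  by rewrite -(mulr0 k); apply: cvgMl_tmp; exact: ci.
have key a : 24 < a -> [/\ 0 < r a, z - 16 * a^-1 <= r a <= z &
    zeta 3 - 8 * a^-1 <= tanh_sum (a * r a) <= zeta 3].
  move=> a24; have a0 : 0 < a by lra.
  have [r0 _] := hr a0; have s0 := mulr_gt0 a0 r0.
  have sl := saddle_large a24.
  have si : (a * r a)^-1 <= 2 * a^-1.
    have -> : 2 * a^-1 = (a / 2)^-1 by field; rewrite gt_eqF.
    by rewrite lef_pV2 ?posrE // divr_gt0.
  have h1 := tanh_sum_ge_infty s0; have h2 := tanh_sum_le_zeta3 (ltW s0).
  have h3 := dtanh_sum_le_infty s0; have h4 := dtanh_sum_ge0 (ltW s0); have h5 := saddle_cube a0.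
  have i0 : 0 < (a * r a)^-1 by rewrite invr_gt0.
  have ai : 0 < a^-1 by rewrite invr_gt0.
  have c1 : r a ^+ 3 <= z ^+ 3 by rewrite z3; lra.
  have c2 : z ^+ 3 - r a ^+ 3 <= 16 * a^-1 by rewrite z3; lra.
  have rz : r a <= z by move: c1; rewrite ler_pXn2r // ?nnegrE // ltW.
  split => //; last by apply/andP; split; lra.
  rewrite rz andbT lerBlDl -lerBlDr.
  apply: le_trans c2; rewrite (_ : z ^+ 3 - r a ^+ 3 =
    (z - r a) * (z ^+ 2 + z * r a + r a ^+ 2)); last by ring.
  rewrite ler_peMr ?subr_ge0 //; nra.
have cr : r a @[a --> +oo] --> z.
  apply: squeeze_cvgr (lo 16 z) (cvg_cst _); near=> a.
  by have [] : [/\ 0 < r a, z - 16 * a^-1 <= r a <= z &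
    zeta 3 - 8 * a^-1 <= tanh_sum (a * r a) <= zeta 3] by apply: key; near: a; exact: nbhs_pinfty_gt.
have cH : tanh_sum (a * r a) @[a --> +oo] --> z ^+ 3.
  rewrite z3; apply: squeeze_cvgr (lo 8 _) (cvg_cst _); near=> a.
  by have [] : [/\ 0 < r a, z - 16 * a^-1 <= r a <= z &
    zeta 3 - 8 * a^-1 <= tanh_sum (a * r a) <= zeta 3] by apply: key; near: a; exact: nbhs_pinfty_gt.
rewrite -/z.
have lim : (r a + tanh_sum (a * r a) / (2 * (r a * r a))) / (3 / 2 * z) @[a --> +oo] -->
    (z + z ^+ 3 / (2 * (z * z))) / (3 / 2 * z).
  apply: cvgMr_tmp; apply: (cvgD cr); apply: cvgM cH _.
  apply: cvgV; first by rewrite !mulf_neq0 ?gt_eqF.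
  by apply: cvgMl_tmp; apply: cvgM; exact: cr.
have e1 : (z + z ^+ 3 / (2 * (z * z))) / (3 / 2 * z) = 1.
  by field; rewrite gt_eqF.
rewrite e1 in lim; apply: cvg_trans lim; apply: near_eq_cvg; near=> a.
have a0 : 0 < a by near: a; exact: nbhs_pinfty_gt.
by have [r0 _] := hr a0; rewrite growthE // expr2.
Unshelve. all: by end_near.
Qed.

End growth_limits.

(** * Logarithms of products as weighted sums *)

Section logseries.
Variable R : realType.
Implicit Types (x y t q c : R) (xs : seq R).

Definition plog N x : R := \sum_(0 <= l < N) l.+1%:R^-1 * x ^+ l.+1.

Lemma is_derive_plog N x : is_derive x 1 (plog N) (\sum_(0 <= l < N) x ^+ l).
Proof.
elim: N => [|N IH].
  rewrite big_geq //.
  have -> : plog 0 = cst 0 by apply/funext => z; rewrite /plog big_geq.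
  exact: is_derive_cst.
have -> : plog N.+1 = plog N + N.+1%:R^-1 *: (@GRing.exp R ^~ N.+1).
  by apply/funext => z; rewrite /plog big_nat_recr.
have -> : \sum_(0 <= l < N.+1) x ^+ l = \sum_(0 <= l < N) x ^+ l + x ^+ N.
  by rewrite big_nat_recr.
have h : (N.+1%:R : R) != 0 by rewrite pnatr_eq0.
have hX : is_derive x 1 (@GRing.exp R ^~ N.+1) (N.+1%:R * x ^+ N).
  apply: DeriveDef; first exact: exprn_derivable.
  by rewrite exp_derive /GRing.scale /= mulr1.
have e : x ^+ N = N.+1%:R^-1 *: (N.+1%:R * x ^+ N).
  by rewrite /GRing.scale /= mulrA mulVf // mul1r.
by rewrite e; exact: is_deriveD IH (is_deriveZ N.+1%:R^-1 hX).
Qed.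

Lemma geometric_sum N x : (1 - x) * \sum_(0 <= l < N) x ^+ l = 1 - x ^+ N.
Proof.
elim: N => [|N IH]; first by rewrite big_geq // mulr0 expr0 subrr.
by rewrite big_nat_recr //= mulrDr IH exprS; ring.
Qed.

(** The derivative of the difference is [c ^ N / (1 - c)]. *)
Lemma ln_plog N x : 0 <= x < 1 -> `|- ln (1 - x) - plog N x| <= x ^+ N / (1 - x).
Proof.
move=> /andP[x0 x1].
pose f y := - ln (1 - y) - plog N y.
pose df y : R := (1 - y)^-1 - \sum_(0 <= l < N) y ^+ l.
have d y : y < 1 -> is_derive y 1 f (df y).
  move=> y1; have y0 : 0 < 1 - y by lra.
  have h1 := is_derive_plog N y.
  have h2 : is_derive (1 - y) 1 (@ln R) (1 - y)^-1 by exact: is_derive1_ln.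
  have h3 : is_derive y 1 (fun y : R => 1 - y) (- 1).
    by apply: is_derive_eq; rewrite add0r mul1r.
  have h4 : is_derive y 1 (fun y => ln (1 - y)) ((1 - y)^-1 * -1).
    exact: (@is_derive1_comp _ (@ln R) (fun y => 1 - y)).
  by apply: is_derive_eq; rewrite /df mulrN1 opprK.
have cf : {within `[0, x], continuous f}.
  apply: derivable_within_continuous => y; rewrite in_itv /= => /andP[_ yx].
  by have [] := d y (le_lt_trans yx x1).
have d' y : y \in `]0, x[ -> is_derive y 1 f (df y).
  by rewrite in_itv /= => /andP[_ yx]; apply: d; exact: lt_trans yx x1.
have [c] := MVT_segment x0 d' cf; rewrite in_itv /= => /andP[c0 cx].
have f0 : f 0 = 0.
  rewrite /f subr0 ln1 oppr0 sub0r /plog big1 ?oppr0 // => l _.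
  by rewrite expr0n /= mulr0.
rewrite f0 !subr0 -/(f x) => ->.
have c1 : 0 < 1 - c by lra.
have -> : df c = c ^+ N / (1 - c).
  apply: (mulfI (_ : 1 - c != 0)); first by rewrite gt_eqF.
  by rewrite /df mulrBr geometric_sum divff ?gt_eqF // mulrCA divff ?gt_eqF // mulr1; ring.
have cN : 0 <= c ^+ N by rewrite exprn_ge0.
rewrite ger0_norm ?mulr_ge0 ?invr_ge0 ?(ltW c1) //.
apply: (@le_trans _ _ (c ^+ N / (1 - c))).
  by rewrite ler_piMr ?mulr_ge0 ?invr_ge0 ?(ltW c1) // ltW.
apply: ler_pM => //; first by rewrite invr_ge0 ltW.
  by apply: lerXn2r; rewrite ?nnegrE.
by rewrite lef_pV2 ?posrE //; lra.
Qed.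

Lemma mul_exp_bounded x l : 0 <= x < 1 -> l%:R * x ^+ l <= (1 - x)^-1.
Proof.
move=> /andP[x0 x1]; have x1' : 0 < 1 - x by lra.
rewrite -[leRHS]mul1r ler_pdivlMr // mulrC.
apply: (@le_trans _ _ ((1 - x) * \sum_(0 <= i < l) x ^+ i)).
  rewrite ler_wpM2l ?(ltW x1') // mulr_natl -[X in _ *+ X](subn0 l) -sumr_const_nat.
  rewrite big_nat_cond [leRHS]big_nat_cond; apply: ler_sum => i /andP[/andP[_ il] _].
  by apply: ler_wiXn2l => //; [exact: ltW|exact: ltnW].
by rewrite geometric_sum gerBl exprn_ge0.
Qed.

Lemma log_bounded x : 0 <= x < 1 -> bounded_by (1 - x)^-1 (fun l => l%:R * x ^+ l).
Proof.
move=> x01 l _; rewrite ger0_norm ?mul_exp_bounded //.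
by case/andP: x01 => x0 _; rewrite mulr_ge0 // exprn_ge0.
Qed.

Lemma wsum_log x : 0 <= x < 1 -> (1 - x)^-1 = expR (wsum (fun l => l%:R * x ^+ l)).
Proof.
move=> /[dup] x01 /andP[x0 x1].
have x1' : 0 < 1 - x by lra.
have c' : plog N x @[N --> \oo] --> wsum (fun l => l%:R * x ^+ l).
  have -> : (fun N => plog N x) = (fun N => series (fun l => l%:R * x ^+ l * isq R l) N.+1).
    apply/funext => N; rewrite /series /= big_nat_recl // isq0 mulr0 add0r.
    apply: eq_bigr => l _; rewrite /isq.
    have h : (l.+1%:R : R) != 0 by rewrite pnatr_eq0.
    by move: (l.+1%:R : R) (x ^+ l.+1) h => a b h; field.
  rewrite (cvg_shiftS (series (fun l => l%:R * x ^+ l * isq R l))).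
  exact: wsum_cvg (log_bounded x01).
have c2 : plog N x @[N --> \oo] --> - ln (1 - x).
  apply/cvgrPdist_le => e e0.
  have cN : x ^+ N @[N --> \oo] --> 0 by apply: cvg_expr; rewrite ger0_norm.
  move/cvgrPdist_le : cN => /(_ _ (mulr_gt0 e0 x1')) cN; near=> N.
  apply: le_trans (ln_plog N x01) _; rewrite ler_pdivrMr //.
  have xN : `|x ^+ N - 0| <= e * (1 - x).
    by rewrite distrC; near: N.
  by move: xN; rewrite subr0 ger0_norm // exprn_ge0.
have -> : wsum (fun l => l%:R * x ^+ l) = - ln (1 - x) by exact: cvg_unique c' c2.
by rewrite expRN lnK // posrE.
Unshelve. all: by end_near.
Qed.

(** Products are handled through the family [g] of which they are the
    exponential; the bound on [g] is kept existential, as only the value of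
    the sum matters. *)
Definition logrep (c : R) (g : nat -> R) := (exists M, bounded_by M g) /\ c = expR (wsum g).

Lemma logrep_ext c g h : (forall l, (0 < l)%N -> g l = h l) -> logrep c g -> logrep c h.
Proof.
move=> gh [[M gM] ->]; split; last by rewrite (eq_wsum gh).
by exists M => l l0; rewrite -gh // gM.
Qed.

Lemma logrep1 : logrep 1 (fun=> 0).
Proof.
split; first by exists 0 => l _; rewrite normr0.
rewrite (_ : wsum (fun=> 0) = 0) ?expR0 // /wsum.
rewrite (_ : series _ = fun=> 0); first exact: lim_cst.
by apply/funext => n; rewrite /series /= big1 // => l _; rewrite mul0r.
Qed.

Lemma logrepM c g c' g' : logrep c g -> logrep c' g' -> logrep (c * c') (fun l => g l + g' l).
Proof.
move=> [[M gM] ->] [[M' gM'] ->]; split; last by rewrite (wsumD gM gM') expRD.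
by exists (M + M'); exact: bounded_byD.
Qed.

Lemma logrep_log x : 0 <= x < 1 -> logrep (1 - x)^-1 (fun l => l%:R * x ^+ l).
Proof.
by move=> x01; split; [exists (1 - x)^-1; exact: log_bounded|exact: wsum_log].
Qed.

Lemma logrep_prod (I : eqType) (s : seq I) (c : I -> R) (g : I -> nat -> R) :
  (forall i, i \in s -> logrep (c i) (g i)) ->
  logrep (\prod_(i <- s) c i) (fun l => \sum_(i <- s) g i l).
Proof.
elim: s => [|i s IH] h.
  by rewrite big_nil; apply: logrep_ext logrep1 => l _; rewrite big_nil.
rewrite big_cons; apply: logrep_ext (logrepM (h i (mem_head _ _)) (IH _)) => [l _|j js].
  by rewrite big_cons.
by apply: h; rewrite inE js orbT.
Qed.

(** The power sum of exponent [l] over the products of two distinct variables. *)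
Fixpoint pair_sum (l : nat) xs : R :=
  if xs is x :: xs' then \sum_(y <- xs') (y * x) ^+ l + pair_sum l xs' else 0.

Lemma pair_sumE l xs :
  pair_sum l xs = ((\sum_(x <- xs) x ^+ l) ^+ 2 - \sum_(x <- xs) (x ^+ l) ^+ 2) / 2.
Proof.
elim: xs => [|x xs IH] /=; first by rewrite !big_nil expr0n subrr mul0r.
rewrite IH !big_cons; under eq_bigr do rewrite exprMn.
by rewrite -mulr_suml; field.
Qed.

Lemma logrep_cauchy xs : all (@in01 R) xs ->
  logrep (cauchy_factor xs) (fun l => l%:R * (\sum_(x <- xs) x ^+ l + pair_sum l xs)).
Proof.
elim: xs => [|x xs IH] /=.
  by move=> _; apply: logrep_ext logrep1 => l _; rewrite big_nil addr0 mulr0.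
move=> /andP[x01 axs].
have h2 : logrep (\prod_(y <- xs) (1 - y * x)^-1) (fun l => \sum_(y <- xs) l%:R * (y * x) ^+ l).
  apply: logrep_prod => y yxs; apply: logrep_log.
  have y01 := allP axs _ yxs; rewrite in01M // andbT.
  by case/andP: y01 => y0 _; case/andP: x01 => x0 _; rewrite mulr_ge0.
apply: logrep_ext (logrepM (logrepM (logrep_log x01) h2) (IH axs)) => l _.
by rewrite big_cons -mulr_sumr -!mulrDr; congr (_ * _); ring.
Qed.

End logseries.

(** * The product formula, one power at a time *)

Section bounds.
Variable R : realType.
Implicit Types (x y t q c : R) (xs : seq R) (l d k K : nat).

Lemma ler_of_eq (a b : R) : a = b -> a <= b.
Proof. by move->. Qed.

(** The leading term of the logarithm of the generating function at
    [exp (- t)]. *)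
Definition free_energy (m : nat) t : R := tanh_sum (m%:R * t) / (2 * t ^+ 2).

Definition gsum d y : R := \sum_(i <- iota 1 d) y ^+ i.

Lemma gsumE d y : (1 - y) * gsum d y = y * (1 - y ^+ d).
Proof.
rewrite -geometric_sum mulrCA; congr (_ * _).
rewrite /gsum (_ : iota 1 d = index_iota 1 d.+1) ?big_add1 /=; last by rewrite /index_iota subn1.
by rewrite mulr_sumr; apply: eq_bigr => i _; rewrite exprS.
Qed.

Lemma gsum_ge0 d y : 0 <= y -> 0 <= gsum d y.
Proof. by move=> y0; apply: sumr_ge0 => i _; rewrite exprn_ge0. Qed.

Definition power_vars q d := [seq q ^+ i | i <- iota 1 d].

Lemma power_vars_in01 q d : 0 <= q < 1 -> all (@in01 R) (power_vars q d).
Proof. by move=> q01; apply: all_in01_pow => //; apply/allP => i; rewrite mem_iota => /andP[]. Qed.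

Lemma scale_power_vars_in01 q d k : 0 <= q < 1 ->
  all (@in01 R) [seq (q ^+ d.+1) ^+ k * x | x <- power_vars q d].
Proof.
move=> q01; apply/allP => _ /mapP[x xb ->].
have /andP[x0 x1] := allP (power_vars_in01 d q01) _ xb; case/andP: q01 => q0 q1.
rewrite /in01 /= mulr_ge0 ?exprn_ge0 //=.
apply: le_lt_trans x1; rewrite ler_piMl // !exprn_ile1 ?exprn_ge0 //; exact: ltW.
Qed.

(** The value of [pair_sum l] at [q, ..., q ^ d] for [y = q ^ l], by
    [pair_sumE]. *)
Definition pairs d y : R := (gsum d y ^+ 2 - gsum d (y ^+ 2)) / 2.

(** The logarithm of the factor of index [k] in the product formula; its
    dependence on [k] is geometric. *)
Lemma logrep_scaled q d k : 0 <= q < 1 ->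
  logrep (cauchy_factor [seq (q ^+ d.+1) ^+ k * x | x <- power_vars q d])
   (fun l => l%:R * ((((q ^+ l) ^+ d.+1) ^+ k) * gsum d (q ^+ l) +
                     (((q ^+ l) ^+ d.+1) ^+ 2) ^+ k * pairs d (q ^+ l))).
Proof.
move=> q01; apply: logrep_ext (logrep_cauchy (scale_power_vars_in01 d k q01)) => l _.
rewrite pair_sumE; congr (_ * _).
set U := (q ^+ l) ^+ d.+1.
have e1 : \sum_(x <- [seq (q ^+ d.+1) ^+ k * x | x <- power_vars q d]) x ^+ l = U ^+ k * gsum d (q ^+ l).
  rewrite !big_map mulr_sumr; apply: eq_bigr => i _.
  by rewrite exprMn /U -!exprM; congr (_ * _); congr (_ ^+ _); lia.
have e2 : \sum_(x <- [seq (q ^+ d.+1) ^+ k * x | x <- power_vars q d]) (x ^+ l) ^+ 2 =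
    (U ^+ 2) ^+ k * gsum d ((q ^+ l) ^+ 2).
  rewrite !big_map mulr_sumr; apply: eq_bigr => i _.
  by rewrite !exprMn /U -!exprM; congr (_ * _); rewrite -exprD; congr (_ ^+ _); lia.
by rewrite e1 e2 /pairs exprMn [(U ^+ k) ^+ 2]exprAC; ring.
Qed.

Lemma exp_ratio_le x : 0 < x -> expR (- x) <= x^-1 * (1 - expR (- x)).
Proof.
move=> x0; rewrite expRN; have := expR_ge1Dx x; have := expR_gt0 x.
set E := expR x => E0 E1.
rewrite mulrC ler_pdivlMr // -(ler_pM2r E0).
rewrite mulrAC mulVf ?gt_eqF // mul1r mulrBl mul1r mulVf ?gt_eqF //; lra.
Qed.

Section one_level.
Variables (t x y U : R) (l d : nat).
Hypotheses (t0 : 0 < t) (l0 : (0 < l)%N).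
Hypotheses (xE : x = l%:R * t) (yE : y = expR (- x)) (UyE : U = y ^+ d.+1).

Lemma level_x_gt0 : 0 < x. Proof. by rewrite xE mulr_gt0 // ltr0n. Qed.

Lemma level_UE : U = expR (- (l%:R * (d.+1%:R * t))).
Proof. by rewrite UyE yE -expRM_natl xE; congr expR; ring. Qed.

Lemma level_y_itv : 0 < y < 1.
Proof.
rewrite yE expR_gt0 /=; apply: lt_le_trans (_ : expR 0 <= 1); last by rewrite expR0.
by rewrite ltr_expR oppr_lt0 level_x_gt0.
Qed.

Lemma level_U_itv : 0 < U < 1.
Proof. by case/andP: level_y_itv => y0 y1; rewrite UyE exprn_gt0 // exprn_ilt1 // ltW. Qed.

Lemma gsum_le : gsum d y <= x^-1 * (1 - U).
Proof.
have /andP[y0 y1] := level_y_itv.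
have h := exp_ratio_le level_x_gt0; rewrite -yE in h.
have y1' : 0 < 1 - y by lra.
rewrite -(ler_pM2l y1') gsumE.
have hU : 1 - y ^+ d <= 1 - U by rewrite lerD2l lerN2 UyE exprS ler_piMl ?exprn_ge0 ?(ltW y0) ?(ltW y1).
have hd : 0 <= 1 - y ^+ d by rewrite subr_ge0 exprn_ile1 // ltW.
apply: (@le_trans _ _ (x^-1 * (1 - y) * (1 - U))); first by apply: ler_pM => //; exact: ltW.
by rewrite [leRHS]mulrCA mulrA.
Qed.

Lemma pairs_ge0 : 0 <= pairs d y.
Proof.
have /andP[y0 y1] := level_y_itv; rewrite divr_ge0 // subr_ge0.
rewrite /gsum; elim: (iota 1 d) => [|i s IH]; first by rewrite !big_nil expr0n.
rewrite !big_cons sqrrD -exprM mulnC exprM -addrA lerD2l (le_trans IH) // lerDr.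
by rewrite mulrn_wge0 // mulr_ge0 ?exprn_ge0 ?(ltW y0) // sumr_ge0 // => j _; rewrite exprn_ge0 // ltW.
Qed.

Lemma pairs_le : pairs d y / (1 - U ^+ 2) <= tanh_half (l%:R * (d.+1%:R * t)) / (2 * x ^+ 2).
Proof.
have /andP[y0 y1] := level_y_itv; have /andP[U0 U1] := level_U_itv; have x0 := level_x_gt0.
have h := gsum_le; have g0 := gsum_ge0 d (ltW y0).
have U2 : 0 < 1 - U ^+ 2 by rewrite subr_gt0 exprn_ilt1 // ltW.
rewrite tanh_halfE -level_UE ler_pdivrMr //.
have -> : (1 - U) / (1 + U) / (2 * x ^+ 2) * (1 - U ^+ 2) = (x^-1 * (1 - U)) ^+ 2 / 2.
  by field; rewrite !gt_eqF //; lra.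
rewrite /pairs ler_pM2r //.
apply: (@le_trans _ _ (gsum d y ^+ 2)); first by rewrite gerBl gsum_ge0 // exprn_ge0 // ltW.
by apply: lerXn2r; rewrite ?nnegrE // mulr_ge0 ?invr_ge0 ?(ltW x0) // subr_ge0 ltW.
Qed.

Lemma geo_le (z : R) K : 0 <= z < 1 -> \sum_(0 <= k < K) z ^+ k <= (1 - z)^-1.
Proof.
move=> /andP[z0 z1]; have z1' : 0 < 1 - z by lra.
by rewrite -[leRHS]mul1r ler_pdivlMr // mulrC geometric_sum gerBl exprn_ge0.
Qed.

(** The factors [1 - y ^ d] in [gsum] cancel against the sums of the geometric
    series in [k]. *)
Lemma level_le K :
  \sum_(0 <= k < K) l%:R * (U ^+ k * gsum d y + (U ^+ 2) ^+ k * pairs d y) <=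
  t^-1 + tanh_half (l%:R * (d.+1%:R * t)) / l%:R / (2 * t ^+ 2).
Proof.
have /andP[y0 y1] := level_y_itv; have /andP[U0 U1] := level_U_itv; have x0 := level_x_gt0.
have lp : 0 < l%:R :> R by rewrite ltr0n.
have U2 : 0 < 1 - U ^+ 2 by rewrite subr_gt0 exprn_ilt1 // ltW.
rewrite -mulr_sumr big_split /= -!mulr_suml.
have h1 : (\sum_(0 <= k < K) U ^+ k) * gsum d y <= x^-1.
  apply: (@le_trans _ _ ((1 - U)^-1 * (x^-1 * (1 - U)))).
    apply: ler_pM; [|exact: gsum_ge0 (ltW y0)| |exact: gsum_le].
      by apply: sumr_ge0 => k _; rewrite exprn_ge0 // ltW.
    by apply: geo_le; rewrite (ltW U0).
  by rewrite mulrCA mulVf ?mulr1 // gt_eqF // subr_gt0.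
have h2 : (\sum_(0 <= k < K) (U ^+ 2) ^+ k) * pairs d y <=
    tanh_half (l%:R * (d.+1%:R * t)) / (2 * x ^+ 2).
  apply: le_trans pairs_le; rewrite [leRHS]mulrC ler_wpM2r ?pairs_ge0 //.
  by apply: geo_le; rewrite exprn_ge0 ?(ltW U0) //= exprn_ilt1 // ltW.
have -> : t^-1 + tanh_half (l%:R * (d.+1%:R * t)) / l%:R / (2 * t ^+ 2) =
   l%:R * (x^-1 + tanh_half (l%:R * (d.+1%:R * t)) / (2 * x ^+ 2)).
  rewrite xE; move: (tanh_half _) => T; move: (l%:R : R) lp => L lp.
  by field; rewrite !gt_eqF.
by rewrite ler_pM2l // lerD.
Qed.

(** All inequalities leading to [pairs_le] are sharp up to the factors
    [d / (d + 1)] and [exp (- x)], except for the subtracted diagonal terms,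
    which contribute at most [1 / (4 x)]. *)
Lemma pairs_ge :
  (d%:R / d.+1%:R) ^+ 2 * y ^+ 2 * tanh_half (l%:R * (d.+1%:R * t)) / (2 * x ^+ 2) - (4 * x)^-1
  <= pairs d y / (1 - U ^+ 2).
Proof.
have /andP[y0 y1] := level_y_itv; have /andP[U0 U1] := level_U_itv; have x0 := level_x_gt0.
have y1' : 0 < 1 - y by lra.
have U2 : 0 < 1 - U ^+ 2 by rewrite subr_gt0 exprn_ilt1 // ltW.
have Ub : 0 <= 1 - U by lra.
have xi : 0 < x^-1 by rewrite invr_gt0.
have hy : 1 - y <= x by rewrite yE; have := expR_ge1Dx (- x); lra.
have hd : d%:R / d.+1%:R * (1 - U) <= 1 - y ^+ d.
  rewrite mulrAC ler_pdivrMr ?ltr0n // -natr1.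
  have : d%:R * (1 - y) * y ^+ d <= 1 - y ^+ d.
    rewrite -geometric_sum mulrAC mulrC ler_pM2l //.
    rewrite mulr_natl -[X in _ *+ X](subn0 d) -sumr_const_nat.
    rewrite big_nat_cond [leRHS]big_nat_cond; apply: ler_sum => i /andP[/andP[_ il] _].
    by apply: ler_wiXn2l; rewrite ?ltW // ltnW.
  by rewrite UyE exprS; set Y := y ^+ d; nra.
have hc : 0 <= d%:R / d.+1%:R :> R by rewrite divr_ge0.
have hG : d%:R / d.+1%:R * (y / x * (1 - U)) <= gsum d y.
  rewrite -(ler_pM2l y1') gsumE.
  apply: (@le_trans _ _ (x * (d%:R / d.+1%:R * (y / x * (1 - U))))).
    by apply: ler_wpM2r => //; rewrite mulr_ge0 // mulr_ge0 // divr_ge0 // ltW.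
  have -> : x * (d%:R / d.+1%:R * (y / x * (1 - U))) = y * (d%:R / d.+1%:R * (1 - U)).
    by move: (_ / _ : R) => c; field; rewrite gt_eqF.
  by rewrite ler_pM2l.
have hG2 : gsum d (y ^+ 2) / 2 / (1 - U ^+ 2) <= (4 * x)^-1.
  have y2' : 0 < 1 - y ^+ 2 by rewrite subr_gt0 exprn_ilt1 // ltW.
  have e2 : y ^+ 2 = expR (- (2 * x)).
    by rewrite yE -expRM_natl mulrN.
  have x2 : 0 < 2 * x by lra.
  have := exp_ratio_le x2; rewrite -e2 => h.
  have hg : gsum d (y ^+ 2) <= (2 * x)^-1 * (1 - U ^+ 2).
    rewrite -(ler_pM2l y2') gsumE.
    have hU : 1 - (y ^+ 2) ^+ d <= 1 - U ^+ 2.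
      have z0 : 0 <= y ^+ 2 by rewrite exprn_ge0 // ltW.
      rewrite lerD2l lerN2 UyE exprAC exprS ler_piMl //; first exact: exprn_ge0.
      by rewrite -subr_ge0 ltW.
    have hd0 : 0 <= 1 - (y ^+ 2) ^+ d by rewrite subr_ge0 !exprn_ile1 ?exprn_ge0 // ltW.
    apply: (@le_trans _ _ ((2 * x)^-1 * (1 - y ^+ 2) * (1 - U ^+ 2))).
      by apply: ler_pM => //; rewrite exprn_ge0 // ltW.
    by rewrite [leRHS]mulrCA mulrA.
  rewrite ler_pdivrMr // ler_pdivrMr //; apply: le_trans hg _.
  by apply: ler_of_eq; field; rewrite gt_eqF.
rewrite /pairs mulrBl mulrBl; apply: lerB => //.
rewrite ler_pdivlMr // tanh_halfE -level_UE.
have -> : (d%:R / d.+1%:R) ^+ 2 * y ^+ 2 * ((1 - U) / (1 + U)) / (2 * x ^+ 2) * (1 - U ^+ 2)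
  = (d%:R / d.+1%:R * (y / x * (1 - U))) ^+ 2 / 2.
  move: (d%:R / d.+1%:R : R) => c; field; by rewrite !gt_eqF //; lra.
rewrite ler_pM2r //; apply: lerXn2r; rewrite ?nnegrE ?gsum_ge0 ?(ltW y0) //.
by rewrite mulr_ge0 // mulr_ge0 // divr_ge0 // ltW.
Qed.

End one_level.
End bounds.

(** * Bounds for the generating function *)

Section chain_bounds.
Variable R : realType.
Variables (d : nat) (t : R).
Hypotheses (d0 : (0 < d)%N) (t0 : 0 < t).
Local Notation m := d.+1.
Let q : R := expR (- t).
Let u := q ^+ m.

Lemma q_itv : 0 < q < 1.
Proof.
rewrite expR_gt0 /=; apply: lt_le_trans (_ : expR 0 <= 1); last by rewrite expR0.
by rewrite ltr_expR oppr_lt0.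
Qed.

Lemma q_in01 : 0 <= q < 1. Proof. by case/andP: q_itv => /ltW -> ->. Qed.

Lemma u_in01 : @in01 R u.
Proof. by case/andP: q_itv => q0 q1; rewrite /in01 /= exprn_ge0 ?exprn_ilt1 // ltW. Qed.

Lemma qlE l : q ^+ l = expR (- (l%:R * t)).
Proof. by rewrite /q -expRM_natl mulrN. Qed.

Definition level k l : R :=
  l%:R * (((q ^+ l) ^+ m) ^+ k * gsum d (q ^+ l) + (((q ^+ l) ^+ m) ^+ 2) ^+ k * pairs d (q ^+ l)).

Lemma logrep_partial K :
  logrep (\prod_(k < K) cauchy_factor [seq u ^+ k * x | x <- power_vars q d])
     (fun l => \sum_(0 <= k < K) level k l).
Proof.
rewrite -(big_mkord predT (fun k => cauchy_factor [seq u ^+ k * x | x <- power_vars q d])).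
by apply: logrep_prod => k _; exact: logrep_scaled q_in01.
Qed.

Lemma const_bounded (c : R) : bounded_by `|c| (fun=> c).
Proof. by move=> l _. Qed.

Lemma wsum_const_le (c : R) : 0 <= c -> wsum (fun=> c) <= 2 * c.
Proof.
move=> c0; apply: le_trans (ler_norm _) _; rewrite -{2}(ger0_norm c0).
exact: wsum_norm (const_bounded c).
Qed.

Lemma mt_ge0 : 0 <= m%:R * t. Proof. by rewrite mulr_ge0 // ltW. Qed.

Lemma free_bounded : bounded_by (`|(2 * t ^+ 2)^-1| * 1)
  (fun l => (2 * t ^+ 2)^-1 * (tanh_half (l%:R * (m%:R * t)) / l%:R)).
Proof. by apply: bounded_byZ; exact: tanh_sum_bounded mt_ge0. Qed.

Lemma partial_le K :
  \prod_(k < K) cauchy_factor [seq u ^+ k * x | x <- power_vars q d] <= expR (free_energy m t + 2 / t).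
Proof.
have [[M gM] ->] := logrep_partial K; rewrite ler_expR.
have hb := bounded_byD (const_bounded t^-1) free_bounded.
apply: le_trans (wsum_le gM hb _) _.
  move=> l l0; rewrite [X in _ <= _ + X]mulrC.
  exact: (@level_le _ t (l%:R * t) (q ^+ l) ((q ^+ l) ^+ m) l d t0 l0 erefl (qlE l) erefl K).
rewrite (wsumD (const_bounded t^-1) free_bounded) (wsumZ _ (tanh_sum_bounded mt_ge0)) addrC.
rewrite lerD //; first by rewrite /free_energy mulrC.
by apply: wsum_const_le; rewrite invr_ge0 ltW.
Qed.

Lemma par_gf_upper : (\esum_(mu in [set: par]) psizeX q mu <= (expR (2 / t))%:E)%E.
Proof.
apply: par_gf_le; first exact: q_in01.
move=> N; rewrite -(big_mkord predT (fun i => (1 - q ^+ i.+1)^-1)).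
have h : logrep (\prod_(0 <= i < N) (1 - q ^+ i.+1)^-1)
    (fun l => \sum_(0 <= i < N) l%:R * (q ^+ i.+1) ^+ l).
  apply: logrep_prod => i _; apply: logrep_log; case/andP: q_itv => qp q1.
  by rewrite exprn_ge0 ?exprn_ilt1 // ltW.
case: h => [[M gM] ->]; rewrite ler_expR.
apply: le_trans (wsum_le gM (const_bounded t^-1) _) _; last first.
  by apply: wsum_const_le; rewrite invr_ge0 ltW.
move=> l l0; have lp : 0 < l%:R :> R by rewrite ltr0n.
have lt0 : 0 < l%:R * t by rewrite mulr_gt0.
have h := exp_ratio_le lt0; rewrite -qlE in h.
have /andP[y0 y1] := @level_y_itv _ t (l%:R * t) (q ^+ l) l t0 l0 erefl (qlE l).
rewrite -mulr_sumr (eq_bigr (fun i => q ^+ l * (q ^+ l) ^+ i)); last first.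
  by move=> i _; rewrite -exprS exprAC.
rewrite -mulr_sumr.
apply: (@le_trans _ _ (l%:R * ((l%:R * t)^-1))); last first.
  by rewrite invfM mulrA divff ?gt_eqF // mul1r.
rewrite ler_pM2l //.
apply: (@le_trans _ _ ((l%:R * t)^-1 * (1 - q ^+ l) * (1 - q ^+ l)^-1)); last first.
  by rewrite mulfK // gt_eqF // subr_gt0.
apply: ler_pM => //; first exact: ltW.
  by apply: sumr_ge0 => i _; rewrite exprn_ge0 // ltW.
by apply: geo_le; rewrite y1 ltW.
Qed.

(** For [K] large the remainder of the product formula is close to that of no strip at all. *)
Lemma cvg_strip_factor (xs : seq R) :
  \prod_(x <- [seq u ^+ K * x | x <- xs]) (1 - x)^-1 @[K --> \oo] --> (1 : R).
Proof.
have uK : u ^+ K @[K --> \oo] --> (0 : R).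
  by apply: cvg_expr; case/andP: u_in01 => u0 u1; rewrite ger0_norm.
elim: xs => [|x xs IH]; first by under eq_fun do rewrite big_nil; exact: cvg_cst.
have h1 : (1 - u ^+ K * x)^-1 @[K --> \oo] --> (1 : R).
  have h2 : 1 - u ^+ K * x @[K --> \oo] --> (1 - 0 * x : R).
    apply: cvgB; first exact: cvg_cst.
    apply: cvgMr_tmp; exact: uK.
  rewrite mul0r subr0 in h2.
  have h3 := cvgV (oner_neq0 R) h2; rewrite invr1 in h3; exact: h3.
have h := cvgM h1 IH; rewrite mulr1 in h.
have E : (fun K => \prod_(y <- [seq u ^+ K * y | y <- x :: xs]) (1 - y)^-1) =
    (fun K => (1 - u ^+ K * x)^-1) \* (fun K => \prod_(y <- [seq u ^+ K * y | y <- xs]) (1 - y)^-1).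
  by apply/funext => K; rewrite /= big_cons.
by rewrite E; exact: h.
Qed.

(** The variables of the remainder tend to [0]; once they are small, the
    remainder is bounded by one more factor of the product and the partition
    generating function at [q], as [u < q]. *)
Lemma chain_upper : (chain_gf (power_vars q d) u <= (expR (free_energy m t + 4 / t))%:E)%E.
Proof.
have axs := power_vars_in01 d q_in01; have /andP[q0 q1] := q_itv.
have /andP[u0 u1] := u_in01.
have uq : u < q by rewrite /u -[ltRHS]expr1 ltr_iXn2l.
have up : 0 < u by rewrite exprn_gt0.
have [K hK] : exists K, u * \prod_(x <- [seq u ^+ K * x | x <- power_vars q d]) (1 - x)^-1 <= q.
  have e0 : 0 < q / u - 1 by rewrite subr_gt0 ltr_pdivlMr // mul1r.
  have := cvg_strip_factor (power_vars q d); move/cvgrPdist_le => /(_ _ e0) [K _ hK].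
  exists K; have := hK K (leqnn K); rewrite distrC => /(le_trans (ler_norm _)).
  by rewrite lerD2r ler_pdivlMr // mulrC.
rewrite (chain_gf_prod K u_in01 axs).
have axK := scale_power_vars_in01 d K q_in01.
have c0 k : 0 <= cauchy_factor [seq u ^+ k * x | x <- power_vars q d].
  by apply: cauchy_factor_ge0; exact: scale_power_vars_in01 q_in01.
have P0 : 0 <= \prod_(k < K) cauchy_factor [seq u ^+ k * x | x <- power_vars q d].
  by apply: prodr_ge0 => k _.
apply: le_trans (lee_wpmul2l _ (chain_gf_le u_in01 axK)) _; first by rewrite lee_fin.
rewrite muleA -EFinM.
have -> : \prod_(k < K) cauchy_factor [seq u ^+ k * x | x <- power_vars q d] *
   cauchy_factor [seq u ^+ K * x | x <- power_vars q d] =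
   \prod_(k < K.+1) cauchy_factor [seq u ^+ k * x | x <- power_vars q d] by rewrite big_ord_recr.
have -> : free_energy m t + 4 / t = (free_energy m t + 2 / t) + 2 / t by lra.
rewrite expRD EFinM; apply: lee_pmul.
- by rewrite lee_fin; apply: prodr_ge0 => k _.
- apply: esum_ge0 => mu _; apply: psizeX_ge0; rewrite mulr_ge0 // big_seq prodr_ge0 // => x /(allP axK).
  by case/andP=> _ x1; exact: in01_invB1.
- by rewrite lee_fin; exact: partial_le.
- apply: le_trans par_gf_upper; apply: le_esum => mu _; rewrite lee_fin.
  apply: lerXn2r; rewrite ?nnegrE ?(ltW q0) // mulr_ge0 // big_seq prodr_ge0 // => x /(allP axK).
  by case/andP=> _ x1; exact: in01_invB1.
Qed.

Lemma chain_fin : chain_gf (power_vars q d) u = (fine (chain_gf (power_vars q d) u))%:E.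
Proof.
rewrite fineK // ge0_fin_numE; first exact: le_lt_trans chain_upper (ltry _).
exact: le_trans lee01 (chain_gf_ge1 u_in01 (power_vars_in01 d q_in01)).
Qed.

(** The contribution of the pairs of variables, summed over all factors of
    the product formula. *)
Definition pair_level l : R := l%:R * (pairs d (q ^+ l) / (1 - ((q ^+ l) ^+ m) ^+ 2)).

Lemma pair_level_bounds l : (0 < l)%N ->
  0 <= pair_level l <= tanh_half (l%:R * (m%:R * t)) / l%:R / (2 * t ^+ 2).
Proof.
move=> l0; have lp : 0 < l%:R :> R by rewrite ltr0n.
have hp := @pairs_le _ t (l%:R * t) (q ^+ l) ((q ^+ l) ^+ m) l d t0 l0 erefl (qlE l) erefl.
have h0 := @pairs_ge0 _ t (l%:R * t) (q ^+ l) l d t0 l0 erefl (qlE l).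
have /andP[U0 U1] := @level_U_itv _ t (l%:R * t) (q ^+ l) _ l d t0 l0 erefl (qlE l) erefl.
apply/andP; split.
  by rewrite mulr_ge0 // divr_ge0 // subr_ge0 exprn_ile1 // ltW.
rewrite /pair_level; apply: le_trans (ler_wpM2l (ltW lp) hp) _.
apply: ler_of_eq; move: (tanh_half _) => T; move: (l%:R : R) lp => L lp.
by field; rewrite !gt_eqF.
Qed.

Lemma pair_level_bounded : bounded_by (2 * t ^+ 2)^-1 pair_level.
Proof.
move=> l l0; have /andP[h1 h2] := pair_level_bounds l0.
rewrite ger0_norm //; apply: le_trans h2 _.
by rewrite ler_piMl ?invr_ge0 ?mulr_ge0 ?exprn_ge0 ?(ltW t0) // tanh_half_div_le1.
Qed.

(** The remainder is at least [1] and the single variables can only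
    increase the product; then let the number of factors go to infinity. *)
Lemma chain_lower : ((expR (wsum pair_level))%:E <= chain_gf (power_vars q d) u)%E.
Proof.
have axs := power_vars_in01 d q_in01.
(* Only the first K factors, and only their pairs of variables. *)
pose part K l : R := l%:R * ((\sum_(0 <= k < K) (((q ^+ l) ^+ m) ^+ 2) ^+ k) * pairs d (q ^+ l)).
have Uk l K : (0 < l)%N -> \sum_(0 <= k < K) (((q ^+ l) ^+ m) ^+ 2) ^+ k <= (1 - ((q ^+ l) ^+ m) ^+ 2)^-1.
  move=> l0.
  have := @level_U_itv _ t (l%:R * t) (q ^+ l) _ l d t0 l0 erefl (qlE l) erefl.
  move: (_ ^+ m) => U /andP[U0 U1].
  by apply: geo_le; rewrite exprn_ge0 ?exprn_ilt1 // ltW.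
have y0 l : 0 <= q ^+ l by rewrite qlE expR_ge0.
have part_b K : bounded_by (2 * t ^+ 2)^-1 (part K).
  move=> l l0; have h0 := @pairs_ge0 _ t (l%:R * t) (q ^+ l) l d t0 l0 erefl (qlE l).
  have s0 : 0 <= \sum_(0 <= k < K) (((q ^+ l) ^+ m) ^+ 2) ^+ k.
    by apply: sumr_ge0 => k _; do 3 apply: exprn_ge0.
  have := pair_level_bounded l0; apply: le_trans; rewrite !ger0_norm; last 2 first.
  - by case/andP: (pair_level_bounds l0).
  - by rewrite mulr_ge0 // mulr_ge0.
  by rewrite ler_wpM2l // [leRHS]mulrC ler_wpM2r // Uk.
have hK K : expR (wsum (part K)) <= fine (chain_gf (power_vars q d) u).
  rewrite -lee_fin -chain_fin (chain_gf_prod K u_in01 axs).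
  have [[M gM] E] := logrep_partial K.
  apply: (@le_trans _ _ (\prod_(k < K) cauchy_factor [seq u ^+ k * x | x <- power_vars q d])%:E).
    rewrite lee_fin E ler_expR; apply: wsum_le (part_b K) gM _ => l l0.
    rewrite /level -mulr_sumr ler_wpM2l // big_split /= -!mulr_suml lerDr.
    apply: mulr_ge0; last exact: gsum_ge0.
    by apply: sumr_ge0 => k _; do 2 apply: exprn_ge0.
  rewrite -[X in (X <= _)%E]mule1; apply: lee_wpmul2l.
    rewrite lee_fin; apply: prodr_ge0 => k _; apply: cauchy_factor_ge0; exact: scale_power_vars_in01 q_in01.
  exact: chain_gf_ge1 u_in01 (scale_power_vars_in01 d K q_in01).
rewrite chain_fin lee_fin.
have cp : wsum (part K) @[K --> \oo] --> wsum pair_level.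
  apply: (@wsum_tannery _ _ _ _ (2 * t ^+ 2)^-1); first by apply: nearW.
  move=> l l0; rewrite /part /pair_level; apply: cvgMl_tmp; rewrite [X in _ --> X]mulrC; apply: cvgMr_tmp.
  have /andP[U0 U1] := @level_U_itv _ t (l%:R * t) (q ^+ l) _ l d t0 l0 erefl (qlE l) erefl.
  set V := _ ^+ 2; have V0 : 0 <= V by rewrite exprn_ge0 // ltW.
  have V1 : V < 1 by rewrite exprn_ilt1 // ltW.
  have E : (fun K => \sum_(0 <= k < K) V ^+ k) = series (geometric 1 V).
    by apply/funext => K; rewrite /series /=; apply: eq_bigr => i _; rewrite /geometric /= mul1r.
  rewrite E -[X in _ --> X]mul1r; apply: cvg_geometric_series.
  by rewrite ger0_norm.
have ce : expR (wsum (part K)) @[K --> \oo] --> expR (wsum pair_level).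
  by apply: (@continuous_cvg _ _ _ _ _ _ (@expR R) _ (@continuous_expR R _) cp).
apply: (closed_cvg (fun z => z <= fine (chain_gf (power_vars q d) u)) _ _ _ ce); first exact: closed_le.
exact: nearW.
Qed.

End chain_bounds.

(** * Comparison with the free energy *)

Section energy.
Variable R : realType.
Implicit Types (t s e eps delta : R) (d n k N : nat).

Local Notation F m t := (free_energy m t).
Local Notation G d k := ((nbpp k d.+1)%:R : R).

Lemma free_energy_gt0 d t : 0 < t -> 0 < F d.+1 t.
Proof. by move=> t0; rewrite divr_gt0 ?mulr_gt0 ?exprn_gt0 // tanh_sum_gt0 // mulr_gt0. Qed.

Lemma bpp_gf_le d t : (0 < d)%N -> 0 < t ->
  (\esum_(f in [set f | is_bpp f]) (expR (- t) ^+ @bpp_size d.+1 f)%:E <=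
   (expR (F d.+1 t + 4 / t))%:E)%E.
Proof. by move=> d0 t0; rewrite bpp_gf ?q_in01 //; exact: chain_upper. Qed.

Lemma exp_lt1 t : 0 < t -> expR (- t) < 1.
Proof. by move=> t0; have /andP[_] := q_itv t0. Qed.

Lemma gf_upper d t N : (0 < d)%N -> 0 < t ->
  \sum_(k < N) G d k * expR (- t) ^+ k <= expR (F d.+1 t + 4 / t).
Proof. by move=> d0 t0; apply: (bpps_upper (expR_gt0 _)); exact: bpp_gf_le. Qed.

Lemma bpps_finite_all d k : (0 < d)%N -> finite_set (bpps d.+1 k).
Proof. by move=> d0; exact: (bpps_finite (expR_gt0 (- 1)) (bpp_gf_le d0 ltr01)). Qed.

Lemma nbpp_homo d k n : (0 < d)%N -> (k <= n)%N -> (nbpp k d.+1 <= nbpp n d.+1)%N.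
Proof.
move=> d0 /subnK <-; elim: (n - k)%N => [|j IH] //.
by rewrite addSn (leq_trans IH) // nbpp_mono // => i; exact: bpps_finite_all.
Qed.

Lemma ln_nbpp_le d n t : (0 < d)%N -> 0 < t ->
  ln (G d n) <= n%:R * t + F d.+1 t + 4 / t.
Proof.
move=> d0 t0; have t4 : 0 < 4 / t by rewrite divr_gt0.
have [G0|G0] := leP (G d n) 0.
  have F0 := free_energy_gt0 d t0.
  have nt0 : 0 <= n%:R * t by rewrite mulr_ge0 // ltW.
  by rewrite ln0 //; lra.
have h := gf_upper n.+1 d0 t0; rewrite big_ord_recr /= in h.
have h2 : G d n * expR (- t) ^+ n <= expR (F d.+1 t + 4 / t).
  apply: le_trans h; rewrite lerDr; apply: sumr_ge0 => k _.
  by rewrite mulr_ge0 // exprn_ge0 // expR_ge0.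
rewrite -ler_expR lnK ?posrE // -addrA expRD.
rewrite mulrC -ler_pdivrMr ?expR_gt0 // -expRN -mulrN expRM_natl //.
Qed.

(** The relative loss from replacing [y ^ 2 = exp (- 2 l t)] by [1] in
    [pairs_ge]; see [wsum_pair_level_ge]. *)
Definition omega t : R := wsum (fun l => 1 - expR (- (2 * (l%:R * t)))).

Lemma omega_bounded t : 0 < t -> bounded_by 1 (fun l => 1 - expR (- (2 * (l%:R * t)))).
Proof.
move=> t0 l l0; have lp : 0 < l%:R :> R by rewrite ltr0n.
have h : 0 < 2 * (l%:R * t) by rewrite !mulr_gt0.
have := exp_lt1 h; have := expR_gt0 (- (2 * (l%:R * t))) => ? ?.
by rewrite ger0_norm; lra.
Qed.

Lemma omega_ge0 t : 0 < t -> 0 <= omega t.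
Proof.
move=> t0; apply: wsum_ge0 (omega_bounded t0) _ => l l0.
have lp : 0 < l%:R :> R by rewrite ltr0n.
have h : 0 < 2 * (l%:R * t) by rewrite !mulr_gt0.
by have := exp_lt1 h; lra.
Qed.

Lemma omega_cvg : omega t @[t --> 0^'+] --> (0 : R).
Proof.
have z : 0 = wsum (fun=> 0 : R) by have [_] := logrep1 R; rewrite -[LHS]expR0 => /expR_inj.
rewrite {2}z; apply: (@wsum_tannery _ _ _ _ 1).
  by near=> t; apply: omega_bounded; near: t; exact: nbhs_right_gt.
move=> l l0; apply: (@squeeze_cvgr _ _ _ _ (fun=> 0) (fun t => t * (2 * l%:R))).
- near=> t; have t0 : 0 < t by near: t; exact: nbhs_right_gt.
  have lp : 0 < l%:R :> R by rewrite ltr0n.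
  have h : 0 < 2 * (l%:R * t) by rewrite !mulr_gt0.
  have := exp_lt1 h; have := expR_ge1Dx (- (2 * (l%:R * t))) => h1 h2.
  by apply/andP; split; lra.
- exact: cvg_cst.
- rewrite -[X in _ --> X](mul0r (2 * l%:R : R)); apply: cvgMr_tmp.
  by apply: cvg_at_right_filter; exact: cvg_id.
Unshelve. all: by end_near.
Qed.

Lemma pair_level_ge d t l : (0 < l)%N -> 0 < t ->
  (d%:R / d.+1%:R) ^+ 2 / (2 * t ^+ 2) *
    (tanh_half (l%:R * (d.+1%:R * t)) / l%:R -
     tanh_half (d.+1%:R * t) * (1 - expR (- (2 * (l%:R * t))))) - (4 * t)^-1 <= pair_level d t l.
Proof.
move=> l0 t0; have lp : 0 < l%:R :> R by rewrite ltr0n.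
have l1 : 1 <= l%:R :> R by rewrite ler1n.
have h := @pairs_ge _ t (l%:R * t) (expR (- t) ^+ l) ((expR (- t) ^+ l) ^+ d.+1) l d t0 l0 erefl
  (qlE t l) erefl.
rewrite /pair_level; apply: le_trans (ler_wpM2l (ltW lp) h).
have e2 : (expR (- t) ^+ l) ^+ 2 = expR (- (2 * (l%:R * t))) by rewrite qlE -expRM_natl mulrN.
rewrite e2; have s0 : 0 <= d.+1%:R * t by rewrite mulr_ge0 // ltW.
have hT := tanh_half_le_nat s0 l0.
have T0 := tanh_half_ge0 s0.
have hw : 0 <= 1 - expR (- (2 * (l%:R * t))).
  have h' : 0 < 2 * (l%:R * t) by rewrite !mulr_gt0.
  by have := exp_lt1 h'; lra.
have c0 : 0 <= (d%:R / d.+1%:R) ^+ 2 / (2 * t ^+ 2).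
  by rewrite divr_ge0 ?exprn_ge0 ?divr_ge0 ?mulr_ge0 ?exprn_ge0 // ltW.
have -> : l%:R * ((d%:R / d.+1%:R) ^+ 2 * expR (- (2 * (l%:R * t))) *
   tanh_half (l%:R * (d.+1%:R * t)) / (2 * (l%:R * t) ^+ 2) - (4 * (l%:R * t))^-1) =
   (d%:R / d.+1%:R) ^+ 2 / (2 * t ^+ 2) *
   (tanh_half (l%:R * (d.+1%:R * t)) / l%:R * expR (- (2 * (l%:R * t)))) - (4 * t)^-1.
  move: (tanh_half _) (expR _) (d%:R / d.+1%:R : R) => T E c; move: (l%:R : R) lp => L lp.
  by field; rewrite !gt_eqF.
rewrite lerD2r ler_wpM2l //.
have : tanh_half (l%:R * (d.+1%:R * t)) / l%:R <= tanh_half (d.+1%:R * t).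
  by rewrite ler_pdivrMr // [leRHS]mulrC.
by move=> /(ler_wpM2r hw); lra.
Qed.

Lemma wsum_pair_level_ge d t : (0 < d)%N -> 0 < t ->
  (d%:R / d.+1%:R) ^+ 2 * (1 - omega t) * F d.+1 t - (2 * t)^-1 <= wsum (pair_level d t).
Proof.
move=> d0 t0; set c := (d%:R / d.+1%:R) ^+ 2.
have s0 : 0 <= d.+1%:R * t by rewrite mulr_ge0 // ltW.
have c0 : 0 <= c by rewrite exprn_ge0 // divr_ge0.
pose c' := c / (2 * t ^+ 2); have c'0 : 0 <= c' by rewrite divr_ge0 // mulr_ge0 // exprn_ge0 // ltW.
set T := tanh_half (d.+1%:R * t).
have bH := tanh_sum_bounded s0; have bo := bounded_byZ (- T) (omega_bounded t0).
have b1 := bounded_byZ c' (bounded_byD bH bo).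
have b2 := @const_bounded R (- (4 * t)^-1).
have h : wsum (fun l => c' * (tanh_half (l%:R * (d.+1%:R * t)) / l%:R +
     - T * (1 - expR (- (2 * (l%:R * t))))) + - (4 * t)^-1) <= wsum (pair_level d t).
  apply: wsum_le (bounded_byD b1 b2) (pair_level_bounded d t0) _ => l l0.
  by rewrite mulNr; exact: pair_level_ge.
apply: le_trans h.
rewrite (wsumD b1 b2) (wsumZ _ (bounded_byD bH bo)) (wsumD bH bo) (wsumZ _ (omega_bounded t0)).
rewrite -/(tanh_sum _) -/(omega t).
have h2 : - (2 * t)^-1 <= wsum (fun=> - (4 * t)^-1).
  have i0 : 0 <= (4 * t)^-1 by rewrite invr_ge0 mulr_ge0 // ltW.
  have := wsum_norm b2; rewrite normrN (ger0_norm i0) ler_norml => /andP[h _]; apply: le_trans h.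
  by apply: ler_of_eq; field; rewrite gt_eqF.
apply: lerD h2; rewrite /free_energy.
have -> : c * (1 - omega t) * (tanh_sum (d.+1%:R * t) / (2 * t ^+ 2)) =
   c' * (tanh_sum (d.+1%:R * t) - tanh_sum (d.+1%:R * t) * omega t) by rewrite /c'; ring.
rewrite ler_wpM2l // lerD2l mulNr lerN2 ler_wpM2r ?omega_ge0 //.
exact: tanh_sum_ge_tanh_half.
Qed.

(** The corrections of order [1 / t] are negligible exactly because both
    [m] and [1 / t] tend to infinity: [t] times the free energy is at least of
    the order of the smaller of the two. *)
Lemma inv_le_free_energy eps : 0 < eps -> exists M : nat, exists2 tau : R, 0 < tau &
  forall d t, (M <= d)%N -> 0 < t -> t <= tau -> t^-1 <= eps * F d.+1 t.
Proof.
move=> e0; exists (Num.truncn (6 / eps)).+1; exists (eps / 6); first by rewrite divr_gt0.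
move=> d t Md t0 tt.
have dM : 6 / eps <= d.+1%:R.
  by apply: le_trans (ltW (truncnS_gt _)) _; rewrite ler_nat (leq_trans Md).
have s0 : 0 <= d.+1%:R * t by rewrite mulr_ge0 // ltW.
have h1 := tanh_sum_ge_tanh_half s0; have h2 := tanh_half_ge_min s0.
rewrite /free_energy mulrA ler_pdivlMr ?mulr_gt0 ?exprn_gt0 //.
have -> : t^-1 * (2 * t ^+ 2) = 2 * t by field; rewrite gt_eqF.
move: dM; rewrite ler_pdivrMr // => dM.
move: h2; have [s1|s1] := leP (d.+1%:R * t) 1 => h2; nra.
Qed.

Lemma ratio_sq_ge eps : 0 < eps -> exists M : nat,
  forall d, (M <= d)%N -> 1 - eps <= (d%:R / d.+1%:R) ^+ 2 :> R.
Proof.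
move=> e0; exists (Num.truncn (2 / eps)).+1 => d Md.
have dM : 2 / eps <= d.+1%:R.
  by apply: le_trans (ltW (truncnS_gt _)) _; rewrite ler_nat (leq_trans Md).
have Dp : 0 < d.+1%:R :> R by rewrite ltr0n.
have e : d%:R / d.+1%:R = 1 - d.+1%:R^-1 :> R.
  rewrite -[X in X / _](addrK 1) natr1; move: (d.+1%:R : R) Dp => D Dp.
  by field; rewrite gt_eqF.
have i : d.+1%:R^-1 <= eps / 2.
  have -> : eps / 2 = (2 / eps)^-1 by field; rewrite gt_eqF.
  by rewrite lef_pV2 ?posrE ?divr_gt0.
rewrite e; move: i; move: (d.+1%:R^-1 : R) => x i.
by have := sqr_ge0 x; rewrite !expr2; lra.
Qed.

(** A partial sum is enough for what follows, and it avoids discussing the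
    convergence of the whole series. *)
Lemma gf_lower eps : 0 < eps -> exists M : nat, exists2 tau : R, 0 < tau &
  forall d t, (M <= d)%N -> (0 < d)%N -> 0 < t -> t <= tau ->
  exists N, expR ((1 - eps) * F d.+1 t) <= \sum_(k < N) G d k * expR (- t) ^+ k.
Proof.
move=> e0; have e4 : 0 < eps / 4 by rewrite divr_gt0.
have [M1 hM1] := ratio_sq_ge e4.
have [M2 [tau2 tau20 hM2]] := inv_le_free_energy e4.
have [tau1 /= tau10 hw] : exists2 tau : R, 0 < tau & forall t, 0 < t -> t <= tau -> omega t <= eps / 4.
  move/cvgrPdist_le : omega_cvg => /(_ _ e4) [r /= r0 hr].
  exists (r / 2); first by rewrite divr_gt0.
  move=> t t0 tr; have := hr t; rewrite /ball /= sub0r normrN ger0_norm ?(ltW t0) //.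
  move=> /(_ _ t0); rewrite sub0r normrN => h; apply: le_trans (ler_norm _) (h _); lra.
exists (maxn M1 M2); exists (Num.min tau1 tau2); first by rewrite lt_min tau10.
move=> d t; rewrite geq_max => /andP[dM1 dM2] d0 t0; rewrite le_min => /andP[tt1 tt2].
have F0 := free_energy_gt0 d t0.
have c1 := hM1 d dM1.
have c2 : (d%:R / d.+1%:R) ^+ 2 <= 1 :> R.
  by rewrite exprn_ile1 ?divr_ge0 // ler_pdivrMr ?ltr0n // mul1r ler_nat.
have w1 := hw t t0 tt1; have w0 := omega_ge0 t0.
have i1 := hM2 d t dM2 t0 tt2.
have h := wsum_pair_level_ge d0 t0.
have i2 : (2 * t)^-1 = t^-1 / 2 by field; rewrite gt_eqF.
have hA : (1 - eps) * F d.+1 t < wsum (pair_level d t).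
  apply: lt_le_trans h; rewrite i2.
  move: c1 c2; set c := (_ / _) ^+ 2 => c1 c2.
  have h1 : (1 - eps / 2) * F d.+1 t <= c * (1 - omega t) * F d.+1 t.
    by rewrite ler_wpM2r ?(ltW F0) //; nra.
  nra.
apply: (bpps_lower (expR_gt0 (- t)) (bpp_gf_le d0 t0)).
rewrite bpp_gf ?q_in01 //; apply: lt_le_trans (chain_lower d0 t0).
by rewrite lte_fin ltr_expR.
Qed.

End energy.

(** * Concentration at the saddle point *)

Section chernoff.
Variable R : realType.
Implicit Types (t s e eps delta : R) (d n k N : nat).

Local Notation F m t := (free_energy m t).
Local Notation G d k := ((nbpp k d.+1)%:R : R).

(** The saddle point equation for [t = r * n ^ (- 1 / 3)], see [saddle_scaling]. *)
Definition saddle d n t := n%:R * t ^+ 3 = tanh_sum (d.+1%:R * t) - dtanh_sum (d.+1%:R * t) / 2.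

(** The function [tanh_sum] is concave and vanishes at [0], so [dtanh_sum <= tanh_sum]. *)
Lemma saddle_nt d n t : 0 < t -> saddle d n t ->
  F d.+1 t <= n%:R * t <= 2 * F d.+1 t.
Proof.
move=> t0 h; have s0 : 0 <= d.+1%:R * t by rewrite mulr_ge0 // ltW.
have K0 := dtanh_sum_ge0 s0; have KH := dtanh_sum_le s0.
have -> : n%:R * t = (n%:R * t ^+ 3) / t ^+ 2 by field; rewrite gt_eqF.
rewrite h /free_energy.
have t2 : 0 < t ^+ 2 by rewrite exprn_gt0.
have -> : tanh_sum (d.+1%:R * t) / (2 * t ^+ 2) = tanh_sum (d.+1%:R * t) / 2 / t ^+ 2 by field; rewrite gt_eqF.
by rewrite mulrA !ler_pM2r ?invr_gt0 //; apply/andP; split; lra.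
Qed.

(** A first-order expansion around the saddle point.  The concavity of
    [tanh_sum] bounds the numerator of the free energy by its tangent, and only
    the expansion of [(1 + e) ^ -2] produces the quadratic term. *)
Lemma free_energy_tilt d n t e : 0 < t -> saddle d n t -> `|e| <= 1 / 2 ->
  F d.+1 ((1 + e) * t) <= F d.+1 t - e * (n%:R * t) + 16 * e ^+ 2 * F d.+1 t.
Proof.
move=> t0 h; rewrite ler_norml => /andP[e1 e2].
have s0 : 0 < d.+1%:R * t by rewrite mulr_gt0.
have K0 := dtanh_sum_ge0 (ltW s0); have KH := dtanh_sum_le (ltW s0).
have t2 : 0 < t ^+ 2 by rewrite exprn_gt0.
have g0 : 0 < 1 + e by lra.
have v0 : 0 <= d.+1%:R * ((1 + e) * t) by rewrite !mulr_ge0 // ltW.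
have := tanh_sum_le_tangent s0 v0.
have -> : (d.+1%:R * ((1 + e) * t) - d.+1%:R * t) / (d.+1%:R * t) = e.
  rewrite [X in X / _](_ : _ = e * (d.+1%:R * t)); last by ring.
  by rewrite mulfK // gt_eqF.
have -> : n%:R * t = (n%:R * t ^+ 3) / t ^+ 2 by field; rewrite gt_eqF.
rewrite h /free_energy; set Hv := tanh_sum (_ * (_ * _)).
move: (tanh_sum (_ * t)) (dtanh_sum (_ * t)) K0 KH => h0 k0 K0 KH hv.
have -> : h0 / (2 * t ^+ 2) - e * ((h0 - k0 / 2) / t ^+ 2) + 16 * e ^+ 2 * (h0 / (2 * t ^+ 2)) =
   (h0 - e * (2 * h0 - k0) + 16 * e ^+ 2 * h0) / (2 * t ^+ 2) by field; rewrite gt_eqF.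
have -> : Hv / (2 * ((1 + e) * t) ^+ 2) = Hv / (1 + e) ^+ 2 / (2 * t ^+ 2).
  by field; rewrite !gt_eqF.
rewrite ler_pM2r ?invr_gt0 ?mulr_gt0 // ler_pdivrMr ?exprn_gt0 //.
apply: le_trans hv _.
have h00 : 0 <= h0 by lra.
(* After clearing denominators the difference is e ^ 2 times this; 16 is
   large enough because (1 + e) ^ 2 >= 1 / 4. *)
have key : 0 <= - 3 * h0 - 2 * e * h0 + 2 * k0 + e * k0 + 16 * h0 * (1 + e) ^+ 2.
  have : 1 / 4 <= (1 + e) ^+ 2 by nra.
  nra.
rewrite -subr_ge0; have -> : (h0 - e * (2 * h0 - k0) + 16 * e ^+ 2 * h0) * (1 + e) ^+ 2 - (h0 + e * k0)
  = e ^+ 2 * (- 3 * h0 - 2 * e * h0 + 2 * k0 + e * k0 + 16 * h0 * (1 + e) ^+ 2) by ring.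
by rewrite mulr_ge0 ?sqr_ge0.
Qed.

(** Each term is bounded by one of three: for [k] at most [(1 - delta) n] by
    its tilt towards small [k], for [k] at least [(1 + delta) n] by its tilt
    towards large [k], and in between by monotonicity of the counts. *)
Lemma chernoff_split d n n1 t e delta N :
  (0 < d)%N -> 0 < t -> 0 <= e -> (1 + delta) * n%:R <= n1%:R ->
  \sum_(k < N) G d k * expR (- t) ^+ k <=
    expR (e * t * ((1 - delta) * n%:R)) * \sum_(k < N) G d k * expR (- ((1 + e) * t)) ^+ k +
    expR (- (e * t * ((1 + delta) * n%:R))) * \sum_(k < N) G d k * expR (- ((1 - e) * t)) ^+ k +
    n1%:R * (G d n1 * expR (- ((1 - delta) * n%:R * t))).
Proof.
move=> d0 t0 e0 hn1.
have et0 : 0 <= e * t by rewrite mulr_ge0 // ltW.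
set C := G d n1 * _.
have C0 : 0 <= C by rewrite mulr_ge0 ?expR_ge0.
have hC : \sum_(k < N) (if (k < n1)%N then C else 0) <= n1%:R * C.
  apply: (@le_trans _ _ ((minn N n1)%:R * C)); last by rewrite ler_wpM2r // ler_nat geq_minr.
  elim: N => [|N IH]; first by rewrite big_ord0 mulr_ge0.
  rewrite big_ord_recr /=; case: ltnP => Nn.
    have -> : minn N.+1 n1 = (minn N n1).+1 by lia.
    by rewrite -natr1 mulrDl mul1r lerD.
  have -> : minn N.+1 n1 = minn N n1 by lia.
  by rewrite addr0.
apply: le_trans (lerD (lexx _) hC).
rewrite !mulr_sumr -!big_split /=; apply: ler_sum => k _.
set g := G d k; have g0 : 0 <= g by [].
set a := expR (e * t * _) * _; set b := expR (- _) * _.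
have a0 : 0 <= a by rewrite !mulr_ge0 ?exprn_ge0 ?expR_ge0.
have b0 : 0 <= b by rewrite !mulr_ge0 ?exprn_ge0 ?expR_ge0.
rewrite -expRM_natl.
have [klo|khi] := leP k%:R ((1 - delta) * n%:R).
  apply: (@le_trans _ _ a); last first.
    by rewrite -addrA lerDl addr_ge0 //; case: ifP.
  rewrite /a mulrCA ler_wpM2l // -expRM_natl -expRD ler_expR.
  have h := ler_wpM2l et0 klo; lra.
have [khi2|klo2] := leP ((1 + delta) * n%:R) k%:R.
  apply: (@le_trans _ _ b); last first.
    by rewrite -addrA [leRHS]addrCA lerDl addr_ge0 //; case: ifP.
  rewrite /b mulrCA ler_wpM2l // -expRM_natl -expRD ler_expR.
  have h := ler_wpM2l et0 khi2; lra.
have kn1 : (k < n1)%N by rewrite -(ltr_nat R) (lt_le_trans klo2).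
rewrite kn1; apply: (@le_trans _ _ C); last by rewrite lerDr addr_ge0.
rewrite /C; apply: ler_pM; [exact: g0|exact: expR_ge0| |].
  by rewrite ler_nat nbpp_homo // ltnW.
rewrite ler_expR mulrN lerN2; apply: ler_wpM2r; exact: ltW.
Qed.

(** Only the square root of the free energy is compared with the
    logarithm. *)
Lemma ln_le_free delta (f x : R) : 0 < delta -> 1024 <= delta ^+ 2 * f -> 0 < x ->
  x <= 16 * f ^+ 2 -> 0 < f -> ln x <= delta * f.
Proof.
move=> D0 fbig x0 xf f0.
pose q := Num.sqrt f.
have q0 : 0 < q by rewrite sqrtr_gt0.
have q2 : q ^+ 2 = f by rewrite sqr_sqrtr // ltW.
have qd : 32 <= delta * q.
  have : 32 ^+ 2 <= (delta * q) ^+ 2.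
    by rewrite exprMn q2 (_ : 32 ^+ 2 = 1024 :> R) //; ring.
  by rewrite ler_pXn2r // ?nnegrE // mulr_ge0 // ltW.
apply: (@le_trans _ _ (ln ((2 * q) ^+ 4))).
  rewrite ler_ln ?posrE ?exprn_gt0 ?mulr_gt0 //; apply: le_trans xf _.
  by apply: ler_of_eq; rewrite -q2; ring.
have qq0 : 0 < 2 * q by rewrite mulr_gt0.
rewrite lnXn // -[leLHS]mulr_natl -q2 expr2.
have h := ln_sublinear qq0; have h2 := ler_wpM2r (ltW q0) qd.
clear -h h2 q0; nra.
Qed.

(** The choice [e = delta / 32] minimises [16 e ^ 2 - e delta], the
    relative change of the exponent. *)
Lemma tail_exponent delta e (f fe y c : R) : e = delta / 32 -> 0 < delta -> f <= y ->
  fe <= f - e * y + 16 * e ^+ 2 * f -> c <= delta ^+ 2 / 128 * f ->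
  e * ((1 - delta) * y) + (fe + c) <= (1 - delta ^+ 2 / 128) * f.
Proof.
move=> eE D0 fy hfe hc.
have ed : e * delta * f <= e * delta * y.
  by rewrite ler_wpM2l // mulr_ge0 ?(ltW D0) // eE divr_ge0 // ltW.
have ee : (16 * e ^+ 2 - e * delta) * f = - (delta ^+ 2 / 64) * f by rewrite eE; field.
clear -ed ee hfe hc; nra.
Qed.

Lemma tilt_inv_le delta t g (f : R) : 0 < t -> 1 / 2 <= g ->
  t^-1 <= delta ^+ 2 / 1024 * f -> 4 / (g * t) <= delta ^+ 2 / 128 * f.
Proof.
move=> t0 hg inv.
apply: (@le_trans _ _ (8 * t^-1)); last by clear -inv; lra.
have g0 : 0 < g by clear -hg; lra.
have -> : 8 * t^-1 = 4 / (1 / 2 * t) by field; rewrite gt_eqF.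
rewrite ler_wpM2l // lef_pV2 ?posrE ?mulr_gt0 //.
by rewrite ler_pM2r.
Qed.

(** Both tails are at most a quarter of the total, so the middle range
    carries half of it. *)
Lemma nbpp_lower_saddle delta d n n1 N t :
  0 < delta -> delta <= 1 / 2 -> (0 < d)%N -> 0 < t -> t <= 1 -> saddle d n t ->
  (1 + delta) * n%:R <= n1%:R -> n1%:R <= 4 * n%:R :> R ->
  t^-1 <= delta ^+ 2 / 1024 * F d.+1 t ->
  expR ((1 - delta ^+ 2 / 256) * F d.+1 t) <= \sum_(k < N) G d k * expR (- t) ^+ k ->
  (1 - 2 * delta) * (n%:R * t + F d.+1 t) <= ln (G d n1).
Proof.
move=> D0 D1 d0 t0 t1 hs hn1 hn14 inv hN.
have Fp := free_energy_gt0 d t0.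
have /andP[ntl nth] := saddle_nt t0 hs.
pose e := delta / 32.
have e0 : 0 <= e by rewrite divr_ge0 // ltW.
have e1 : e <= 1 / 2 by rewrite /e; clear -D1 D0; lra.
have eh : `|e| <= 1 / 2 by rewrite ger0_norm.
have eh' : `|- e| <= 1 / 2 by rewrite normrN.
have f1 := free_energy_tilt t0 hs eh.
have f2 := free_energy_tilt t0 hs eh'; rewrite sqrrN in f2.
have t1e : 0 < (1 + e) * t by rewrite mulr_gt0 //; clear -e0; lra.
have t2e : 0 < (1 - e) * t by rewrite mulr_gt0 //; clear -e1; lra.
have u1 := gf_upper N d0 t1e.
have u2 := gf_upper N d0 t2e.
have sp := chernoff_split N d0 t0 e0 hn1.
have i1 : 4 / ((1 + e) * t) <= delta ^+ 2 / 128 * F d.+1 t.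
  by apply: tilt_inv_le => //; clear -e0; lra.
have i2 : 4 / ((1 - e) * t) <= delta ^+ 2 / 128 * F d.+1 t.
  by apply: tilt_inv_le => //; clear -e1; lra.
pose X := (1 - delta ^+ 2 / 128) * F d.+1 t.
have tail1 : expR (e * t * ((1 - delta) * n%:R)) *
    \sum_(k < N) G d k * expR (- ((1 + e) * t)) ^+ k <= expR X.
  apply: le_trans (ler_wpM2l (expR_ge0 _) u1) _; rewrite -expRD ler_expR /X.
  apply: le_trans (tail_exponent (erefl _) D0 ntl f1 i1).
  by rewrite lerD2r; apply: ler_of_eq; rewrite /e; ring.
have tail2 : expR (- (e * t * ((1 + delta) * n%:R))) *
    \sum_(k < N) G d k * expR (- ((1 - e) * t)) ^+ k <= expR X.
  apply: le_trans (ler_wpM2l (expR_ge0 _) u2) _; rewrite -expRD ler_expR /X.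
  have f3 : F d.+1 ((1 - e) * t) - 2 * e * (n%:R * t) <=
    F d.+1 t - e * (n%:R * t) + 16 * e ^+ 2 * F d.+1 t by clear -f2; lra.
  apply: le_trans (tail_exponent (erefl _) D0 ntl f3 i2).
  by apply: ler_of_eq; rewrite /e; ring.
pose Y := (1 - delta ^+ 2 / 256) * F d.+1 t.
have ti : 1 <= t^-1 by rewrite invf_ge1.
have Fbig : 1024 <= delta ^+ 2 * F d.+1 t by clear -inv ti; lra.
have XY : 4 * expR X <= expR Y.
  have -> : Y = X + delta ^+ 2 * F d.+1 t / 256 by rewrite /Y /X; field.
  rewrite expRD [leRHS]mulrC ler_wpM2r ?expR_ge0 //.
  by have h := expR_ge1Dx (delta ^+ 2 * F d.+1 t / 256); clear -h Fbig; lra.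
pose W := expR (- ((1 - delta) * n%:R * t)).
have main : expR Y / 2 <= n1%:R * (G d n1 * W).
  have h := le_trans hN sp; rewrite -/Y -/W in h; clear -h tail1 tail2 XY.
  move: h tail1 tail2; move: (_ * \sum_(k < N) _) => a.
  by move: (_ * \sum_(k < N) _) => b h h1 h2; lra.
have Y0 : 0 < expR Y / 2 by rewrite divr_gt0 ?expR_gt0.
have W0 : 0 < W by exact: expR_gt0.
have := lt_le_trans Y0 main.
have G00 : 0 <= G d n1 by [].
have n00 : 0 <= n1%:R :> R by [].
move=> prod0.
have n10 : 0 < n1%:R :> R.
  rewrite lt_neqAle n00 andbT; apply/eqP => z.
  by move: prod0; rewrite -z mul0r ltxx.
have G0 : 0 < G d n1.
  rewrite lt_neqAle G00 andbT; apply/eqP => z.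
  by move: prod0; rewrite -z mul0r mulr0 ltxx.
have n1F : 2 * n1%:R <= 16 * F d.+1 t ^+ 2.
  have hh : n%:R <= 2 * F d.+1 t * t^-1 by rewrite ler_pdivlMr.
  have t1F : t^-1 <= F d.+1 t.
    have c1 : delta ^+ 2 / 1024 <= 1 by clear -D0 D1; nra.
    by apply: le_trans inv _; rewrite -[leRHS]mul1r; apply: (ler_wpM2r (ltW Fp)); exact: c1.
  have h2 : 2 * F d.+1 t * t^-1 <= 2 * F d.+1 t * F d.+1 t by rewrite ler_wpM2l // mulr_ge0 // ltW.
  rewrite expr2; clear -hh h2 hn14; lra.
have lnb : ln (2 * n1%:R) <= delta * F d.+1 t.
  by apply: ln_le_free => //; exact: mulr_gt0.
have : ln (expR Y / 2) <= ln (n1%:R * (G d n1 * W)) by rewrite ler_ln.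
rewrite ln_div ?posrE ?expR_gt0 // expRK lnM ?posrE ?(mulr_gt0 G0 W0) //.
rewrite lnM ?posrE // expRK.
move: lnb; rewrite lnM ?posrE // => lnb hfin.
have hY : (1 - delta) * F d.+1 t <= Y.
  have c1 : 1 - delta <= 1 - delta ^+ 2 / 256 by clear -D0 D1; nra.
  by apply: (ler_wpM2r (ltW Fp)); exact: c1.
have dnt : 0 <= delta * (n%:R * t) by rewrite mulr_ge0 ?(ltW D0) // (le_trans (ltW Fp)).
clear -hfin lnb hY dnt; lra.
Qed.

(** At the saddle point [n t ^ 3 <= zeta 3], so [t] is small as soon as [n] is
    large, uniformly in the width. *)
Lemma nbpp_lower delta : 0 < delta -> delta <= 1 / 2 ->
  exists M n0 : nat, forall d n n1 t, (M <= d)%N -> (n0 <= n)%N -> 0 < t -> saddle d n t ->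
  (1 + delta) * n%:R <= n1%:R -> n1%:R <= 4 * n%:R :> R ->
  (1 - 2 * delta) * (n%:R * t + F d.+1 t) <= ln (G d n1) /\ 4 / t <= delta * F d.+1 t.
Proof.
move=> D0 D1; have D2 := exprn_gt0 2 D0.
have eps0 : 0 < delta ^+ 2 / 256 by clear -D2; lra.
have eps20 : 0 < delta ^+ 2 / 1024 by clear -D2; lra.
have [M1 [tau1 tau10 hlow]] := gf_lower eps0.
have [M2 [tau2 tau20 hinv]] := inv_le_free_energy eps20.
pose tau := Num.min 1 (Num.min tau1 tau2).
have tau0 : 0 < tau by rewrite !lt_min tau10 tau20 ltr01.
exists (maxn 1 (maxn M1 M2)), (Num.truncn (2 / tau ^+ 3)).+1.
move=> d n n1 t; rewrite !geq_max => /andP[d0 /andP[dM1 dM2]] nn t0 hs hn1 hn14.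
have s0 : 0 < d.+1%:R * t by rewrite mulr_gt0.
have n2 : 2 / tau ^+ 3 < n%:R.
  by apply: lt_le_trans (truncnS_gt _) _; rewrite ler_nat.
have ttau : t <= tau.
  rewrite leNgt; apply/negP => tt.
  have h1 : n%:R * t ^+ 3 <= 2.
    rewrite hs; apply: le_trans (saddle_rhs_le (ltW s0)) _.
    exact: le_trans (tanh_sum_le_zeta3 (ltW s0)) (zeta3_le2 R).
  move: n2; rewrite ltr_pdivrMr ?exprn_gt0 // ltNge => /negP; apply.
  apply: le_trans h1; rewrite ler_wpM2l //; apply: lerXn2r; rewrite ?nnegrE; exact: ltW.
move: ttau; rewrite !le_min => /andP[t1 /andP[tt1 tt2]].
have inv := hinv d t dM2 t0 tt2.
have [N hN] := hlow d t dM1 d0 t0 tt1.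
split; first exact: nbpp_lower_saddle inv hN.
have Fp := free_energy_gt0 d t0.
apply: (@le_trans _ _ (4 * (delta ^+ 2 / 1024 * F d.+1 t))); first by rewrite ler_wpM2l.
have c1 : 4 * (delta ^+ 2 / 1024) <= delta by clear -D0 D1 D2; nra.
by rewrite mulrA; apply: (ler_wpM2r (ltW Fp)); exact: c1.
Qed.

End chernoff.

(** * Uniform asymptotics *)

Section final.
Variable R : realType.
Implicit Types (d n : nat).

Local Notation F m t := (free_energy m t).
Local Notation G d k := ((nbpp k d.+1)%:R : R).

Section scaling.
Variable r : R -> R.
Hypothesis hr : forall a : R, 0 < a -> 0 < r a /\ saddle_eq a (r a).

Definition saddle_point d n : R := r (alpha R n d.+1) * n%:R `^ (- (1 / 3)).

(** Substitute [t = r n ^ (- 1 / 3)], so that the product of the width and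
    [t] is [alpha * r]. *)
Lemma saddle_scaling d n : (0 < n)%N -> let a := alpha R n d.+1 in
  let t := saddle_point d n in
  [/\ 0 < t, saddle d n t & n%:R `^ (2 / 3) * growth a (r a) = n%:R * t + F d.+1 t].
Proof.
move=> n0 a t; have np : 0 < n%:R :> R by rewrite ltr0n.
pose c : R := n%:R `^ (- (1 / 3)).
have c0 : 0 < c by rewrite powR_gt0.
have a0 : 0 < a by rewrite mulr_gt0 ?ltr0n.
have [r0 _] := hr a0.
have tE : t = r a * c by [].
have t0 : 0 < t by rewrite mulr_gt0.
have c3 : c ^+ 3 = n%:R^-1.
  rewrite -powR_mulrn ?powR_ge0 // -powRrM (_ : - (1 / 3) * 3 = - 1); last by field.
  by rewrite powR_inv1 // ltW.
have c2 : n%:R `^ (2 / 3) = n%:R * c.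
  have -> : 2 / 3 = 1 + - (1 / 3) :> R by field.
  have cond : (1 + - (1 / 3) == 0 :> R) ==> (n%:R != 0 :> R) by rewrite (gt_eqF np) implybT.
  by rewrite (powRD cond) (powRr1 (ltW np)).
have mt : d.+1%:R * t = a * r a by rewrite tE /a /alpha -/c mulrCA mulrC.
split => //.
  rewrite /saddle mt -(saddle_cube hr a0) tE exprMn c3 mulrCA mulfV ?mulr1 //.
  by rewrite gt_eqF.
rewrite growthE // c2 /free_energy mt tE.
have nE : n%:R = (c ^+ 3)^-1 by rewrite c3 invrK.
rewrite nE; field; by rewrite !gt_eqF.
Qed.

(** Lower bounds are available at [(1 + delta)] times an index: at [n] from
    the saddle point [t'] of [n'], and at [n1] from that of [n].  The upper
    bound at [n1] with parameter [t'] closes the chain of inequalities. *)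
Lemma nbpp_asymptotics delta : 0 < delta -> delta <= 1 / 2 ->
  exists M n0 : nat, forall d n, (M <= d)%N -> (n0 <= n)%N ->
  `| ln (G d n) / n%:R `^ (2 / 3) / growth (alpha R n d.+1) (r (alpha R n d.+1)) - 1|
    <= 8 * delta.
Proof.
move=> D0 D1; have [M [n0 low]] := nbpp_lower D0 D1.
exists M.+1; exists (Num.truncn (2 * (3 / delta + n0%:R + 3))).+1 => d n Md nn.
have dM : (M <= d)%N by exact: ltnW.
have d0 : (0 < d)%N by exact: leq_ltn_trans (leq0n M) Md.
have nb : 2 * (3 / delta + n0%:R + 3) <= n%:R.
  by apply: le_trans (ltW (truncnS_gt _)) _; rewrite ler_nat.
have di : 0 < 3 / delta by rewrite divr_gt0.
have n00 : 0 <= n0%:R :> R by [].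
have ng : 6 <= n%:R :> R by clear -nb di n00; lra.
have np : (0 < n)%N by rewrite -(ltr0n R); clear -ng; lra.
have gd : 0 < 1 + delta by clear -D0; lra.
(* The largest index with (1 + delta) n' <= n. *)
pose n' := Num.truncn (n%:R / (1 + delta)).
have q0 : 0 <= n%:R / (1 + delta) by rewrite divr_ge0 // ltW.
have /andP[l1 l2] := truncn_itv q0.
rewrite -/n' ler_pdivlMr // in l1; rewrite -/n' ltr_pdivrMr // -natr1 in l2.
have n'b : 3 / delta + n0%:R <= n'%:R by clear -nb l2 D0 D1 di n00; nra.
have n'0 : (n0 <= n')%N by rewrite -(ler_nat R); clear -n'b di; lra.
have n'p : (0 < n')%N by rewrite -(ltr0n R); clear -n'b di n00; lra.
have dn' : 3 <= delta * n'%:R.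
  have h : 3 / delta <= n'%:R by clear -n'b n00; lra.
  by rewrite ler_pdivrMr // mulrC in h.
(* An index just above (1 + delta) n. *)
pose n1 := (Num.truncn ((1 + delta) * n%:R)).+1.
have q1 : 0 <= (1 + delta) * n%:R by rewrite mulr_ge0 // ltW.
have /andP[l3 l4] := truncn_itv q1.
have n1b : n1%:R <= (1 + delta) * n%:R + 1 by rewrite /n1 -natr1 lerD2r.
have n1n' : n1%:R <= (1 + 4 * delta) * n'%:R.
  clear -n1b l2 dn' D0 D1 gd.
  have h : (1 + delta) * n%:R <= (1 + delta) * ((n'%:R + 1) * (1 + delta)).
    by apply: ler_wpM2l; exact: ltW.
  have h2 : delta * delta <= delta / 2 by nra.
  have h3 : delta * delta * n'%:R <= delta / 2 * n'%:R by rewrite ler_wpM2r.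
  nra.
have n0n : (n0 <= n)%N.
  by rewrite -(ler_nat R); clear -nb di n00; lra.
have [t0 hs hL] := saddle_scaling d np.
have [t'0 hs' _] := saddle_scaling d n'p.
set t := saddle_point d n in t0 hs hL; set t' := saddle_point d n' in t'0 hs'.
have l1' : (1 + delta) * n'%:R <= n%:R by rewrite mulrC.
have n4 : n%:R <= 4 * n'%:R :> R by clear -l2 dn' D0 D1; nra.
have n14 : n1%:R <= 4 * n%:R :> R by clear -n1b D1 ng; nra.
have [low1 t'F] := low d n' n t' dM n'0 t'0 hs' l1' n4.
have [low2 tF] := low d n n1 t dM n0n t0 hs (ltW l4) n14.
have up1 := ln_nbpp_le n d0 t0.
have up2 := ln_nbpp_le n1 d0 t'0.
have Fp := free_energy_gt0 d t0; have F'p := free_energy_gt0 d t'0.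
have nt0 : 0 <= n%:R * t by rewrite mulr_ge0 // ltW.
have nt'0 : 0 <= n'%:R * t' by rewrite mulr_ge0 // ltW.
pose L := n%:R * t + F d.+1 t; pose L' := n'%:R * t' + F d.+1 t'.
have L0 : 0 < L by clear -Fp nt0; rewrite /L; lra.
have L'0 : 0 < L' by clear -F'p nt'0; rewrite /L'; lra.
have U1 : ln (G d n) <= (1 + delta) * L.
  have h := mulr_ge0 (ltW D0) nt0; clear -up1 tF h; rewrite /L; lra.
have U2 : ln (G d n1) <= (1 + 4 * delta) * L'.
  have h := ler_wpM2r (ltW t'0) n1n'; have h2 := mulr_ge0 (ltW D0) (ltW F'p).
  clear -up2 t'F h h2; rewrite /L'; lra.
rewrite -/L' in low1; rewrite -/L in low2.
have LL : (1 - 2 * delta) * L <= (1 + 4 * delta) * L' by exact: le_trans low2 U2.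
have low3 : (1 - 8 * delta) * L <= ln (G d n).
  apply: le_trans low1.
  have e1 : 0 <= 1 - 2 * delta by clear -D1; lra.
  have h := ler_wpM2l e1 LL.
  have h2 : (1 - 8 * delta) * (1 + 4 * delta) * L <= (1 - 2 * delta) * (1 - 2 * delta) * L.
    rewrite ler_wpM2r ?(ltW L0) //; clear -D0; nra.
  have p4 : 0 < 1 + 4 * delta by clear -D0; lra.
  rewrite -(ler_pM2l p4); clear -h h2; lra.
have hn : 0 < n%:R `^ (2 / 3) :> R by rewrite powR_gt0 // ltr0n.
have LE : L = n%:R `^ (2 / 3) * growth (alpha R n d.+1) (r (alpha R n d.+1)) by rewrite hL.
have e : ln (G d n) / n%:R `^ (2 / 3) / growth (alpha R n d.+1) (r (alpha R n d.+1)) - 1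
    = (ln (G d n) - L) / L.
  rewrite LE in L0 *; move: L0 hn; move: (_ `^ _) (growth _ _) (ln _) => A B C AB A0.
  have B0 : 0 < B by rewrite pmulr_rgt0 in AB.
  by field; rewrite !gt_eqF.
rewrite e normrM normfV (ger0_norm (ltW L0)) ler_pdivrMr // ler_norml.
have dL := mulr_ge0 (ltW D0) (ltW L0).
by apply/andP; split; clear -U1 low3 dL; lra.
Qed.

End scaling.
End final.

Theorem theorem1p1 (R : realType) :
  (forall a : R, 0 < a -> exists2 r : R, 0 < r & saddle_eq a r) /\
  forall r : R -> R,
    (forall a : R, 0 < a -> 0 < r a /\ saddle_eq a (r a)) ->
    [/\ forall w : nat -> R, w @ \oo --> +oo ->
          forall eps : R, 0 < eps ->
            \forall n \near \oo, forall m : nat, (3 <= m)%N ->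
              w n * n%:R `^ (- (1 / 3)) <= alpha R n m ->
              `| ln (nbpp n m)%:R / n%:R `^ (2 / 3)
                 / growth (alpha R n m) (r (alpha R n m)) - 1 | <= eps,
        (fun a : R => growth a (r a)
           / (pi / Num.sqrt 6 * Num.sqrt a)) @ 0^'+ --> (1 : R)
      & (fun a : R => growth a (r a)
           / (3 / 2 * zeta 3 `^ (1 / 3))) @ +oo --> (1 : R)].
Proof.
split; first exact: saddle_exists.
move=> r hr; split; [|exact: growth_at_0|exact: growth_at_infty].
move=> w winf eps e0.
pose delta := Num.min (1 / 2) (eps / 8).
have D0 : 0 < delta by rewrite lt_min; apply/andP; split; lra.
have D1 : delta <= 1 / 2 by rewrite ge_min lexx.
have D2 : delta <= eps / 8 by rewrite ge_min lexx orbT.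
have [M [n0 hM]] := nbpp_asymptotics hr D0 D1.
near=> n => -[|d] // m3 hw.
have wn : M.+2%:R <= w n by near: n; move/cvgryPge : winf; exact.
have np : (0 < n)%N by near: n; exact: nbhs_infty_gt.
have c0 : 0 < n%:R `^ (- (1 / 3)) :> R by rewrite powR_gt0 // ltr0n.
rewrite ler_pM2r // in hw.
have Md : (M <= d)%N.
  by have := le_trans wn hw; rewrite ler_nat => /ltnW.
apply: le_trans (hM d n Md _) _; last by lra.
by near: n; exact: nbhs_infty_ge.
Unshelve. all: by end_near.
Qed.
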